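(* Let $f,g_1,g_2$ denote the densities of $N(0,1)$, $N(-1,1)$, $N(1,1)$ respectively, and let $H_0:\mu=0$, $H_1:\mu=\pm1$. Let $I_f$ and $I_g$ be the constants defined in the context ($I_f\approx 0.3137$, $I_g\approx 0.3186$). Let $\{\delta(c)\}$ be any family of decentralized sequential tests of $H_0$ versus $H_1$, indexed by small $c>0$, with stopping time $N$ and decision $d$ (depending on $c$), such that for every $\varphi\in\{f,g_1,g_2\}$, $$\mathbf{P}_\varphi(\text{decision incorrect})=O(c\log c)\quad\text{as } c\to0 .$$ Then, as $c\to0$, $$\mathbf{E}_f(N)\ \ge\ (1+o(1))\frac{|\log c|}{I_f},\qquad \mathbf{E}_{g_1}(N)\ \ge\ (1+o(1))\frac{|\log c|}{I_g},\qquad \mathbf{E}_{g_2}(N)\ \ge\ (1+o(1))\frac{|\log c|}{I_g}.$$ Moreover, the tests $\{\delta_I(c)\}$ defined in the context attain all three lower bounds simultaneously, i.e. the stopping time $N$ of $\delta_I(c)$ satisfies, as $c\to 0$, $\mathbf{E}_f(N)=(1+o(1))|\log c|/I_f$ and $\mathbf{E}_{g_i}(N)=(1+o(1))|\log c|/I_g$ for $i=1,2$.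
   Context: **Model.** $X_1,X_2,\dots$ are i.i.d. $N(\mu,1)$. $\mathbf{P}_f,\mathbf{P}_{g_1},\mathbf{P}_{g_2}$ (with expectations $\mathbf{E}_f,\mathbf{E}_{g_1},\mathbf{E}_{g_2}$) are the probability measures when $\mu=0,-1,1$ respectively. $I(A)$ is the indicator of the event $A$; $\log$ is the natural logarithm. **Decentralized sequential test.** It consists of: quantizers $\phi_n$ and feedback functions $\psi_n$ producing binary messages $U_n=\phi_n(X_n;V_{n-1})\in\{0,1\}$, where the feedback $V_{n-1}=\psi_n(U_1,\dots,U_{n-1})$ depends only on past messages (no restriction on the range of $V_{n-1}$); a stopping time $N$ at the fusion center, based on the messages $U_1,U_2,\dots$; and a decision $d\in\{0,1\}$ (for $H_0$, $H_1$) based on the information received by the fusion center up to time $N$. ''Decision incorrect'' means $d=1$ under $\mathbf{P}_f$, and $d=0$ under $\mathbf{P}_{g_1}$ or $\mathbf{P}_{g_2}$. **Constants.** For $\lambda\in\mathbb{R}$ and $\varphi\in\{f,g_1,g_2\}$ let $p_\lambda(\varphi)=\mathbf{P}_\varphi(X_1\ge\lambda)$, and for $p,q\in(0,1)$ let $\mathrm{kl}(p,q)=p\log\frac pq+(1-p)\log\frac{1-p}{1-q}$. Put $$I_f=\mathrm{kl}(p_0(f),p_0(g_1))=\mathrm{kl}(p_0(f),p_0(g_2))\approx 0.3137,\qquad I_g=\sup_{\lambda\in\mathbb{R}}\mathrm{kl}(p_\lambda(g_2),p_\lambda(f))\approx0.3186,$$ and let $\lambda^*\approx 0.7941$ be the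 value of $\lambda$ attaining the supremum defining $I_g$. **The test $\delta_I(c)$.** Fix a prior $\pi=(\pi_f,\pi_{g_1},\pi_{g_2})$ with positive entries summing to $1$, and positive costs of incorrect decisions $W_f,W_{g_1},W_{g_2}$. Let $u(c)\in(0,1/2)$ satisfy $u(c)\to0$ and $\log u(c)/\log c\to0$ as $c\to0$. Let $(\pi_{f,n},\pi_{g_1,n},\pi_{g_2,n})$ be the posterior distribution of the three densities given $U_1,\dots,U_n$, starting from $\pi$ and updated recursively by Bayes' rule: for $j\in\{f,g_1,g_2\}$, upon observing $U_n=u$, $$\pi_{j,n}=\frac{\pi_{j,n-1}\mathbf{P}_j(U_n=u)}{\sum_{i\in\{f,g_1,g_2\}}\pi_{i,n-1}\mathbf{P}_i(U_n=u)},$$ where the probabilities are those induced by the quantizer used at time $n$. *First stage:* the sensor uses $U_n=I(X_n\ge0)$. The stage stops at $N_1=\min\{n\ge1:\max\{\pi_{f,n},\pi_{g_1,n},\pi_{g_2,n}\}\ge1-u(c)\}$, and the fusion center makes a preliminary decision $d^0\in\{f,g_1,g_2\}$ with $\pi_{d^0,N_1}=\max\{\pi_{f,N_1},\pi_{g_1,N_1},\pi_{g_2,N_1}\}$. *Second stage:* $d^0$ is sent to the sensor as a one-shot feedback, and for all $n>N_1$ the sensor uses $U_n=\phi^*_{d^0}(X_n)$, where $\phi_f^*(X)=I(X\ge0)$, $\phi_{g_1}^*(X)=I(X\ge-\lambda^* )$, $\phi_{g_2}^*(X)=I(X\ge\lambda^* )$. The posterior continues to be updated, and the test stops at $$N=\min\Big\{n\ge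 N_1:\ \frac{\pi_{f,n}W_f}{\pi_{g_1,n}W_{g_1}+\pi_{g_2,n}W_{g_2}}\notin(c,1/c)\Big\},$$ with $d=0$ if the ratio is $\ge 1/c$ and $d=1$ if it is $\le c$. *)

(* Defs.v *)
From mathcomp Require Import all_boot all_order all_algebra.
From mathcomp Require Import all_classical all_reals all_analysis.
Import Order.TTheory GRing.Theory Num.Theory.
Import numFieldNormedType.Exports.

Set Implicit Arguments.
Unset Strict Implicit.
Unset Printing Implicit Defensive.

Local Open Scope classical_set_scope.
Local Open Scope ring_scope.

(* [df], [dg1], [dg2] stand for f, g_1, g_2: N(0,1), N(-1,1), N(1,1). *)
Inductive density := df | dg1 | dg2.

Definition mean {R : realType} (j : density) : R :=
  match j with df => 0 | dg1 => -1 | dg2 => 1 end.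

(* Independence is the product rule over every finite subfamily. Throughout, time
   is 0-based: [X n] is the observation X_(n+1). *)
Definition mutually_independent {R : realType} {d} {Omega : measurableType d}
    (P : probability Omega R) (X : nat -> Omega -> R) : Prop :=
  forall (s : seq nat) (A : nat -> set R), uniq s ->
    (forall i, measurable (A i)) ->
    P (\bigcap_(i in [set` s]) (X i @^-1` A i)) =
    (\prod_(i <- s) P (X i @^-1` A i))%E.

Definition iid_normal {R : realType} {d} {Omega : measurableType d}
    (P : density -> probability Omega R) (X : nat -> Omega -> R) : Prop :=
  (forall n, measurable_fun [set: Omega] (X n)) /\
  forall j, mutually_independent (P j) X /\
    (forall n (A : set R), measurable A ->
       P j (X n @^-1` A) = normal_prob (mean j) 1 A).

(* [quantize n x v] is phi_(n+1)(x; v); [feed h] is the feedback psi applied to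
   the list [h] of all past messages, oldest first (its length gives the time
   index). The feedback type carries no sigma-algebra: at each time the feedback
   takes finitely many values, so measurability in [x] alone is needed. *)
Record sensor (R : realType) := Sensor {
  feedback : Type;
  feed : seq bool -> feedback;
  quantize : nat -> R -> feedback -> bool;
  measurable_quantize : forall n v,
    measurable_fun [set: R] (fun x => quantize n x v) }.

Section messages.
Context {R : realType} {Omega : Type} (X : nat -> Omega -> R) (s : sensor R).

Fixpoint history (n : nat) (w : Omega) : seq bool :=
  if n is m.+1 then
    rcons (history m w) (quantize m (X m w) (feed s (history m w)))
  else [::].

Definition message (n : nat) (w : Omega) : bool :=
  quantize n (X n w) (feed s (history n w)).

(* The sigma-algebra generated by the first [n] messages. *)
Definition message_sigma (n : nat) : set (set Omega) :=
  g_sigma_preimage (fun i : 'I_n => message i).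

End messages.

(* [stop w = None] when the test never stops. [decision w = true] accepts H_1.
   The decision is only meaningful, and only constrained, when the test stops. *)
Record seq_test (R : realType) (Omega : Type) (X : nat -> Omega -> R) := SeqTest {
  test_sensor : sensor R;
  stop : Omega -> option nat;
  decision : Omega -> bool;
  stop_adapted : forall n,
    message_sigma X test_sensor n [set w | stop w = Some n];
  decision_adapted : forall n b,
    message_sigma X test_sensor n [set w | stop w = Some n /\ decision w = b] }.

Definition incorrect {R : realType} {Omega : Type} {X : nat -> Omega -> R}
    (delta : seq_test X) (j : density) : set Omega :=
  [set w | stop delta w <> None /\
           decision delta w = (if j is df then true else false)].

Definition time_ereal {R : realType} (o : option nat) : \bar R :=
  if o is Some n then n%:R%:E else +oo%E.

Definition expected_time {R : realType} {d} {Omega : measurableType d}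
    {X : nat -> Omega -> R} (P : probability Omega R) (delta : seq_test X) : \bar R :=
  (\int[P]_w time_ereal (stop delta w))%E.

(* [r] is the o(1) of E(c) >= (1 + o(1)) a(c), resp. E(c) = (1 + o(1)) a(c),
   as c -> 0+; E(c) may be +oo in the former. *)
Definition asymp_ge {R : realType} (E : R -> \bar R) (a : R -> R) : Prop :=
  exists2 r : R -> R, r c @[c --> (0:R)^'+] --> (0:R) &
    \forall c \near (0:R)^'+, (((1 + r c) * a c)%:E <= E c)%E.

Definition asymp_eq {R : realType} (E : R -> \bar R) (a : R -> R) : Prop :=
  exists2 r : R -> R, r c @[c --> (0:R)^'+] --> (0:R) &
    \forall c \near (0:R)^'+, E c = ((1 + r c) * a c)%:E.

Definition kl {R : realType} (p q : R) : R :=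
  p * ln (p / q) + (1 - p) * ln ((1 - p) / (1 - q)).

Definition tail_prob {R : realType} (lam : R) (j : density) : R :=
  fine (normal_prob (mean j) 1 `[lam, +oo[).

Definition info_f (R : realType) : R := kl (tail_prob 0 df) (tail_prob 0 dg1).

Definition info_g (R : realType) : R :=
  sup (range (fun lam : R => kl (tail_prob lam dg2) (tail_prob lam df))).

(* [lam] is a value lambda^* at which the supremum is attained. *)
Definition attains_info_g {R : realType} (lam : R) : Prop :=
  kl (tail_prob lam dg2) (tail_prob lam df) = info_g R.

(* A test given by a sensor and by rules on the message history: stop at the
   first [n] at which [stop_rule] holds of the first [n] messages. *)
Section rules.
Context {R : realType} {Omega : Type} (X : nat -> Omega -> R) (s : sensor R).
Variables stop_rule decision_rule : seq bool -> bool.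

Definition rule_stop (w : Omega) : option nat :=
  match pselect (exists n, stop_rule (history X s n w)) with
  | left e => Some (ex_minn e)
  | right _ => None
  end.

Definition rule_decision (w : Omega) : bool :=
  if rule_stop w is Some n then decision_rule (history X s n w) else false.

Lemma size_history n w : size (history X s n w) = n.
Proof. by elim: n => //= n IH; rewrite size_rcons IH. Qed.

Lemma take_history m n w : (m <= n)%N ->
  take m (history X s n w) = history X s m w.
Proof.
elim: n => [|n IH]; first by rewrite leqn0 => /eqP ->.
rewrite leq_eqVlt => /orP[/eqP ->|mn]; first by rewrite take_oversize// size_history.
by rewrite /= -cats1 takel_cat ?size_history// IH.
Qed.

Lemma message_sigma_sub m n : (m <= n)%N ->
  message_sigma X s m `<=` message_sigma X s n.
Proof.
move=> mn; apply: sub_sigma_algebra2 => A.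
rewrite (big_ord_widen n (fun i => preimage_set_system setT (message X s i) measurable) mn).
rewrite -bigcup_seq_cond -bigcup_seq => -[i /= /andP[_ im] Ai].
by exists i => //=; rewrite mem_index_enum.
Qed.

Lemma message_sigmaU n A B : message_sigma X s n A -> message_sigma X s n B ->
  message_sigma X s n (A `|` B).
Proof.
move=> mA mB; rewrite -bigcup2E; apply: sigma_algebra_bigcup => -[|[|k]] //=.
exact: sigma_algebra0.
Qed.

Lemma message_sigmaC n A : message_sigma X s n A -> message_sigma X s n (~` A).
Proof. by rewrite -setTD; exact: sigma_algebraCD. Qed.

Lemma message_sigmaI n A B : message_sigma X s n A -> message_sigma X s n B ->
  message_sigma X s n (A `&` B).
Proof.
move=> mA mB; rewrite -[_ `&` _]setCK setCI; apply: message_sigmaC.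
by apply: message_sigmaU; exact: message_sigmaC.
Qed.

Lemma message_sigma_message n b :
  message_sigma X s n.+1 [set w | message X s n w = b].
Proof.
apply: sub_sigma_algebra; rewrite -bigcup_seq; exists (@ord_max n) => /=.
  by rewrite mem_index_enum.
by exists [set b] => //; rewrite setTI.
Qed.

Lemma message_sigma_history n (B : set (seq bool)) :
  message_sigma X s n [set w | B (history X s n w)].
Proof.
elim: n B => [|n IH] B.
  have [B0|nB0] := pselect (B [::]).
    rewrite (_ : mkset _ = setT); last by apply/seteqP; split.
    by rewrite -setC0; apply: message_sigmaC; exact: sigma_algebra0.
  rewrite (_ : mkset _ = set0); last by apply/seteqP; split.
  exact: sigma_algebra0.
pose C b := [set w | [set h | B (rcons h b)] (history X s n w)]
            `&` [set w | message X s n w = b].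
rewrite (_ : mkset _ = C true `|` C false).
  by apply: message_sigmaU; apply: message_sigmaI; try exact: message_sigma_message;
    apply: (message_sigma_sub (leqnSn n)); exact: IH.
apply/seteqP; split=> w /=.
  rewrite -/(message X s n w) /C /=.
  by case: (message X s n w) => ?; [left|right].
by rewrite -/(message X s n w) /C /= => -[] [] /[swap] ->.
Qed.

Lemma rule_stopP n w : rule_stop w = Some n <->
  stop_rule (history X s n w) /\
  (forall m, (m < n)%N -> ~~ stop_rule (take m (history X s n w))).
Proof.
rewrite /rule_stop; case: pselect => [e|ne]; last first.
  by split=> // -[sn _]; case: ne; exists n.
case: ex_minnP => k sk kmin; split=> [[<-]|[sn nmin]].
  split=> // m mk; rewrite take_history; last exact: ltnW.
  by apply: contraL mk => /kmin; rewrite -leqNgt.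
congr Some; apply/eqP; rewrite eqn_leq kmin//= leqNgt; apply/negP => kn.
by move/negP: (nmin _ kn); rewrite take_history// ltnW.
Qed.

Lemma rule_stop_adapted n : message_sigma X s n [set w | rule_stop w = Some n].
Proof.
rewrite (_ : mkset _ = [set w | [set h | stop_rule h /\
  forall m, (m < n)%N -> ~~ stop_rule (take m h)] (history X s n w)]).
  exact: message_sigma_history.
by apply/seteqP; split=> w /rule_stopP.
Qed.

Lemma rule_decision_adapted n b : message_sigma X s n
  [set w | rule_stop w = Some n /\ rule_decision w = b].
Proof.
rewrite (_ : mkset _ = [set w | rule_stop w = Some n] `&`
   [set w | [set h | decision_rule h = b] (history X s n w)]).
  by apply: message_sigmaI; [exact: rule_stop_adapted|exact: message_sigma_history].
by apply/seteqP; split=> w [sn] /=; rewrite /rule_decision sn.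
Qed.

Definition rule_test : seq_test X :=
  SeqTest rule_stop_adapted rule_decision_adapted.

End rules.

Section two_stage_test.
Context {R : realType}.
Variables (prior W : density -> R) (lamstar : R).

Definition threshold (v : option density) : R :=
  match v with
  | None | Some df => 0
  | Some dg1 => - lamstar
  | Some dg2 => lamstar
  end.

Definition two_stage_quantize (x : R) (v : option density) : bool :=
  threshold v <= x.

Definition message_prob (v : option density) (b : bool) (j : density) : R :=
  fine (normal_prob (mean j) 1 [set x | two_stage_quantize x v = b]).

Definition bayes (p : density -> R) (v : option density) (b : bool) (j : density) : R :=
  p j * message_prob v b j /
  (p df * message_prob v b df + p dg1 * message_prob v b dg1
   + p dg2 * message_prob v b dg2).

Definition max3 (p : density -> R) : R :=
  Num.max (p df) (Num.max (p dg1) (p dg2)).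

(* When used below, max3 p >= 1 - u(c) > 1/2, so the maximum is unique and the
   order of the tests is immaterial. *)
Definition argmax3 (p : density -> R) : density :=
  if p df == max3 p then df else if p dg1 == max3 p then dg1 else dg2.

(* The state is the current posterior together with the feedback: [None] during
   the first stage, [Some d0] from the preliminary decision d0 on. The constant
   [uc] is the value u(c). *)
Definition update (uc : R) (st : (density -> R) * option density) (b : bool) :
    (density -> R) * option density :=
  let p := bayes st.1 st.2 b in
  (p, if st.2 is Some d0 then Some d0
      else if 1 - uc <= max3 p then Some (argmax3 p) else None).

Definition state (uc : R) (h : seq bool) : (density -> R) * option density :=
  foldl (update uc) (prior, None) h.

Definition posterior_ratio (p : density -> R) : R :=
  p df * W df / (p dg1 * W dg1 + p dg2 * W dg2).

Lemma measurable_two_stage_quantize (n : nat) (v : option density) :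
  measurable_fun [set: R] (fun x => two_stage_quantize x v).
Proof. exact: measurable_realfun.measurable_fun_ler. Qed.

Definition two_stage_sensor (uc : R) : sensor R :=
  Sensor (fun h => (state uc h).2) measurable_two_stage_quantize.

Definition two_stage_stop (uc c : R) (h : seq bool) : bool :=
  (state uc h).2 && (posterior_ratio (state uc h).1 \notin `]c, c^-1[).

Definition two_stage_decision (uc c : R) (h : seq bool) : bool :=
  ~~ (c^-1 <= posterior_ratio (state uc h).1).

Definition delta_I {Omega : Type} (X : nat -> Omega -> R) (u : R -> R) (c : R) :
    seq_test X :=
  rule_test X (two_stage_sensor (u c)) (two_stage_stop (u c) c)
    (two_stage_decision (u c) c).

End two_stage_test.

(* Main.v *)
(* The law of the message history is a binary tree whose branching probabilities
   at each node are those of the quantization cell used there, so that expectations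
   of stopping times and error probabilities satisfy recursions along the tree.

   Lower bounds. By induction along the tree and the two-point Donsker-Varadhan
   inequality, the information accumulated until stopping, which is at most the
   maximal information per message times E(N), dominates (1 + o(1)) |log c| when the
   errors are O(c log c). Under g_i the maximal information of a message against f is
   I_g, by the Neyman-Pearson lemma. Under f both alternatives must be excluded,
   so only the sum of the two divergences matters; it is at most 2 I_f for
   every quantizer. For a threshold this is a monotonicity statement proved by
   differentiating in the threshold; a general cell is compared with a threshold cell
   when the alternatives lie on opposite sides of p_f, and otherwise its
   information is small because densities of N(-1,1) and N(1,1) multiply to 1/e times
   the squared density of N(0,1).

   Attainment. A change of measure along the tree gives errors O(c). The expected
   stopping time is bounded by a superharmonic potential built from the logarithm
   of a sum of small powers of likelihood ratios: by Jensen's inequality it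
   decreases at a rate close to the divergence of the current quantizer, and it stays
   above -|log c| - O(1), up to scaling, while the test runs. The first stage costs
   O(|log u|), and a wrong preliminary decision has probability O(u). *)

Require Import Defs.
From mathcomp Require Import all_boot all_order all_algebra.
From mathcomp Require Import all_classical all_reals all_analysis.
From mathcomp Require Import measurable_realfun ring lra.
From HB Require Import structures.
Import Order.TTheory GRing.Theory Num.Theory.
Import numFieldNormedType.Exports.

Set Implicit Arguments.
Unset Strict Implicit.
Unset Printing Implicit Defensive.

Local Open Scope classical_set_scope.
Local Open Scope ring_scope.

(** * The normal distribution function *)

(** Under f no bound per alternative is available: moving the threshold away from 0 raises one of
    the two divergences above I_f at the expense of the other, so the whole difficulty is that
    threshold 0 maximises their sum. The derivative of that sum splits into a term signed by the
    convexity of the log-odds and a comparison of two adjacent windows of length 1. In logarithmic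
    form the comparison sets a growth of at least 3/4 of a conditional mean (Popoviciu) against two
    terms that must be at most 3/8 each; this is what the Mills-type inequalities and their rational
    constants serve. The other numerical target is 3/5, a round number just below 2 I_f, about
    0.627, for cells with both alternatives on the same side of p_f.

    Expectations are truncated at a horizon r and treated by induction on r, so no optional stopping
    or integrability argument occurs. The horizon is removed at the end, by Markov's inequality in
    the lower bounds and by summing tail probabilities in the upper ones. The exponent t of the
    likelihood ratios is fixed before c, so every constant depending on it is O(1) as c tends to
    0. *)

Section calculus.
Context {R : realType}.
Implicit Types (f g : R -> R) (x a b : R).

Definition has_deriv f x a : Prop := is_derive x 1 f a.

Lemma deriv_eq f x a b : has_deriv f x a -> a = b -> has_deriv f x b.
Proof. by move=> fx <-. Qed.

Lemma deriv_cst (c x : R) : has_deriv (fun _ : R => c) x 0.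
Proof. exact: is_derive_cst. Qed.

Lemma deriv_id x : has_deriv (fun y : R => y) x 1.
Proof. exact: is_derive_id. Qed.

Lemma derivD f g x a b : has_deriv f x a -> has_deriv g x b ->
  has_deriv (fun y => f y + g y) x (a + b).
Proof. by move=> fx gx; apply: is_deriveD. Qed.

Lemma derivN f x a : has_deriv f x a -> has_deriv (fun y => - f y) x (- a).
Proof. by move=> fx; apply: is_deriveN. Qed.

Lemma derivM f g x a b : has_deriv f x a -> has_deriv g x b ->
  has_deriv (fun y => f y * g y) x (f x * b + g x * a).
Proof. by move=> fx gx; apply: is_deriveM. Qed.

Lemma derivX f n x a : has_deriv f x a ->
  has_deriv (fun y => f y ^+ n.+1) x (n.+1%:R * f x ^+ n * a).
Proof.
move=> fx; rewrite (_ : (fun y => f y ^+ n.+1) = f ^+ n.+1); last first.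
  by apply/funext => y; rewrite exprfctE.
apply: deriv_eq (is_deriveX n.+1 fx) _.
by rewrite /GRing.scale /= mulr_natl.
Qed.

Lemma derivV f x a : f x != 0 -> has_deriv f x a ->
  has_deriv (fun y => (f y)^-1) x (- a / f x ^+ 2).
Proof.
move=> fx0 fx; apply: deriv_eq (is_deriveV fx0 fx) _.
by rewrite /GRing.scale /= !mulNr mulrC.
Qed.

Lemma deriv_comp f g x a b : has_deriv f (g x) a -> has_deriv g x b ->
  has_deriv (fun y => f (g y)) x (a * b).
Proof.
exact: is_derive1_comp.
Qed.

Lemma deriv_expR g x b : has_deriv g x b ->
  has_deriv (fun y => expR (g y)) x (expR (g x) * b).
Proof. by move=> h; exact: (deriv_comp (is_derive_expR _) h). Qed.

Lemma deriv_ln g x b : 0 < g x -> has_deriv g x b ->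
  has_deriv (fun y => ln (g y)) x ((g x)^-1 * b).
Proof. by move=> gx h; exact: (deriv_comp (is_derive1_ln gx) h). Qed.

Lemma deriv_ge0_le f (df : R -> R) a b : a <= b ->
  (forall x, a <= x <= b -> has_deriv f x (df x)) ->
  (forall x, a <= x <= b -> 0 <= df x) -> f a <= f b.
Proof.
move=> ab fdf df0; have [||c] := @MVT_segment R f df a b ab.
- by move=> x; rewrite in_itv/= => /andP[/ltW ax /ltW xb]; apply: fdf; rewrite ax.
- apply: derivable_within_continuous => x; rewrite in_itv/= => xab.
  by have := fdf x xab => -[].
rewrite in_itv/= => cab /eqP; rewrite subr_eq => /eqP ->.
by rewrite lerDr mulr_ge0 ?df0// subr_ge0.
Qed.

Lemma deriv_le0_ge f (df : R -> R) a b : a <= b ->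
  (forall x, a <= x <= b -> has_deriv f x (df x)) ->
  (forall x, a <= x <= b -> df x <= 0) -> f b <= f a.
Proof.
move=> ab fdf df0; rewrite -lerN2.
apply: (@deriv_ge0_le (fun x => - f x) (fun x => - df x)) => // x xab.
  exact/derivN/fdf.
by rewrite oppr_ge0 df0.
Qed.

End calculus.

(** Reads the derivative off the syntax of the function and leaves its value to unification, so that
    [deriv] ends, up to side conditions, with one algebraic identity. *)
Ltac deriv_step := match goal with
  | |- has_deriv (fun y => ?c) _ _ => apply: deriv_cst
  | |- has_deriv (fun y => y) _ _ => apply: deriv_id
  | |- has_deriv (fun y => @?f y + @?g y) _ _ => apply: (derivD (f := f) (g := g))
  | |- has_deriv (fun y => - @?f y) _ _ => apply: (derivN (f := f))
  | |- has_deriv (fun y => @?f y * @?g y) _ _ => apply: (derivM (f := f) (g := g))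
  | |- has_deriv (fun y => (@?f y) ^+ _) _ _ => apply: (derivX (f := f))
  | |- has_deriv (fun y => (@?f y)^-1) _ _ => apply: (derivV (f := f))
  | |- has_deriv (fun y => expR (@?f y)) _ _ => apply: (deriv_expR (g := f))
  | |- has_deriv (fun y => ln (@?f y)) _ _ => apply: (deriv_ln (g := f))
  end.
Ltac deriv := eapply deriv_eq; [repeat deriv_step|]; cbv beta.

Section normal.
Context {R : realType}.
Implicit Types (x y m t : R).

Definition gpdf x : R := normal_pdf 0 1 x.
Definition gpeak : R := normal_peak 1.

Lemma normal_pdf1E m x : normal_pdf m 1 x = gpeak * expR (- (x - m) ^+ 2 / 2).
Proof. by rewrite normal_pdfE ?oner_neq0// /normal_fun expr1n. Qed.

Lemma normal_pdf_gpdf m x : normal_pdf m 1 x = gpdf (x - m).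
Proof. by rewrite /gpdf !normal_pdf1E subr0. Qed.

Lemma gpdfE x : gpdf x = gpeak * expR (- x ^+ 2 / 2).
Proof. by rewrite /gpdf normal_pdf1E subr0. Qed.

Lemma gpeak_gt0 : 0 < gpeak.
Proof. by rewrite normal_peak_gt0// oner_neq0. Qed.

Lemma gpeak_sqr : gpeak ^+ 2 = (2 * pi)^-1.
Proof.
rewrite /gpeak /normal_peak exprVn sqr_sqrtr expr1n mul1r -mulr_natl//.
by rewrite mulr_ge0// pi_ge0.
Qed.

Lemma gpdf_gt0 x : 0 < gpdf x.
Proof. by rewrite gpdfE mulr_gt0 ?gpeak_gt0// expR_gt0. Qed.

Lemma gpdfN x : gpdf (- x) = gpdf x.
Proof. by rewrite !gpdfE sqrrN. Qed.

Lemma deriv_gpdf x : has_deriv gpdf x (- x * gpdf x).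
Proof.
rewrite (_ : gpdf = fun y => gpeak * expR (- y ^+ 2 / 2)); last first.
  by apply/funext => y; rewrite gpdfE.
by deriv; field.
Qed.

Lemma deriv_gpdf_comp (g : R -> R) x b : has_deriv g x b ->
  has_deriv (fun y => gpdf (g y)) x (- g x * gpdf (g x) * b).
Proof. by move=> h; exact: (deriv_comp (deriv_gpdf _) h). Qed.

Definition ncdf m x : R := fine (normal_prob m 1 `]-oo, x]).
Definition gcdf x : R := ncdf 0 x.

Lemma deriv_ncdf m x : has_deriv (ncdf m) x (gpdf (x - m)).
Proof.
have xu : x < x + 1 by rewrite ltrDl.
have h : lebesgue_measure.-integrable [set` Interval -oo%O (BRight (x + 1))]
    (EFin \o (normal_pdf m 1)).
  by apply: integrableS (integrable_normal_pdf m 1).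
have /= [||d e] := @continuous_FTC1 R (normal_pdf m 1) -oo%O x (x + 1) xu h.
- by rewrite ltNyr.
- exact: continuous_normal_pdf (oner_neq0 R) x.
rewrite derive1E in e.
by split => //; rewrite -normal_pdf_gpdf -e.
Qed.

(** The identity as a random variable under the normal law: [ncdf] is its cumulative distribution
    function, whence the limits at both infinities. *)
Let idTR : measurableTypeR R -> R := idfun.

#[local] HB.instance Definition _ :=
  @isMeasurableFun.Build _ _ _ _ idTR (@measurable_id _ _ setT).

Lemma cvg_ncdfy m : ncdf m x @[x --> +oo] --> (1 : R).
Proof.
have := cvg_cdfy1 (idTR : {RV (normal_prob m 1) >-> R}).
by move/fine_cvg; apply: cvg_trans.
Qed.

Lemma cvg_ncdfNy m : ncdf m x @[x --> -oo] --> (0 : R).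
Proof.
have := cvg_cdfNy0 (idTR : {RV (normal_prob m 1) >-> R}).
by move/fine_cvg; apply: cvg_trans.
Qed.

End normal.

Section normal2.
Context {R : realType}.
Implicit Types (x y m t : R).
Local Notation gcdf := (@gcdf R).
Local Notation gpdf := (@gpdf R).

Lemma gcdf_cvgy : gcdf x @[x --> +oo] --> (1 : R).
Proof. exact: cvg_ncdfy. Qed.

Lemma gcdf_cvgNy : gcdf x @[x --> -oo] --> (0 : R).
Proof. exact: cvg_ncdfNy. Qed.

Lemma deriv_gcdf x : has_deriv gcdf x (gpdf x).
Proof. by have := deriv_ncdf 0 x; rewrite subr0. Qed.

Lemma deriv_gcdf_comp (g : R -> R) x b : has_deriv g x b ->
  has_deriv (fun y => gcdf (g y)) x (gpdf (g x) * b).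
Proof. by move=> h; exact: (deriv_comp (deriv_gcdf _) h). Qed.

(** Both sides have the derivative [gpdf (x - m)], so they differ by a constant, which is 0 by
    comparison of the limits at +oo. *)
Lemma gcdf_shift m x : ncdf m x = gcdf (x - m).
Proof.
pose h x := ncdf m x - gcdf (x - m).
have hc y z : h y = h z.
  apply: is_derive_0_is_cst => w; rewrite -/(has_deriv _ _ _).
  have g1 : has_deriv (ncdf m) w (gpdf (w - m)) by exact: deriv_ncdf.
  eapply deriv_eq; first apply: derivD; first exact: g1.
    by apply: derivN; apply: deriv_gcdf_comp; apply: derivD;
      [exact: deriv_id|exact: deriv_cst].
  by rewrite /=; ring.
have h0 : h z @[z --> +oo] --> (1 - 1 : R).
  apply: cvgB; first exact: cvg_ncdfy.
  by rewrite (cvg_centerr m gcdf); exact: gcdf_cvgy.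
have h1 : h z @[z --> +oo] --> h x.
  by under eq_fun do rewrite (hc _ x); exact: cvg_cst.
have := cvg_unique (@Rhausdorff R) h0 h1; move=> /(_ _).
by rewrite /h subrr => /esym/eqP; rewrite subr_eq0 => /eqP.
Qed.

Lemma gcdfN x : gcdf (- x) = 1 - gcdf x.
Proof.
pose h x := gcdf (- x) + gcdf x.
have hc y z : h y = h z.
  apply: is_derive_0_is_cst => w; rewrite -/(has_deriv _ _ _).
  eapply deriv_eq.
    apply: derivD; last exact: deriv_gcdf.
    by apply: deriv_gcdf_comp; apply: derivN; exact: deriv_id.
  by rewrite /= gpdfN; ring.
have h0 : h z @[z --> +oo] --> (0 + 1 : R).
  apply: cvgD; last exact: gcdf_cvgy.
  by have /cvgNy_compNP := gcdf_cvgNy.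
have h1 : h z @[z --> +oo] --> h x.
  by under eq_fun do rewrite (hc _ x); exact: cvg_cst.
have := cvg_unique (@Rhausdorff R) h0 h1; move=> /(_ _).
by rewrite /h add0r => ->; rewrite addrK.
Qed.

Lemma gcdf_le x y : x <= y -> gcdf x <= gcdf y.
Proof.
move=> xy; apply: (deriv_ge0_le xy (df := gpdf)) => z _.
  exact: deriv_gcdf.
exact/ltW/gpdf_gt0.
Qed.

Lemma gcdf_lt x y : x < y -> gcdf x < gcdf y.
Proof.
move=> xy; have h (z : R) : is_derive z (1 : R) gcdf (gpdf z) by exact: deriv_gcdf.
have [|c cxy e] := @MVT R gcdf gpdf x y xy.
- by apply: derivable_within_continuous => z _; have [] := h z.
- by rewrite -subr_gt0 e mulr_gt0 ?gpdf_gt0// subr_gt0.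
Qed.

Lemma gcdf_gt0 x : 0 < gcdf x.
Proof.
have h : x - 1 < x by lra.
apply: le_lt_trans (gcdf_lt h).
by rewrite /gcdf /ncdf fine_ge0// measure_ge0.
Qed.

Lemma gcdf_lt1 x : gcdf x < 1.
Proof. by have := gcdf_gt0 (- x); rewrite gcdfN subr_gt0. Qed.

Lemma gcdf0 : gcdf 0 = 2^-1.
Proof. by have := gcdfN 0; rewrite oppr0 => h; lra. Qed.

Lemma gcdf_surj (p : R) : 0 < p < 1 -> exists x, gcdf x = p.
Proof.
move=> /andP[p0 p1].
have [a ap] : exists a, gcdf a < p.
  have /cvgr_lt /(_ _ p0) [M [_ HM]] := gcdf_cvgNy.
  by exists (M - 1); apply: HM; rewrite ltrBlDr ltrDl.
have [b bp] : exists b, p < gcdf b.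
  have /cvgr_gt /(_ _ p1) [M [_ HM]] := gcdf_cvgy.
  by exists (M + 1); apply: HM; rewrite ltrDl.
have ab : a <= b.
  by rewrite leNgt; apply/negP => /ltW/gcdf_le; apply/negP; rewrite -ltNge; lra.
have [||c _ <-] := @IVT R gcdf a b p ab; last by exists c.
  by apply: derivable_within_continuous => z _; have [] := deriv_gcdf z.
rewrite minEle maxEle gcdf_le//; apply/andP; lra.
Qed.

Lemma normal_prob_tail m x : normal_prob m 1 `[x, +oo[ = (gcdf (m - x))%:E.
Proof.
have h : normal_prob m 1 `]-oo, x[ = normal_prob m 1 `]-oo, x].
  apply: integral_itv_bndo_bndc; apply: (@measurable_funS _ _ _ _ setT) => //.
  by apply/measurable_EFinP; exact: measurable_normal_pdf.
rewrite -setCitvl probability_setC//= h -[X in (_ - X)%E]fineK ?fin_num_measure//.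
rewrite -/(ncdf m x) gcdf_shift -EFinB; congr EFin.
by rewrite -gcdfN opprB.
Qed.

(** Replaces a limit at +oo. In the applications [v] is the value at x of a decreasing function
    whose value at y is at least - C / y, by Gaussian tail bounds. *)
Lemma ge0_of_inv (C M v : R) : 0 < C -> (forall y, M <= y -> 0 < y -> - (C / y) <= v) ->
  0 <= v.
Proof.
move=> C0 h; rewrite leNgt; apply/negP => v0.
pose y := Num.max (Num.max M 1) (2 * C / - v).
have y0 : 0 < y by rewrite !lt_max ltr01 orbT.
have My : M <= y by rewrite !le_max lexx.
have := h y My y0; apply/negP; rewrite -ltNge ltrNr.
rewrite ltr_pdivrMr// mulrC -ltr_pdivrMr ?oppr_gt0//.
apply: (@lt_le_trans _ _ (2 * C / - v)); last by rewrite le_max lexx orbT.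
rewrite ltr_pM2r ?invr_gt0 ?oppr_gt0//; lra.
Qed.

Lemma gpdf_le_peak x : gpdf x <= gpeak.
Proof. exact/normal_pdf_ub/oner_neq0. Qed.

Lemma gpdf_le_inv2 x : 0 < x -> gpdf x <= 2 * gpeak / x ^+ 2.
Proof.
move=> x0; rewrite gpdfE ler_pdivlMr ?exprn_gt0// -mulrA [2 * _]mulrC.
rewrite ler_pM2l ?gpeak_gt0// mulNr expRN mulrC ler_pdivrMr ?expR_gt0//.
by have := expR_ge1Dx (x ^+ 2 / 2); lra.
Qed.

Lemma gpdf_le_inv x : 1 <= x -> x * gpdf x <= 2 * gpeak / x.
Proof.
move=> x1; have x0 : 0 < x by lra.
apply: (le_trans (ler_wpM2l (ltW x0) (gpdf_le_inv2 x0))).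
rewrite [leRHS](_ : _ = x * (2 * gpeak / x ^+ 2))//; field; lra.
Qed.

(** On [1, +oo) the difference of the two sides decreases, its derivative being [gpdf z * (1 - z)],
    and it is at least [gcdf y - 1], which tends to 0. *)
Lemma gtail_le_gpdf x : 1 <= x -> 1 - gcdf x <= gpdf x.
Proof.
move=> x1; rewrite -subr_ge0.
have d z : has_deriv (fun y => gpdf y - (1 - gcdf y)) z (gpdf z * (1 - z)).
  eapply deriv_eq; first apply: derivD; first exact: deriv_gpdf.
    apply: derivN; apply: derivD; first exact: deriv_cst.
    by apply: derivN; exact: deriv_gcdf.
  by rewrite /=; ring.
have h : (gcdf y - 1) @[y --> +oo] --> (1 - 1 : R).
  by apply: cvgB; [exact: gcdf_cvgy|exact: cvg_cst].
rewrite subrr in h; apply: (cvgr_to_le h).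
exists x; split => [|y xy /=]; first exact: num_real.
apply: le_trans (deriv_le0_ge (ltW xy) (fun z _ => d z) _).
  by rewrite opprB lerDr ltW// gpdf_gt0.
move=> z /andP[xz _]; rewrite pmulr_rle0 ?gpdf_gt0//; lra.
Qed.

End normal2.

(** * Numerical and normal tail bounds *)

Section trigo_bounds.
Context {R : realType}.
Implicit Types x : R.

Lemma deriv_sin x : has_deriv sin x (cos x).
Proof. exact: is_derive_sin. Qed.

Lemma deriv_cos x : has_deriv cos x (- sin x).
Proof. exact: is_derive_cos. Qed.

(** One rung of the Taylor ladder: each remainder below vanishes at 0 and has the previous remainder
    as its derivative. *)
Lemma nonneg_of_deriv (f df : R -> R) x : 0 <= x -> 0 <= f 0 ->
  (forall y, 0 <= y -> has_deriv f y (df y)) -> (forall y, 0 <= y -> 0 <= df y) ->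
  0 <= f x.
Proof.
move=> x0 f0 d p; apply: (le_trans f0); apply: (deriv_ge0_le x0 (df := df)).
- by move=> y /andP[y0 _]; exact: d.
- by move=> y /andP[y0 _]; exact: p.
Qed.

Lemma sin_le_id x : 0 <= x -> 0 <= x - sin x.
Proof.
move=> x0; apply: (nonneg_of_deriv (f := fun x => x - sin x) (df := fun x => 1 - cos x)); first exact: x0.
- by rewrite sin0 subrr.
- by move=> y _; apply: derivD; [exact: deriv_id|apply: derivN; exact: deriv_sin].
- by move=> y _; rewrite subr_ge0 cos_le1.
Qed.

Lemma cos_ge_taylor2 x : 0 <= x -> 0 <= cos x - (1 - x ^+ 2 / 2).
Proof.
move=> x0.
apply: (nonneg_of_deriv (f := fun x => cos x - (1 - x ^+ 2 / 2)) (df := fun x => x - sin x)); first exact: x0.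
- by rewrite cos0; lra.
- move=> y _; eapply deriv_eq; first apply: derivD; first exact: deriv_cos.
    by repeat deriv_step.
  by rewrite /=; field.
- exact: sin_le_id.
Qed.

Lemma sin_ge_taylor3 x : 0 <= x -> 0 <= sin x - (x - x ^+ 3 / 6).
Proof.
move=> x0.
apply: (nonneg_of_deriv (f := fun x => sin x - (x - x ^+ 3 / 6))
  (df := fun x => cos x - (1 - x ^+ 2 / 2))); first exact: x0.
- by rewrite sin0; lra.
- move=> y _; eapply deriv_eq; first apply: derivD; first exact: deriv_sin.
    by repeat deriv_step.
  by rewrite /=; field.
- exact: cos_ge_taylor2.
Qed.

Lemma cos_le_taylor4 x : 0 <= x -> 0 <= 1 - x ^+ 2 / 2 + x ^+ 4 / 24 - cos x.
Proof.
move=> x0.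
apply: (nonneg_of_deriv (f := fun x => 1 - x ^+ 2 / 2 + x ^+ 4 / 24 - cos x)
  (df := fun x => sin x - (x - x ^+ 3 / 6))); first exact: x0.
- by rewrite cos0; lra.
- move=> y _; eapply deriv_eq; first (apply: derivD; [|apply: derivN; exact: deriv_cos]).
    by repeat deriv_step.
  by rewrite /=; field.
- exact: sin_ge_taylor3.
Qed.

Lemma sin_le_taylor5 x : 0 <= x -> 0 <= x - x ^+ 3 / 6 + x ^+ 5 / 120 - sin x.
Proof.
move=> x0.
apply: (nonneg_of_deriv (f := fun x => x - x ^+ 3 / 6 + x ^+ 5 / 120 - sin x)
  (df := fun x => 1 - x ^+ 2 / 2 + x ^+ 4 / 24 - cos x)); first exact: x0.
- by rewrite sin0; lra.
- move=> y _; eapply deriv_eq; first (apply: derivD; [|apply: derivN; exact: deriv_sin]).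
    by repeat deriv_step.
  by rewrite /=; field.
- exact: cos_le_taylor4.
Qed.

Lemma cos_ge_taylor6 x : 0 <= x ->
  0 <= cos x - (1 - x ^+ 2 / 2 + x ^+ 4 / 24 - x ^+ 6 / 720).
Proof.
move=> x0.
apply: (nonneg_of_deriv (f := fun x => cos x - (1 - x ^+ 2 / 2 + x ^+ 4 / 24 - x ^+ 6 / 720))
  (df := fun x => x - x ^+ 3 / 6 + x ^+ 5 / 120 - sin x)); first exact: x0.
- by rewrite cos0; lra.
- move=> y _; eapply deriv_eq; first apply: derivD; first exact: deriv_cos.
    by repeat deriv_step.
  by rewrite /=; field.
- exact: sin_le_taylor5.
Qed.

(** The fourth-order Taylor bound makes cos (8/5) negative, whereas it would be positive if 8/5 <
    pi/2. Bounds on pi are needed for the peak of the density, whose square is 1 / (2 pi). *)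
Lemma pi_le : (pi : R) <= 16 / 5.
Proof.
rewrite leNgt; apply/negP => h.
have : 0 < cos (8 / 5 : R) by apply: cos_gt0_pihalf; apply/andP; split; lra.
have h0 : 0 <= (8 / 5 : R) by lra.
have := cos_le_taylor4 h0; lra.
Qed.

Lemma pi_ge : 31 / 10 <= (pi : R).
Proof.
rewrite leNgt; apply/negP => h.
have p2 := @pi_ge2 R.
have : cos (31 / 20 : R) < cos (pi / 2).
  by rewrite ltr_cos ?in_itv/=; [lra|apply/andP; split; lra|apply/andP; split; lra].
have h0 : 0 <= (31 / 20 : R) by lra.
have := cos_ge_taylor6 h0; rewrite cos_pihalf; lra.
Qed.

End trigo_bounds.

(** * Rational lower bounds for the exponential *)

Section exp_bounds.
Context {R : realType}.
Implicit Types u x : R.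

(** The tangent line at u0 with [expR (- u0)] replaced by a rational lower bound; where the line is
    negative there is nothing to prove. *)
Lemma expRN_ge_tangent (c u0 u : R) : 0 <= c <= expR (- u0) ->
  c * (1 + u0 - u) <= expR (- u).
Proof.
move=> /andP[c0 cu]; have -> : expR (- u) = expR (- u0) * expR (u0 - u) by rewrite -expRD; congr expR; ring.
 have h := expR_ge1Dx (u0 - u).
have e0 := expR_ge0 (u0 - u).
have [p|p] := leP 0 (1 + u0 - u).
  by apply: ler_pM => //; lra.
apply: (@le_trans _ _ 0); last by rewrite mulr_ge0 ?expR_ge0.
by apply: mulr_ge0_le0 => //; exact: ltW.
Qed.

Lemma expR_double (a b u : R) : 0 <= a -> a <= expR u -> b <= a * a ->
  b <= expR (2 * u).
Proof.
move=> a0 au ab; apply: le_trans ab _.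
by rewrite (_ : 2 * u = u + u); [rewrite expRD ler_pM|ring].
Qed.

(** Four squarings of 1 + u / 16 <= e^(u/16), rounding down after each one to keep the fractions
    small. *)
Lemma expR_ge_pow16 (a b c d e u : R) : 0 <= a -> a <= 1 + u / 16 ->
  0 <= b <= a * a -> 0 <= c <= b * b -> 0 <= d <= c * c -> e <= d * d ->
  e <= expR u.
Proof.
move=> a0 au /andP[b0 ba] /andP[c0 cb] /andP[d0 dc] ed.
rewrite (_ : u = 2 * (2 * (2 * (2 * (u / 16))))); last by field.
apply: (expR_double (a := d)) => //; apply: (expR_double (a := c)) => //.
apply: (expR_double (a := b)) => //; apply: (expR_double (a := a)) => //.
exact: le_trans au (expR_ge1Dx _).
Qed.

(** The line and the factor 5/4 are dictated by [mills_upper]: there 2 gpdf^2 is at least 5/16 w^2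
    and gcdf (1 - gcdf) at most w / 4, w being the exponential, so line <= 5/4 w is what remains.
    Tangents at x^2 / 2 = 0, 3/2 and 12/5 cover the range up to 5/2, beyond which the line is
    negative. *)
Lemma gauss_ge_line x : 0 <= x -> 55 / 64 - 3 / 8 * x <= 5 / 4 * expR (- (x ^+ 2 / 2)).
Proof.
move=> x0.
have [x1|x1] := leP x 1.
  by have := expR_ge1Dx (- (x ^+ 2 / 2)); nra.
have [x2|x2] := leP x 2.
  have h : 103 / 500 <= expR (- (3 / 2)) :> R.
    by apply: (@expR_ge_pow16 (29 / 32) (821 / 1000) (674 / 1000) (454 / 1000)); lra.
  have := @expRN_ge_tangent (103 / 500) (3 / 2) (x ^+ 2 / 2).
  move=> /(_ _)/wrap[|]; first by apply/andP; split; lra.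
  by nra.
have h : 37 / 500 <= expR (- (12 / 5)) :> R.
  by apply: (@expR_ge_pow16 (17 / 20) (7225 / 10000) (5218 / 10000) (2722 / 10000)); lra.
have := @expRN_ge_tangent (37 / 500) (12 / 5) (x ^+ 2 / 2).
move=> /(_ _)/wrap[|]; first by apply/andP; split; lra.
have [x3|x3] := leP x (5 / 2); first by nra.
by have := expR_ge0 (- (x ^+ 2 / 2)); lra.
Qed.

End exp_bounds.

(** * Mills-type inequalities *)

Section mills.
Context {R : realType}.
Implicit Types x y t : R.
Local Notation gcdf := (@gcdf R).
Local Notation gpdf := (@gpdf R).

Let b x := gcdf x * (1 - gcdf x).
Let a x := 2 * gcdf x - 1.

Let b_ge0 x : 0 <= b x.
Proof. by rewrite mulr_ge0 ?ltW ?gcdf_gt0// subr_gt0 gcdf_lt1. Qed.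

Let a_lt1 x : a x < 1.
Proof. rewrite /a; have := gcdf_lt1 x; lra. Qed.

Let a_ge0 x : 0 <= x -> 0 <= a x.
Proof. by move=> /gcdf_le; rewrite gcdf0 /a => ?; lra. Qed.

Let db x : has_deriv b x (- gpdf x * a x).
Proof.
have h := deriv_gcdf x; rewrite /b.
eapply deriv_eq; first (apply: derivM; [exact: h|]).
  by apply: derivD; [exact: deriv_cst|apply: derivN; exact: h].
by rewrite /= /a; ring.
Qed.

Let da x : has_deriv a x (2 * gpdf x).
Proof.
have h := deriv_gcdf x; rewrite /a.
eapply deriv_eq; first (apply: derivD; [|exact: deriv_cst]).
  by apply: derivM; [exact: deriv_cst|exact: h].
by rewrite /=; ring.
Qed.

Let y2 x := a x - 4 * x * gpdf x.
Let dy2 x : has_deriv y2 x (2 * gpdf x * (2 * x ^+ 2 - 1)).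
Proof.
rewrite /y2; eapply deriv_eq; first apply: derivD; first exact: da.
  apply: derivN; apply: derivM; last exact: deriv_gpdf.
  by apply: derivM; [exact: deriv_cst|exact: deriv_id].
by rewrite /=; ring.
Qed.

Let y1 x := 2 * gpdf x ^+ 2 - b x.
Let dy1 x : has_deriv y1 x (gpdf x * y2 x).
Proof.
rewrite /y1; eapply deriv_eq; first (apply: derivD; [|apply: derivN; exact: db]).
  apply: derivM; first exact: deriv_cst.
  by apply: derivX; exact: deriv_gpdf.
by rewrite /= /y2; ring.
Qed.

Let y0 x := gpdf x * a x - x * b x.
Let dy0 x : has_deriv y0 x (y1 x).
Proof.
rewrite /y0; eapply deriv_eq; first apply: derivD.
- by apply: derivM; [exact: deriv_gpdf|exact: da].
- by apply: derivN; apply: derivM; [exact: deriv_id|exact: db].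
by rewrite /= /y1; ring.
Qed.

Let y2_0 : y2 0 = 0.
Proof. by rewrite /y2 /a gcdf0; field. Qed.

Let gp0 x := gpdf_gt0 x.

Let y2_le0_small x : 0 <= x -> 2 * x ^+ 2 <= 1 -> y2 x <= 0.
Proof.
move=> x0 x1; rewrite -y2_0.
apply: (deriv_le0_ge x0 (df := fun x => 2 * gpdf x * (2 * x ^+ 2 - 1))) => [z _|z /andP[z0 zx]].
  exact: dy2.
have zz : z * z <= x * x by apply: ler_pM.
by rewrite pmulr_rle0 ?mulr_gt0// -expr2 in zz *; move: zz x1; rewrite !expr2 => ? ?; lra.
Qed.

Let y2_incr x y : 0 <= x -> 1 <= 2 * x ^+ 2 -> x <= y -> y2 x <= y2 y.
Proof.
move=> x0 x1 xy.
apply: (deriv_ge0_le xy (df := fun x => 2 * gpdf x * (2 * x ^+ 2 - 1))) => [z _|z /andP[xz zy]].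
  exact: dy2.
have zz : x * x <= z * z by apply: ler_pM.
by rewrite pmulr_rge0 ?mulr_gt0//; move: zz x1; rewrite !expr2 => ? ?; lra.
Qed.

(** The region to the right of the sign change of [y2], which starts at 0, decreases as long as 2
    x^2 <= 1 and increases afterwards. Once [P] holds it persists, and where it fails [y2] has been
    nonpositive all along. *)
Let P x := 1 <= 2 * x ^+ 2 /\ 0 <= y2 x.

Let P_after x y : 0 <= x -> P x -> x <= y -> 0 <= y2 y.
Proof. by move=> x0 [x1 h] xy; apply: le_trans h _; exact: y2_incr. Qed.

Let notP_before x y : 0 <= y -> ~ P x -> y <= x -> y2 y <= 0.
Proof.
move=> yn nP yx; have [yy|yy] := leP (2 * y ^+ 2) 1; first exact: y2_le0_small.
have [h|h] := leP (y2 y) 0 => //; case: nP; split.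
  have zz : y * y <= x * x by apply: ler_pM.
  by move: zz yy; rewrite !expr2 => ? ?; lra.
exact: P_after (conj (ltW yy) (ltW h)) yx.
Qed.

(** From x on, [y1] increases, and it tends to 0 at a rate controlled by [4 * gpeak ^+ 2 / y]. *)
Let y1_P x : 0 <= x -> P x -> y1 x <= 0.
Proof.
move=> x0 Px; rewrite -oppr_ge0.
apply: (@ge0_of_inv R (4 * gpeak ^+ 2) (Num.max x 1)) => [|y].
  by rewrite mulr_gt0// exprn_gt0// gpeak_gt0.
rewrite ge_max => /andP[xy y1'] yp; rewrite lerN2.
have h : y1 x <= y1 y.
  apply: (deriv_ge0_le xy (df := fun x => gpdf x * y2 x)) => [z _|z /andP[xz _]].
    exact: dy1.
  by rewrite mulr_ge0 ?(ltW (gp0 _))//; exact: P_after xz.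
apply: le_trans h _; rewrite /y1.
have h1 := gpdf_le_inv y1'; have h2 := gpdf_le_peak y; have := b_ge0 y; have := gp0 y.
have k : 0 < @gpeak R by exact: gpeak_gt0.
have h3 : gpdf y <= 2 * gpeak / y by apply: le_trans h1; rewrite ler_peMl// ltW.
have h4 : gpdf y ^+ 2 <= gpeak * (2 * gpeak / y).
  by rewrite expr2 ler_pM// ltW.
move=> *; rewrite (_ : 4 * _ / y = 2 * (gpeak * (2 * gpeak / y))); first lra.
by field; lra.
Qed.

(** Since [y1] is the derivative of [y0], the function [y0] decreases from x on, and its limit at
    +oo is 0. *)
Let y0_lb x : 0 <= x -> (forall y, x <= y -> y1 y <= 0) -> 0 <= y0 x.
Proof.
move=> x0 h; apply: (@ge0_of_inv R (2 * gpeak) (Num.max x 1)) => [|y].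
  by rewrite mulr_gt0// gpeak_gt0.
rewrite ge_max => /andP[xy y1'] yp.
have : y0 y <= y0 x.
  apply: (deriv_le0_ge xy (df := y1)) => [z _|z /andP[xz _]]; first exact: dy0.
  exact: h.
apply: le_trans; rewrite /y0.
have h1 := gpdf_le_inv y1'; have h2 := gtail_le_gpdf y1'.
have h3 : b y <= gpdf y.
  apply: le_trans h2; rewrite /b ler_piMl// ?subr_ge0 ltW//; first exact: gcdf_lt1.
  exact: gcdf_lt1.
have h4 : 0 <= gpdf y * a y by rewrite mulr_ge0 ?a_ge0 ?ltW.
have h5 : y * b y <= y * gpdf y by rewrite ler_pM2l.
lra.
Qed.

(* The hazard-type function [gpdf * a / b] dominates the identity: its defect
   [y0] has derivative [y1], which is first positive, then negative. *)
Lemma mills_lower x : 0 <= x ->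
  x * (gcdf x * (1 - gcdf x)) <= gpdf x * (2 * gcdf x - 1).
Proof.
move=> x0; rewrite -subr_ge0 -/(a x) -/(b x) -/(y0 x).
have [Px|nP] := pselect (P x).
  apply: y0_lb => // y xy; apply: y1_P; first lra.
  case: (Px) => p1 p2; split; last exact: P_after Px xy.
  have zz : x * x <= y * y by apply: ler_pM.
  by move: zz p1; rewrite !expr2 => ? ?; lra.
have y1d y : 0 <= y -> ~ P y -> forall z, 0 <= z <= y -> y1 y <= y1 z.
  move=> yn nPy z /andP[z0 zy].
  apply: (deriv_le0_ge zy (df := fun x => gpdf x * y2 x)) => [w _|w /andP[zw wy]].
    exact: dy1.
  by rewrite pmulr_rle0//; apply: notP_before wy => //; lra.
have [h|h] := leP 0 (y1 x).
  have <- : y0 0 = 0 by rewrite /y0 /a gcdf0; field.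
  apply: (deriv_ge0_le x0 (df := y1)) => [z _|z zx]; first exact: dy0.
  by apply: le_trans h _; exact: y1d.
apply: y0_lb => // y xy; have [Py|nPy] := pselect (P y).
  by apply: y1_P => //; lra.
by apply: le_trans (ltW h); apply: y1d => //; [lra|apply/andP; split].
Qed.

(** By [mills_lower], [b x * expR (x ^+ 2 / 2)] decreases on [0, +oo), and its value at 0 is 1/4. *)
Lemma gcdf_var_le_exp x : 0 <= x ->
  4 * (gcdf x * (1 - gcdf x)) <= expR (- (x ^+ 2 / 2)).
Proof.
move=> x0; rewrite -/(b x).
have : b x * expR (x ^+ 2 / 2) <= b 0 * expR (0 ^+ 2 / 2).
  apply: (deriv_le0_ge (f := fun x => b x * expR (x ^+ 2 / 2)) x0
     (df := fun x => expR (x ^+ 2 / 2) * (x * b x - gpdf x * a x))) => z.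
    move=> _; eapply deriv_eq; first apply: derivM; first exact: db.
      by repeat deriv_step.
    by rewrite /=; field.
  move=> /andP[z0 _]; rewrite pmulr_rle0 ?expR_gt0// subr_le0; exact: mills_lower.
rewrite expr0n/= mul0r expR0 mulr1 expRN => h.
rewrite -[leRHS]mul1r ler_pdivlMr ?expR_gt0// -mulrA.
by move: h; rewrite /b gcdf0; lra.
Qed.

Let Z x := (x + 3 / 8) * b x - gpdf x * a x.

(* Any slope below the Popoviciu bound works here; [3/8] makes the two terms in
   [odds_ratio_incr] add up to exactly [3/4]. *)
Lemma mills_upper x : 0 <= x ->
  gpdf x * (2 * gcdf x - 1) <= (x + 3 / 8) * (gcdf x * (1 - gcdf x)).
Proof.
move=> x0; rewrite -subr_ge0 -/(a x) -/(b x) -/(Z x).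
have key z : 0 <= z -> (55 / 64 - 3 / 8 * z) * b z <= 2 * gpdf z ^+ 2.
  move=> z0; have g2 : gpdf z ^+ 2 = (2 * pi)^-1 * expR (- (z ^+ 2 / 2)) ^+ 2.
    by rewrite gpdfE exprMn gpeak_sqr mulNr.
  have [h|h] := leP (55 / 64 - 3 / 8 * z) 0.
    apply: (@le_trans _ _ 0); first exact: mulr_le0_ge0.
    by apply: mulr_ge0; rewrite ?sqr_ge0.
  have h1 := gauss_ge_line z0; have h2 := gcdf_var_le_exp z0.
  have e0 := expR_ge0 (- (z ^+ 2 / 2)); set w := expR _ in g2 h1 h2 e0.
  have p1 : 5 / 16 <= (pi : R)^-1.
    rewrite -[5 / 16]invf_div lef_pV2 ?posrE ?pi_gt0//; first exact: pi_le; lra.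
  rewrite g2 invfM (_ : 2 * _ = pi^-1 * w ^+ 2); last first.
    by rewrite !mulrA mulfV ?pnatr_eq0// mul1r.
  apply: (@le_trans _ _ (5 / 4 * w * (w / 4))).
    by apply: ler_pM => //; [exact: ltW|rewrite -/(b z) in h2; lra].
  by rewrite (_ : 5 / 4 * w * (w / 4) = 5 / 16 * w ^+ 2); [rewrite ler_wpM2r ?sqr_ge0|field].
(* The exponential factor cancels the terms in [gpdf * a] of the derivative; this is where 55/64 = 1
   - (3/8)^2 comes from. *)
suff : 0 <= expR (- (3 / 8 * x)) * Z x by rewrite pmulr_rge0 ?expR_gt0.
apply: (@ge0_of_inv R (2 * gpeak) (Num.max x 1)) => [|y].
  by rewrite mulr_gt0// gpeak_gt0.
rewrite ge_max => /andP[xy y1'] yp.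
have : expR (- (3 / 8 * y)) * Z y <= expR (- (3 / 8 * x)) * Z x.
  apply: (deriv_le0_ge (f := fun x => expR (- (3 / 8 * x)) * Z x) xy
    (df := fun z => expR (- (3 / 8 * z)) * ((55 / 64 - 3 / 8 * z) * b z - 2 * gpdf z ^+ 2))) => z.
    move=> _; rewrite /Z; eapply deriv_eq.
      apply: derivM; first by repeat deriv_step.
      apply: derivD; first by apply: derivM; [repeat deriv_step|exact: db].
      by apply: derivN; apply: derivM; [exact: deriv_gpdf|exact: da].
    by rewrite /= /Z; field.
  move=> /andP[xz _]; rewrite pmulr_rle0 ?expR_gt0// subr_le0; apply: key; lra.
apply: le_trans; have h1 := gpdf_le_inv y1'.
have h4 : gpdf y * a y <= gpdf y by rewrite ler_piMr ?ltW.
have h5 : gpdf y <= y * gpdf y by rewrite ler_peMl// ltW.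
have h6 : 0 <= (y + 3 / 8) * b y by rewrite mulr_ge0//; lra.
have : - gpdf y <= Z y by rewrite /Z; lra.
have e0 : 0 < expR (- (3 / 8 * y)) by exact: expR_gt0.
have e1 : expR (- (3 / 8 * y)) <= 1 by rewrite expR_le1; lra.
have g0 := gp0 y; set e := expR _ in e0 e1 *; move=> h7.
apply: (@le_trans _ _ (- gpdf y)); first lra.
by nra.
Qed.

End mills.

(** * Information of threshold quantizers *)

Section odds.
Context {R : realType}.
Implicit Types x y t s : R.
Local Notation gcdf := (@gcdf R).
Local Notation gpdf := (@gpdf R).

Let b x := gcdf x * (1 - gcdf x).

Let F0 x : 0 < gcdf x. Proof. exact: gcdf_gt0. Qed.
Let F1 x : 0 < 1 - gcdf x. Proof. by rewrite subr_gt0 gcdf_lt1. Qed.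
Let p0 x : 0 < gpdf x. Proof. exact: gpdf_gt0. Qed.
Let b0 x : 0 < b x. Proof. by rewrite mulr_gt0. Qed.

Definition lodds x := ln (gcdf x) - ln (1 - gcdf x).
Definition odds' x := gpdf x / (gcdf x * (1 - gcdf x)).
(** The logarithmic derivative of [odds'], itself the derivative of the log-odds. The Mills-type
    inequalities place it in [0, 3/8] for x >= 0. *)
Definition rho x := gpdf x * (2 * gcdf x - 1) / (gcdf x * (1 - gcdf x)) - x.

Lemma odds'_gt0 x : 0 < odds' x.
Proof. by rewrite divr_gt0 ?mulr_gt0. Qed.

Lemma odds'N x : odds' (- x) = odds' x.
Proof. by rewrite /odds' gpdfN gcdfN subKr [X in _ / X]mulrC. Qed.

Lemma rhoN x : rho (- x) = - rho x.
Proof.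
rewrite /rho gpdfN gcdfN subKr [X in _ / X]mulrC; have := lt0r_neq0 (b0 x).
by rewrite /b => ?; field; rewrite ?lt0r_neq0//.
Qed.

Lemma rho_ge0 x : 0 <= x -> 0 <= rho x.
Proof. by move=> x0; rewrite subr_ge0 ler_pdivlMr ?mulr_gt0//; exact: mills_lower. Qed.

Lemma rho_le x : 0 <= x -> rho x <= 3 / 8.
Proof.
by move=> x0; rewrite lerBlDr ler_pdivrMr ?mulr_gt0// [3 / 8 + x]addrC; exact: mills_upper.
Qed.

Lemma deriv_lodds x : has_deriv lodds x (odds' x).
Proof.
have h := deriv_gcdf x; rewrite /lodds; eapply deriv_eq.
  apply: derivD; first by apply: (deriv_ln _ h).
  apply: derivN; apply: deriv_ln => //.
  by apply: derivD; [exact: deriv_cst|apply: derivN; exact: h].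
rewrite /= /odds'; field; rewrite !lt0r_neq0//.
Qed.

Lemma deriv_odds' x : has_deriv odds' x (odds' x * rho x).
Proof.
have h := deriv_gcdf x; rewrite /odds'; eapply deriv_eq.
  apply: derivM; first exact: deriv_gpdf.
  apply: derivV; first by rewrite lt0r_neq0 ?mulr_gt0.
  apply: derivM; first exact: h.
  by apply: derivD; [exact: deriv_cst|apply: derivN; exact: h].
rewrite /= /odds' /rho; field; rewrite !lt0r_neq0//.
Qed.

Lemma odds'_le x y : 0 <= x -> x <= y -> odds' x <= odds' y.
Proof.
move=> x0 xy; apply: (deriv_ge0_le xy (df := fun z => odds' z * rho z)) => [z _|z /andP[xz _]].
  exact: deriv_odds'.
by rewrite mulr_ge0 ?(ltW (odds'_gt0 _))// rho_ge0//; lra.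
Qed.

(** In s, the second difference has the derivative [odds' (x + s) - odds' (x - s)]. It is
    nonnegative even when x - s < 0, because [odds'] is even, increasing on [0, +oo), and |x - s| <=
    x + s. *)
Lemma lodds_midconvex x : 0 <= x -> 0 <= lodds (x + 1) + lodds (x - 1) - 2 * lodds x.
Proof.
move=> x0; pose q s := lodds (x + s) + lodds (x - s) - 2 * lodds x.
have -> : 0 = q 0 by rewrite /q addr0 subr0; ring.
apply: (deriv_ge0_le ler01 (df := fun s => odds' (x + s) - odds' (x - s)) (f := q)) => s.
  move=> _; rewrite /q; eapply deriv_eq.
    apply: derivD; last exact: deriv_cst.
    apply: derivD.
      by apply: (deriv_comp (g := fun s => x + s) (deriv_lodds _)); repeat deriv_step.
    by apply: (deriv_comp (g := fun s => x - s) (deriv_lodds _)); repeat deriv_step.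
  by rewrite /=; ring.
move=> /andP[s0 _]; rewrite subr_ge0.
have [h|h] := leP 0 (x - s); first by apply: odds'_le => //; lra.
by rewrite -odds'N; apply: odds'_le; lra.
Qed.

Let W t := gcdf (t + 1) - gcdf t.
Let W0 t : 0 < W t.
Proof. by rewrite subr_gt0 gcdf_lt// ltrDl. Qed.

Let dW t : has_deriv W t (gpdf (t + 1) - gpdf t).
Proof.
rewrite /W; eapply deriv_eq.
  apply: derivD; first by apply: deriv_gcdf_comp; repeat deriv_step.
  by apply: derivN; exact: deriv_gcdf.
by rewrite /=; ring.
Qed.

(* The mean of the normal law conditioned on the window [t, t + 1]. *)
Let E t := (gpdf t - gpdf (t + 1)) / W t.

(** The function (x - t)(t + 1 - x) is nonnegative on the window, hence so is its integral against
    the density; [G] is a primitive. *)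
Let window_moment t : (1 + t + t ^+ 2) * W t <= (t + 1) * gpdf t - t * gpdf (t + 1).
Proof.
pose G x := x * gpdf x - gcdf x - (2 * t + 1) * gpdf x - t * (t + 1) * gcdf x.
have tt : t <= t + 1 by lra.
have : G t <= G (t + 1).
  apply: (deriv_ge0_le tt (df := fun x => gpdf x * ((x - t) * (t + 1 - x)))) => x.
    move=> _; have h := deriv_gcdf x; have h' := deriv_gpdf x; rewrite /G.
    eapply deriv_eq.
      apply: derivD; last first.
        by apply: derivN; apply: derivM; [exact: deriv_cst|exact: h].
      apply: derivD; last first.
        by apply: derivN; apply: derivM; [exact: deriv_cst|exact: h'].
      apply: derivD; first by apply: derivM; [exact: deriv_id|exact: h'].
      by apply: derivN; exact: h.
    by rewrite /=; ring.
  by move=> /andP[tx xt]; rewrite mulr_ge0 ?(ltW (p0 _))// mulr_ge0; lra.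
by rewrite /G /W => h; lra.
Qed.

(* Popoviciu: the conditional variance on a window of length 1 is at most 1/4,
   and the derivative of the conditional mean is 1 minus the variance. *)
Let window_mean_incr t : 3 / 4 <= E t - E (t - 1).
Proof.
have tt : t - 1 <= t by lra.
pose dE x := ((x + 1) * gpdf (x + 1) - x * gpdf x) / W x
             + ((gpdf x - gpdf (x + 1)) / W x) ^+ 2 - 3 / 4.
have : E (t - 1) - 3 / 4 * (t - 1) <= E t - 3 / 4 * t.
  apply: (deriv_ge0_le tt (f := fun x => E x - 3 / 4 * x) (df := dE)) => x _.
    rewrite /E; eapply deriv_eq.
      apply: derivD; last by repeat deriv_step.
      apply: derivM; last by apply: derivV; [rewrite lt0r_neq0|exact: dW].
      apply: derivD; first exact: deriv_gpdf.
      by apply: derivN; apply: deriv_gpdf_comp; repeat deriv_step.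
    by rewrite /= /dE; field; rewrite lt0r_neq0.
  rewrite /dE -/(E x); have h := window_moment x.
  have e : gpdf x - gpdf (x + 1) = E x * W x by rewrite /E divfK// lt0r_neq0.
  have h2 : 1 + x + x ^+ 2 - (2 * x + 1) * E x <=
      ((x + 1) * gpdf (x + 1) - x * gpdf x) / W x.
    by rewrite ler_pdivlMr// mulrBl -mulrA -e; lra.
  (* Completing the square: with E for [E x], 1 + x + x^2 - (2x + 1) E + E^2 = 3/4 + (E - x -
     1/2)^2. *)
  have := sqr_ge0 (E x - x - 1 / 2); lra.
lra.
Qed.

(** The logarithm of right side over left side vanishes at t = 0 by symmetry. Its derivative is the
    increment of the window mean, at least 3/4, minus [rho (1 + t) + rho (1 - t)], at most 3/8 +
    3/8. *)
Lemma odds_ratio_incr t : 0 <= t ->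
  odds' (1 + t) * (gcdf (t + 1) - gcdf t) <= odds' (1 - t) * (gcdf t - gcdf (t - 1)).
Proof.
move=> t0; have Wm x : W (x - 1) = gcdf x - gcdf (x - 1) by rewrite /W subrK.
rewrite -Wm -/(W t).
pose L x := ln (odds' (1 - x)) + ln (W (x - 1)) - (ln (odds' (1 + x)) + ln (W x)).
suff : 0 <= L t.
  rewrite subr_ge0 -!lnM ?posrE ?odds'_gt0//.
  have h1 : 0 < odds' (1 + t) * W t by rewrite mulr_gt0// odds'_gt0.
  have h2 : 0 < odds' (1 - t) * W (t - 1) by rewrite mulr_gt0// odds'_gt0.
  by rewrite ler_ln ?posrE.
have -> : 0 = L 0.
  rewrite /L Wm /W sub0r subr0 addr0 gcdfN add0r gcdf0.
  by rewrite (_ : 2^-1 - (1 - gcdf 1) = gcdf 1 - 2^-1); [rewrite subrr|field].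
apply: (deriv_ge0_le t0 (df := fun x => (E x - E (x - 1)) - (rho (1 + x) + rho (1 - x)))).
  move=> x _; rewrite /L; eapply deriv_eq.
    apply: derivD.
      apply: derivD.
        apply: deriv_ln; first exact: odds'_gt0.
        by apply: (deriv_comp (deriv_odds' _)); repeat deriv_step.
      by apply: deriv_ln => //; apply: (deriv_comp (dW _)); repeat deriv_step.
    apply: derivN; apply: derivD.
      apply: deriv_ln; first exact: odds'_gt0.
      by apply: (deriv_comp (g := fun x => 1 + x) (deriv_odds' _)); repeat deriv_step.
    by apply: deriv_ln => //; exact: dW.
  rewrite /= /E subrK.
  have := lt0r_neq0 (W0 x); have := lt0r_neq0 (W0 (x - 1)).
  have := lt0r_neq0 (odds'_gt0 (1 + x)); have := lt0r_neq0 (odds'_gt0 (1 - x)).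
  by move=> h1 h2 h3 h4; field; rewrite h1 h2 h3 h4.
move=> x /andP[x0 _]; have h := window_mean_incr x; rewrite subr_ge0.
apply: le_trans h; have h1 : rho (1 + x) <= 3 / 8 by apply: rho_le; lra.
have h2 : rho (1 - x) <= 3 / 8.
  have [h|h] := leP 0 (1 - x); first exact: rho_le.
  have : 0 <= rho (- (1 - x)) by apply: rho_ge0; lra.
  by rewrite rhoN; lra.
lra.
Qed.

(** The sum of the divergences of f from both alternatives for the threshold x, with the logarithms
    expanded for differentiation (see [kl_T]). *)
Let T x := 2 * ((1 - gcdf x) * ln (1 - gcdf x) + gcdf x * ln (gcdf x))
  - (1 - gcdf x) * (ln (1 - gcdf (x + 1)) + ln (1 - gcdf (x - 1)))
  - gcdf x * (ln (gcdf (x + 1)) + ln (gcdf (x - 1))).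

(** The derivative is grouped into a second difference of the log-odds, signed by [lodds_midconvex],
    and a difference of window terms, signed by [odds_ratio_incr]. *)
Let T_le0 x : 0 <= x -> T x <= T 0.
Proof.
move=> x0; apply: (deriv_le0_ge x0 (df := fun x =>
   - gpdf x * (lodds (x + 1) + lodds (x - 1) - 2 * lodds x)
   + (odds' (1 + x) * (gcdf (x + 1) - gcdf x) - odds' (1 - x) * (gcdf x - gcdf (x - 1))))) => y.
  move=> _; have h := deriv_gcdf y.
  have h1 : has_deriv (fun x => gcdf (x + 1)) y (gpdf (y + 1)).
    by eapply deriv_eq; [apply: deriv_gcdf_comp; repeat deriv_step|rewrite /=; ring].
  have h2 : has_deriv (fun x => gcdf (x - 1)) y (gpdf (y - 1)).
    by eapply deriv_eq; [apply: deriv_gcdf_comp; repeat deriv_step|rewrite /=; ring].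
  have hc (f : R -> R) d : has_deriv f y d -> has_deriv (fun x => 1 - f x) y (- d).
    move=> fd; eapply deriv_eq; first apply: derivD; first exact: deriv_cst.
      by apply: derivN; exact: fd.
    by rewrite add0r.
  rewrite /T; eapply deriv_eq.
    apply: derivD; first apply: derivD.
    - apply: derivM; first exact: deriv_cst.
      apply: derivD; apply: derivM.
      + exact: hc h.
      + by apply: deriv_ln; [exact: F1|exact: hc h].
      + exact: h.
      + by apply: deriv_ln; [exact: F0|exact: h].
    - apply: derivN; apply: derivM; first exact: hc h.
      by apply: derivD; apply: deriv_ln; [exact: F1|exact: hc h1|exact: F1|exact: hc h2].
    apply: derivN; apply: derivM; first exact: h.
    by apply: derivD; apply: deriv_ln; [exact: F0|exact: h1|exact: F0|exact: h2].
  rewrite /= /lodds (_ : odds' (1 - y) = odds' (y - 1)); last by rewrite -odds'N opprB.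
  rewrite [1 + y]addrC /odds'.
  by field; rewrite !lt0r_neq0.
move=> /andP[y0 _]; have := lodds_midconvex y0; have := odds_ratio_incr y0.
have := p0 y; move=> h1 h2 h3; rewrite -[leRHS]addr0 lerD// ?subr_le0//.
by rewrite mulNr oppr_le0 mulr_ge0// ltW.
Qed.

Lemma kl_compl (p q : R) : kl (1 - p) (1 - q) = kl p q.
Proof. by rewrite /kl !subKr addrC. Qed.

Let kl_T x : kl (1 - gcdf x) (1 - gcdf (x + 1)) + kl (1 - gcdf x) (1 - gcdf (x - 1)) = T x.
Proof.
rewrite /kl !subKr !ln_div ?posrE//; rewrite /T; ring.
Qed.

(** Reflecting x into - x exchanges the two alternatives, so the half-line x >= 0 is enough. *)
Lemma kl_shift_sum_le x :
  kl (1 - gcdf x) (1 - gcdf (x + 1)) + kl (1 - gcdf x) (1 - gcdf (x - 1))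
  <= 2 * kl (1 - gcdf 0) (1 - gcdf 1).
Proof.
have e0 : 2 * kl (1 - gcdf 0) (1 - gcdf 1) = T 0.
  rewrite -kl_T add0r sub0r gcdfN subKr gcdf0 (_ : 1 - 2^-1 = 2^-1); last by field.
  rewrite -[X in _ = _ + X]kl_compl (_ : 1 - 2^-1 = 2^-1); last by field.
  ring.
rewrite e0; have [x0|x0] := leP 0 x; first by rewrite kl_T T_le0.
have := @T_le0 (- x); rewrite -kl_T => /(_ _)/wrap[|]; first by lra.
apply: le_trans; rewrite -[X in X + _]kl_compl -[X in _ + X]kl_compl -!gcdfN.
rewrite !opprK (_ : - (- x + 1) = x - 1); last by ring.
rewrite (_ : - (- x - 1) = x + 1); last by ring.
by rewrite addrC.
Qed.

End odds.

Opaque expR ln gcdf gpdf normal_pdf.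

(** * Information of arbitrary quantizers *)

Section normal_sets.
Context {R : realType}.
Implicit Types (A B : set R) (x m t c K : R).
Local Notation gcdf := (@gcdf R).
Local Notation gpdf := (@gpdf R).

Definition nP m A : R := fine (normal_prob m 1 A).

Lemma nP_ge0 m A : 0 <= nP m A.
Proof. exact/fine_ge0/measure_ge0. Qed.

Lemma nPE m A : measurable A -> (nP m A)%:E = normal_prob m 1 A.
Proof. by move=> mA; rewrite fineK// fin_num_measure. Qed.

Lemma nP_setC m A : measurable A -> nP m (~` A) = 1 - nP m A.
Proof.
move=> mA; apply: EFin_inj; rewrite nPE; last exact: measurableC.
by rewrite probability_setC// EFinB nPE.
Qed.

Lemma nP_le1 m A : measurable A -> nP m A <= 1.
Proof. by move=> mA; rewrite -lee_fin nPE// probability_le1. Qed.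

Lemma nP_split m A B : measurable A -> measurable B ->
  nP m A = nP m (A `&` B) + nP m (A `\` B).
Proof.
move=> mA mB; have mI := measurableI _ _ mA mB; have mD := measurableD mA mB.
apply: EFin_inj; rewrite EFinD !nPE// addeC.
by rewrite -(measureDI (normal_prob m 1) mA mB).
Qed.

Lemma nP_tail m x : nP m `[x, +oo[ = gcdf (m - x).
Proof. by rewrite /nP normal_prob_tail. Qed.

(** Pointwise inequalities between densities integrate over [A]. Two terms on the right serve the
    arithmetic-geometric mean bound; with one of them zero this gives the scaling bounds behind
    Neyman-Pearson. *)
Lemma nP_lin (c0 c1 c2 m0 m1 m2 : R) A : measurable A ->
  0 <= c0 -> 0 <= c1 -> 0 <= c2 ->
  (forall x, A x -> c0 * normal_pdf m0 1 x <=
     c1 * normal_pdf m1 1 x + c2 * normal_pdf m2 1 x) ->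
  c0 * nP m0 A <= c1 * nP m1 A + c2 * nP m2 A.
Proof.
move=> mA h0 h1 h2 h.
have mf m : measurable_fun A (fun x => (normal_pdf m 1 x)%:E).
  apply: (@measurable_funS _ _ _ _ setT) => //.
  by apply/measurable_EFinP; exact: measurable_normal_pdf.
have gf m x : A x -> (0 <= (normal_pdf m 1 x)%:E)%E.
  by move=> _; rewrite lee_fin normal_pdf_ge0.
have cg (c m : R) x : 0 <= c -> A x -> (0 <= c%:E * (normal_pdf m 1 x)%:E)%E.
  by move=> c0' Ax; apply: mule_ge0; [rewrite lee_fin|exact: gf].
have e (c m : R) : 0 <= c -> ((c * nP m A)%:E = \int[lebesgue_measure]_(x in A) (c%:E * (normal_pdf m 1 x)%:E))%E.
  by move=> c0'; rewrite EFinM nPE// /normal_prob ge0_integralZl_EFin//; [move=> x; exact: gf|exact: mf].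
rewrite -lee_fin EFinD !e// -ge0_integralD//; last 4 first.
- by move=> x Ax; exact: cg.
- by apply: measurable_funeM; exact: mf.
- by move=> x Ax; exact: cg.
- by apply: measurable_funeM; exact: mf.
apply: ge0_le_integral => //.
- by move=> x Ax; exact: cg.
- by apply: measurable_funeM; exact: mf.
- by apply: emeasurable_funD; apply: measurable_funeM; exact: mf.
Qed.

Lemma nP_le_scale K m m' A : measurable A -> 0 <= K ->
  (forall x, A x -> normal_pdf m 1 x <= K * normal_pdf m' 1 x) ->
  nP m A <= K * nP m' A.
Proof.
move=> mA K0 h; have := @nP_lin 1 K 0 m m' 0 A mA ler01 K0 (lexx _).
rewrite !mul1r !mul0r !addr0; apply => x Ax; rewrite mul1r mul0r addr0; exact: h.
Qed.

Lemma nP_ge_scale K m m' A : measurable A -> 0 <= K ->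
  (forall x, A x -> K * normal_pdf m' 1 x <= normal_pdf m 1 x) ->
  K * nP m' A <= nP m A.
Proof.
move=> mA K0 h; have := @nP_lin K 1 0 m' m 0 A mA K0 ler01 (lexx _).
rewrite !mul1r !mul0r !addr0; apply => x Ax; rewrite mul1r mul0r addr0; exact: h.
Qed.

Definition lr m m' x : R := expR ((m - m') * (x - (m + m') / 2)).

Lemma normal_pdf_lr m m' x : normal_pdf m 1 x = lr m m' x * normal_pdf m' 1 x.
Proof.
by rewrite !normal_pdf1E /lr mulrCA -expRD; congr (_ * expR _); field.
Qed.

Lemma lr_gt0 m m' x : 0 < lr m m' x.
Proof. exact: expR_gt0. Qed.

Let split_le (k i a b i' a' b' : R) : a <= k * a' -> k * b' <= b ->
  i + a - (i + b) <= k * (i' + a' - (i' + b')).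
Proof. by lra. Qed.

(** The likelihood ratio is at most its value at x on [A] minus the tail and at least that value on
    the tail minus [A]; the common part cancels. *)
Lemma neyman_pearson m m' x A : measurable A -> m' <= m ->
  nP m A - nP m `[x, +oo[ <= lr m m' x * (nP m' A - nP m' `[x, +oo[).
Proof.
move=> mA mm; pose T : set R := `[x, +oo[%classic; rewrite -/T; have mT : measurable T by exact: measurable_itv.
rewrite (nP_split m mA mT) (nP_split m' mA mT) (nP_split m mT mA) (nP_split m' mT mA).
rewrite (setIC T A).
have h1 : nP m (A `\` T) <= lr m m' x * nP m' (A `\` T).
  apply: nP_le_scale; [exact: measurableD|exact/ltW/lr_gt0|move=> z [_ /= nT]].
  rewrite (normal_pdf_lr m m') ler_wpM2r ?normal_pdf_ge0// ler_expR ler_wpM2l ?subr_ge0//.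
  rewrite lerB// leNgt; apply/negP => xz; apply: nT.
  by rewrite /T /= in_itv/= andbT ltW.
have h2 : lr m m' x * nP m' (T `\` A) <= nP m (T `\` A).
  apply: nP_ge_scale; [exact: measurableD|exact/ltW/lr_gt0|move=> z [/= zT _]].
  rewrite (normal_pdf_lr m m') ler_wpM2r ?normal_pdf_ge0// ler_expR ler_wpM2l ?subr_ge0//.
  by rewrite lerB//; move: zT; rewrite /T /= in_itv/= andbT.
exact: split_le.
Qed.

Opaque nP.

Lemma gcdf_arb_small (e : R) : 0 < e -> exists x, gcdf x < e.
Proof.
move=> e0; have [e1|e1] := ltP e 1.
  have [|x xe] := @gcdf_surj R (e / 2); first by apply/andP; split; lra.
  by exists x; lra.
by exists 0; apply: lt_le_trans e1; exact: gcdf_lt1.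
Qed.

(** Absolute continuity from Neyman-Pearson alone: a set null under m' but not under m would beat a
    tail of smaller probability under m. If m < m', the complement is used. *)
Lemma nP_eq0 m m' A : measurable A -> nP m' A = 0 -> nP m A = 0.
Proof.
move=> mA p0; apply/eqP; rewrite eq_le nP_ge0 andbT leNgt; apply/negP => pos.
have [z zs] := gcdf_arb_small pos.
have [mm|/ltW mm] := leP m' m.
  have := neyman_pearson (m - z) mA mm; rewrite p0 (nP_tail m) (nP_tail m') subKr.
  have : 0 <= lr m m' (m - z) * gcdf (m' - (m - z)).
    exact: mulr_ge0 (ltW (lr_gt0 _ _ _)) (ltW (gcdf_gt0 _)).
  by rewrite sub0r mulrN => h1 h2; move: zs h1 h2; clear; lra.
have := neyman_pearson (z + m) (measurableC mA) mm.
rewrite (nP_setC m mA) (nP_setC m' mA) (nP_tail m) (nP_tail m') p0.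
have k0 := lr_gt0 m' m (z + m).
rewrite (_ : m - (z + m) = - z) ?gcdfN; last by ring.
have := gcdf_lt1 (m' - (z + m)); rewrite -subr_gt0 subr0 => h /(lt_le_trans h).
by rewrite pmulr_rgt0// => h'; move: zs h'; clear; lra.
Qed.

Lemma nP_gt0 m m' A : measurable A -> 0 < nP m' A -> 0 < nP m A.
Proof.
move=> mA p0; rewrite lt0r nP_ge0 andbT; apply: contraTneq p0 => h.
by rewrite (nP_eq0 m' mA h) ltxx.
Qed.

(** The family of linear inequalities is sharpest when c1 q1 = c2 q2, both then being the square
    root of q1 q2. *)
Let sqr_le_of_amgm (th p q1 q2 : R) : 0 <= th -> 0 < p -> 0 < q1 -> 0 < q2 ->
  (forall c1 c2, 0 < c1 -> 0 < c2 -> c1 * c2 = 1 -> 2 * th * p <= c1 * q1 + c2 * q2) ->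
  (th * p) ^+ 2 <= q1 * q2.
Proof.
move=> th0 p0 q1p q2p h; pose s := Num.sqrt (q1 * q2).
have s0 : 0 < s by rewrite sqrtr_gt0 mulr_gt0.
have s2 : s ^+ 2 = q1 * q2 by rewrite sqr_sqrtr// ltW// mulr_gt0.
have c1 : 0 < s / q1 by rewrite divr_gt0.
have c2 : 0 < s / q2 by rewrite divr_gt0.
have cc : (s / q1) * (s / q2) = 1.
  by rewrite mulf_div -expr2 s2 divff// mulf_neq0 ?gt_eqF.
have {h} := h _ _ c1 c2 cc; rewrite !divfK ?gt_eqF// => h.
have s0' := ltW s0; have tp : 0 <= th * p by rewrite mulr_ge0// ltW.
by rewrite -s2 ler_sqr ?nnegrE//; move: h; rewrite -mulrA; clear; lra.
Qed.

Let amgm_pdf (u v x : R) : 0 < u -> 0 < v -> u * v = 1 ->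
  2 * expR (- (1 / 2)) * normal_pdf 0 1 x <=
    u * normal_pdf (-1) 1 x + v * normal_pdf 1 1 x.
Proof.
move=> u0 v0 uv; rewrite (normal_pdf_lr (-1) 0) (normal_pdf_lr 1 0).
have -> : lr (-1) 0 x = expR (- (1 / 2)) * expR (- x).
  by rewrite /lr -expRD; congr expR; field.
have -> : lr 1 0 x = expR (- (1 / 2)) * expR x.
  by rewrite /lr -expRD; congr expR; field.
have := normal_pdf_ge0 0 1 x; have := expR_ge0 (- (1 / 2)) : 0 <= _ :> R.
have := expR_gt0 x; rewrite expRN.
move: (expR x) (expR (- (1 / 2))) (normal_pdf 0 1 x) => E th f E0 th0 f0.
have -> : u * (th / E * f) + v * (th * E * f) = th * f * (u / E + v * E).
  by field; rewrite gt_eqF.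
rewrite -mulrA [2 * _]mulrC; apply: ler_wpM2l; first exact: mulr_ge0.
have euv : (u / E) * (v * E) = 1 by rewrite mulrACA mulVf ?gt_eqF// mulr1.
have w1 : 0 < u / E by rewrite divr_gt0.
have w2 : 0 < v * E by rewrite mulr_gt0.
move: (u / E) (v * E) w1 w2 euv => a b; clear => a0 b0 ab.
by have := sqr_ge0 (a - b); nra.
Qed.

(* Cauchy-Schwarz, using that the densities of N(-1,1) and N(1,1) multiply to
   1/e times the squared density of N(0,1). *)
Lemma nP_product_ge A : measurable A -> 0 < nP 0 A ->
  expR (- 1) * nP 0 A ^+ 2 <= nP (-1) A * nP 1 A.
Proof.
move=> mA p0.
have -> : expR (- 1) = expR (- (1 / 2)) ^+ 2 :> R.
  by rewrite expr2 -expRD; congr expR; field.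
rewrite -exprMn; apply: sqr_le_of_amgm; [exact: expR_ge0|exact: p0| | |].
- exact: nP_gt0 p0.
- exact: nP_gt0 p0.
move=> c1 c2 c10 c20 cc; apply: nP_lin mA _ (ltW c10) (ltW c20) _.
  by rewrite mulr_ge0// expR_ge0.
by move=> x _; exact: amgm_pdf.
Qed.

End normal_sets.

(** * Convexity and monotonicity of the binary divergence *)

Section kl_theory.
Context {R : realType}.
Implicit Types (p q k t x y : R).

Lemma ln_ge_1BV x : 0 < x -> 1 - x^-1 <= ln x.
Proof.
move=> x0; have := expR_ge1Dx (- ln x); rewrite expRN lnK ?posrE// => h.
by lra.
Qed.

Lemma ln_gt_1BV x : 0 < x -> x != 1 -> 1 - x^-1 < ln x.
Proof.
move=> x0 x1; have := @expR_gt1Dx _ (- ln x); rewrite oppr_eq0 ln_eq0//.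
by move=> /(_ x1); rewrite expRN lnK ?posrE// => h; lra.
Qed.

(* The tangent line of [x ln x] at [x = k], scaled by [b]. *)
Lemma mul_ln_div_ge (a b k : R) : 0 <= a -> 0 < b -> 0 < k ->
  a * ln k + a - b * k <= a * ln (a / b).
Proof.
rewrite le_eqVlt => /predU1P[<- b0 k0|a0 b0 k0].
  by rewrite !mul0r addr0 sub0r oppr_le0 mulr_ge0// ltW.
have ab : 0 < a / b by rewrite divr_gt0.
have e : ln (a / b / k) = ln (a / b) - ln k by rewrite ln_div ?posrE.
have := ln_ge_1BV (divr_gt0 ab k0); rewrite e => h.
have : a * (1 - (a / b / k)^-1) <= a * (ln (a / b) - ln k) by rewrite ler_pM2l.
rewrite (_ : a * (1 - _) = a - b * k); last by field; rewrite !gt_eqF.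
by lra.
Qed.

Lemma ln_ge_of_expR x y : 0 < y -> expR x <= y -> x <= ln y.
Proof. by move=> y0 h; rewrite -[leLHS]expRK ler_ln ?posrE ?expR_gt0. Qed.

Lemma kl_ge0 p q : 0 <= p <= 1 -> 0 < q < 1 -> 0 <= kl p q.
Proof.
move=> /andP[p0 p1] /andP[q0 q1].
have := @mul_ln_div_ge p q 1 p0 q0 ltr01.
have := @mul_ln_div_ge (1 - p) (1 - q) 1; rewrite !subr_ge0 subr_gt0 ln1.
by move=> /(_ p1 q1 ltr01); rewrite /kl; lra.
Qed.

Lemma kl_gt0 p q : 0 < p < 1 -> 0 < q < 1 -> p != q -> 0 < kl p q.
Proof.
move=> /andP[p0 p1] /andP[q0 q1] pq.
have pq1 : p / q != 1
  by apply: contraNneq pq => e; apply/eqP; rewrite -[LHS](@divfK _ q) ?e ?mul1r// gt_eqF.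
have := ln_gt_1BV (divr_gt0 p0 q0) pq1; rewrite -(ltr_pM2l p0) => h.
have := @mul_ln_div_ge (1 - p) (1 - q) 1; rewrite !subr_ge0 subr_gt0 ln1.
move=> /(_ (ltW p1) q1 ltr01); rewrite /kl.
have : p * (1 - (p / q)^-1) = p - q by field; rewrite !gt_eqF.
by move: h => + e; rewrite e; lra.
Qed.

Lemma klxx p : kl p p = 0.
Proof.
rewrite /kl; have [->|p0] := eqVneq p 0; first by rewrite mul0r add0r subr0 divr1 ln1 mulr0.
rewrite divff// ln1 mulr0 add0r; have [->|p1] := eqVneq (1 - p) 0; first by rewrite mul0r.
by rewrite divff// ln1 mulr0.
Qed.

(** Both terms on the right are bounded below by their tangents at the common slope [A / B], and
    these tangents average to the left side. *)
Lemma log_sum_ineq t p p' q q' : 0 <= t <= 1 -> 0 <= p -> 0 <= p' -> 0 < q -> 0 < q' ->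
  (t * p + (1 - t) * p') * ln ((t * p + (1 - t) * p') / (t * q + (1 - t) * q'))
  <= t * (p * ln (p / q)) + (1 - t) * (p' * ln (p' / q')).
Proof.
move=> /andP[t0 t1] p0 p'0 q0 q'0.
have u0 : 0 <= 1 - t by rewrite subr_ge0.
set A := t * p + _; set B := t * q + _.
have B0 : 0 < B.
  rewrite /B; have [t0'|t0'] := ltP 0 t; first by rewrite ltr_wpDr ?mulr_gt0 ?mulr_ge0// ltW.
  by rewrite (_ : t = 0) ?mul0r ?add0r ?subr0 ?mul1r//; lra.
have [A0|A0] := eqVneq A 0.
  have a1 : 0 <= t * p by rewrite mulr_ge0.
  have a2 : 0 <= (1 - t) * p' by rewrite mulr_ge0.
  have e1 : t * p = 0 by move: A0; rewrite /A; lra.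
  have e2 : (1 - t) * p' = 0 by move: A0; rewrite /A; lra.
  by rewrite A0 !mulrA e1 e2 !mul0r addr0.
have Ap : 0 < A by rewrite lt0r A0 addr_ge0// mulr_ge0.
have k0 : 0 < A / B by rewrite divr_gt0.
have h1 := mul_ln_div_ge p0 q0 k0; have h2 := mul_ln_div_ge p'0 q'0 k0.
have h3 := lerD (ler_wpM2l t0 h1) (ler_wpM2l u0 h2).
apply: le_trans h3; rewrite le_eqVlt; apply/orP; left; apply/eqP.
have e : B * (A / B) = A by rewrite mulrC divfK// gt_eqF.
set l := ln _; set k := A / B in e *.
have -> : t * (p * l + p - q * k) + (1 - t) * (p' * l + p' - q' * k) = A * l + A - B * k.
  by rewrite /A /B; ring.
by rewrite e addrK.
Qed.

Lemma kl_convex t p p' q q' : 0 <= t <= 1 -> 0 <= p <= 1 -> 0 <= p' <= 1 ->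
  0 < q < 1 -> 0 < q' < 1 ->
  kl (t * p + (1 - t) * p') (t * q + (1 - t) * q') <= t * kl p q + (1 - t) * kl p' q'.
Proof.
move=> t01 /andP[p0 p1] /andP[p'0 p'1] /andP[q0 q1] /andP[q'0 q'1].
have h1 := log_sum_ineq t01 p0 p'0 q0 q'0.
have := @log_sum_ineq t (1 - p) (1 - p') (1 - q) (1 - q') t01.
rewrite !subr_ge0 !subr_gt0 => /(_ p1 p'1 q1 q'1).
rewrite (_ : t * (1 - p) + _ = 1 - (t * p + (1 - t) * p')); last by ring.
rewrite (_ : t * (1 - q) + _ = 1 - (t * q + (1 - t) * q')); last by ring.
by move: h1; rewrite /kl; lra.
Qed.

(** The divergence is convex in its second argument and vanishes at p, so it grows as that argument
    moves away from p on either side. *)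
Lemma kl_between p q q' : 0 < p < 1 -> 0 < q' < 1 ->
  (p <= q <= q') || (q' <= q <= p) -> kl p q <= kl p q'.
Proof.
move=> p01 q01 h; have [e|ne] := eqVneq p q'.
  have -> : q = p by case/orP: h => /andP[]; rewrite -?e => *; apply/eqP; rewrite eq_le; apply/andP.
  by rewrite klxx -e klxx.
pose t := (q' - q) / (q' - p).
have d : q' - p != 0 by rewrite subr_eq0 eq_sym.
have t01 : 0 <= t <= 1.
  case/orP: h => /andP[h1 h2].
    have dp : 0 < q' - p by rewrite lt0r d subr_ge0; lra.
    by rewrite /t ler_pdivrMr// mul1r divr_ge0 ?(ltW dp)//=; lra.
  have dp : 0 < p - q' by rewrite lt0r -opprB oppr_eq0 d oppr_ge0 subr_le0; lra.
  rewrite /t -[q' - q]opprB -[q' - p]opprB divrNN ler_pdivrMr// mul1r divr_ge0 ?(ltW dp)//=; lra.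
have := @kl_convex t p p p q' t01; rewrite klxx mulr0 add0r.
have p01' : 0 <= p <= 1 by case/andP: p01 => a b; rewrite !ltW.
move=> /(_ p01' p01' p01 q01).
rewrite (_ : t * p + (1 - t) * p = p); last by ring.
rewrite (_ : t * p + (1 - t) * q' = q); last by rewrite /t; field.
move/le_trans; apply; rewrite ler_piMl ?kl_ge0//.
by case/andP: t01; lra.
Qed.

End kl_theory.

(** * Numerical bounds for cells with both alternatives on one side *)

Section numeric.
Context {R : realType}.
Implicit Types (u x y : R).
Local Notation gcdf := (@gcdf R).

Lemma expRN_bounds u : 0 <= u ->
  (1 - u + u ^+ 2 / 2 - u ^+ 3 / 6 <= expR (- u)) * (expR (- u) <= 1 - u + u ^+ 2 / 2).
Proof.
move=> u0.
have dE y : has_deriv (fun u => expR (- u)) y (- expR (- y)).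
  by eapply deriv_eq; [repeat deriv_step|rewrite /=; ring].
have up y : 0 <= y -> 0 <= 1 - y + y ^+ 2 / 2 - expR (- y).
  move=> y0; apply: (nonneg_of_deriv (f := fun y => 1 - y + y ^+ 2 / 2 - expR (- y))
     (df := fun y => expR (- y) - (1 - y))); first exact: y0.
  - by rewrite oppr0 expR0; lra.
  - move=> z _; eapply deriv_eq; first (apply: derivD; [|apply: derivN; exact: dE]).
      by repeat deriv_step.
    by rewrite /=; field.
  - by move=> z _; have := expR_ge1Dx (- z); lra.
split; rewrite -subr_ge0; last exact: up.
apply: (nonneg_of_deriv (f := fun u => expR (- u) - (1 - u + u ^+ 2 / 2 - u ^+ 3 / 6))
  (df := fun y => 1 - y + y ^+ 2 / 2 - expR (- y))); first exact: u0.
- by rewrite oppr0 expR0; lra.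
- move=> z _; eapply deriv_eq; first (apply: derivD; [exact: dE|]).
    by repeat deriv_step.
  by rewrite /=; field.
- exact: up.
Qed.

Lemma gpeak_bounds : 247 / 625 <= (gpeak : R) <= 241 / 600.
Proof.
have p2 := @gpeak_sqr R; have p0 := @gpeak_gt0 R; have ple := @pi_le R; have pge := @pi_ge R.
have h : gpeak ^+ 2 * (2 * pi) = 1 :> R.
  by rewrite p2 mulVf// mulf_neq0 ?gt_eqF ?pi_gt0.
have p2' : 0 < (gpeak : R) ^+ 2 by rewrite exprn_gt0.
have l : 5 / 32 <= (gpeak : R) ^+ 2 by nra.
have u : (gpeak : R) ^+ 2 <= 5 / 31 by nra.
move: l u p0; rewrite expr2; clear; set g := gpeak => l u p0.
by apply/andP; split; nra.
Qed.

(** Taylor bounds for e^(-x^2/2) integrated term by term over [0, 1]; the value is about 0.8413. *)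
Lemma gcdf1_bounds : 419 / 500 <= gcdf 1 <= 528 / 625.
Proof.
have /andP[g1 g2] := gpeak_bounds; have p0 := @gpeak_gt0 R.
have e (x : R) : 0 <= x -> - x ^+ 2 / 2 = - (x ^+ 2 / 2) by move=> _; rewrite mulNr.
have xx (x : R) : 0 <= x ^+ 2 / 2 by rewrite divr_ge0 ?sqr_ge0.
have h1 : gcdf 0 - gpeak * (0 - 0 ^+ 3 / 6 + 0 ^+ 5 / 40 - 0 ^+ 7 / 336) <=
          gcdf 1 - gpeak * (1 - 1 ^+ 3 / 6 + 1 ^+ 5 / 40 - 1 ^+ 7 / 336).
  apply: (deriv_ge0_le (f := fun x => gcdf x - gpeak * (x - x ^+ 3 / 6 + x ^+ 5 / 40 - x ^+ 7 / 336))
    ler01 (df := fun x => gpeak * (expR (- (x ^+ 2 / 2)) - (1 - (x ^+ 2 / 2) + (x ^+ 2 / 2) ^+ 2 / 2 - (x ^+ 2 / 2) ^+ 3 / 6)))).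
    move=> x _; eapply deriv_eq; first (apply: derivD; [exact: deriv_gcdf|]).
      by repeat deriv_step.
    by rewrite /= gpdfE mulNr; field.
  move=> x _; apply: mulr_ge0; first exact: ltW.
  by rewrite subr_ge0 (expRN_bounds (xx x)).
have h2 : gcdf 1 - gpeak * (1 - 1 ^+ 3 / 6 + 1 ^+ 5 / 40) <=
          gcdf 0 - gpeak * (0 - 0 ^+ 3 / 6 + 0 ^+ 5 / 40).
  apply: (deriv_le0_ge (f := fun x => gcdf x - gpeak * (x - x ^+ 3 / 6 + x ^+ 5 / 40))
    ler01 (df := fun x => gpeak * (expR (- (x ^+ 2 / 2)) - (1 - (x ^+ 2 / 2) + (x ^+ 2 / 2) ^+ 2 / 2)))).
    move=> x _; eapply deriv_eq; first (apply: derivD; [exact: deriv_gcdf|]).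
      by repeat deriv_step.
    by rewrite /= gpdfE mulNr; field.
  move=> x _; apply: mulr_ge0_le0; first exact: ltW.
  by rewrite subr_le0 (expRN_bounds (xx x)).
move: h1 h2; rewrite gcdf0 !expr1n !expr0n/= !mul0r !subr0 !addr0 mulr0 subr0 => h1 h2.
apply/andP; split; lra.
Qed.

Lemma ln_ge_pade y : 1 <= y -> 2 * (y - 1) / (y + 1) <= ln y.
Proof.
move=> y1; rewrite -subr_ge0.
have -> : 0 = ln 1 - 2 * (1 - 1) / (1 + 1) :> R by rewrite ln1 subrr mulr0 mul0r subrr.
apply: (deriv_ge0_le (f := fun y => ln y - 2 * (y - 1) / (y + 1)) y1
  (df := fun y => (y - 1) ^+ 2 / (y * (y + 1) ^+ 2))) => z /andP[z1 _].
  have z0 : 0 < z by lra.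
  have z2 : z + 1 != 0 by rewrite gt_eqF//; lra.
  eapply deriv_eq.
    apply: derivD; first by apply: (deriv_ln (g := fun y => y)); [exact: z0|exact: deriv_id].
    apply: derivN; apply: derivM; first by repeat deriv_step.
    by apply: (derivV (f := fun y => y + 1)); [exact: z2|repeat deriv_step].
  by rewrite /=; field; rewrite z2 gt_eqF.
have z0 : 0 < z by lra.
by rewrite divr_ge0 ?sqr_ge0// mulr_ge0 ?sqr_ge0// ltW.
Qed.

(** With F = [gcdf 1], the right side is - log (4 F (1 - F)). *)
Lemma info_ge : 3 / 5 <= 2 * kl (1 - gcdf 0) (1 - gcdf 1).
Proof.
have /andP[] := gcdf1_bounds; move: (gcdf 1) => F l u.
rewrite gcdf0 /kl (_ : 1 - (1 - 2^-1) = 2^-1); last by field.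
rewrite (_ : 1 - 2^-1 = 2^-1); last by field.
rewrite subKr; have Fp : 0 < F by lra. have F1 : 0 < 1 - F by lra.
rewrite !ln_div ?posrE//.
have h2 : ln (2^-1 : R) = - ln 2 by rewrite lnV ?posrE.
have e : ln (4 * F * (1 - F)) = ln 2 + ln 2 + ln F + ln (1 - F).
  rewrite -!lnM ?posrE ?mulr_gt0//; congr ln; ring.
have h : ln (4 * F * (1 - F)) <= - (3 / 5).
  have h0 : 0 <= 3 / 5 :> R by lra.
  have hx : 0 < 4 * F * (1 - F) by rewrite !mulr_gt0.
  have hy : 4 * F * (1 - F) <= expR (- (3 / 5)).
    by apply: le_trans (expRN_bounds h0).1; nra.
  by rewrite -[leRHS]expRK ler_ln ?posrE ?expR_gt0.
rewrite h2; lra.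
Qed.

(** Here E is 1/e. The pair (q1, q2) is traded for (p, q1 q2 / p), which has the same product and no
    smaller total divergence; the first member then contributes 0. By monotonicity q = E p is the
    worst case, and its divergence is at most 3/4 p, which is why p is cut at 4/5. The Pade bound
    for the logarithm is attained with no slack at p = 4/5, E = 1/2. *)
Lemma kl_bad_small (E p q1 q2 : R) : 0 < p <= 4 / 5 -> 0 < E <= 1 / 2 -> ln E = -1 ->
  0 < q1 <= p -> 0 < q2 <= p -> E * p ^+ 2 <= q1 * q2 ->
  kl p q1 + kl p q2 <= 3 / 5.
Proof.
move=> /andP[p0 p1] /andP[E0 E1] lE /andP[q10 q1p] /andP[q20 q2p] qq.
have q12 : 0 < q1 * q2 by rewrite mulr_gt0.
have [q qE] : exists q, q = q1 * q2 / p by eexists.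
have q0 : 0 < q by rewrite qE divr_gt0.
have qp : q <= p by rewrite qE ler_pdivrMr// ler_pM// ltW.
have Eq : E * p <= q by rewrite qE ler_pdivlMr// -mulrA -expr2.
have Ep0 : 0 < E * p by rewrite mulr_gt0.
have Ep1 : E * p < p by rewrite gtr_pMl//; lra.
have r0 : 0 < 1 - p by lra.
have h1 : kl p q1 + kl p q2 <= kl p q.
  have v1 : 0 < 1 - q1 by lra.
  have v2 : 0 < 1 - q2 by lra.
  have v : 0 < 1 - q by lra.
  rewrite /kl !ln_div ?posrE//.
  have e1 : ln q = ln q1 + ln q2 - ln p by rewrite qE ln_div ?posrE// lnM ?posrE.
  have e2 : ln (1 - p) + ln (1 - q) <= ln (1 - q1) + ln (1 - q2).
    rewrite -!lnM ?posrE// ler_ln ?posrE ?mulr_gt0// -subr_ge0.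
    rewrite (_ : _ - _ = (p - q1) * (p - q2) / p); last by rewrite qE; field; rewrite gt_eqF.
    by rewrite divr_ge0 ?mulr_ge0 ?subr_ge0// ltW.
  have := ler_wpM2l (ltW r0) e2; rewrite e1; lra.
apply: (le_trans h1).
have h2 : kl p q <= kl p (E * p).
  by apply: kl_between; [lra|lra|apply/orP; right; apply/andP].
apply: (le_trans h2).
have y1 : 1 <= (1 - E * p) / (1 - p) by rewrite ler_pdivlMr//; lra.
have := ln_ge_pade y1.
rewrite (_ : 2 * _ / _ = 2 * (p - E * p) / (2 - p - E * p)); last first.
  by field; rewrite !gt_eqF//; lra.
have w0 : 0 < 2 - p - E * p by lra.
rewrite ler_pdivrMr// => h3.
have l0 : 0 <= ln ((1 - E * p) / (1 - p)) by exact: ln_ge0.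
rewrite /kl ln_div ?posrE// lnM ?posrE// lE.
rewrite (_ : (1 - p) / (1 - E * p) = ((1 - E * p) / (1 - p))^-1); last by rewrite invf_div.
rewrite lnV ?posrE; last by lra.
set L := ln _ in l0 h3 *.
have : p / 4 <= (1 - p) * L.
  rewrite -(ler_pM2r w0); apply: (@le_trans _ _ ((1 - p) * (2 * (p - E * p)))); last first.
    by rewrite -[leRHS]mulrA ler_pM2l.
  have a1 : 0 <= 4 / 5 - p by lra.
  have a2 : 0 <= 1 / 2 - E by lra.
  have := mulr_ge0 (ltW p0) (mulr_ge0 a1 a2); have := mulr_ge0 (ltW p0) a1.
  by have := mulr_ge0 (ltW p0) a2; clear; lra.
lra.
Qed.

Lemma kl_num1 x : 149 / 200 <= x -> kl 1 x <= 3 / 10.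
Proof.
move=> x0.
rewrite /kl subrr mul0r addr0 !mul1r lnV ?posrE; last by lra.
rewrite lerNl -[leLHS]expRK ler_ln ?posrE ?expR_gt0//; last by lra.
have h0 : 0 <= 3 / 10 :> R by lra.
by apply: le_trans (expRN_bounds h0).2 _; lra.
Qed.

Lemma kl_num2 : kl (4 / 5) (17 / 40) <= 3 / 10 :> R.
Proof.
have e1 : (4 / 5 : R) / (17 / 40) = 32 / 17 by field.
have e2 : (1 - 4 / 5 : R) / (1 - 17 / 40) = (23 / 8)^-1 by field.
rewrite /kl e1 e2 lnV ?posrE; last by lra.
have l17 : 0 < 32 / 17 :> R by lra.
have l8 : 0 < 23 / 8 :> R by lra.
have l4 : 0 < (32 / 17 : R) ^+ 4 by rewrite exprn_gt0.
suff : ln ((32 / 17) ^+ 4) - ln (23 / 8) <= 3 / 2 :> R.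
  by rewrite lnXn// -mulr_natl; lra.
rewrite -ln_div ?posrE// -[leRHS]opprK lerNr -lnV ?posrE; last by rewrite divr_gt0.
apply: ln_ge_of_expR; first by rewrite invr_gt0 divr_gt0.
have h0 : 0 <= 3 / 16 :> R by lra.
have b7 := (expRN_bounds h0).2.
have b8 : expR (- (3 / 16)) <= 191 / 230 :> R by lra.
have g0 : 0 <= expR (- (3 / 16)) :> R by exact: expR_ge0.
(* At 3/16 the quadratic Taylor bound is accurate enough; three squarings follow, each rounded
   up. *)
have -> : expR (- (3 / 2)) = expR (- (3 / 16)) ^+ 8 :> R.
  by rewrite -expRM_natl; congr expR; field.
move: (expR _) b8 g0 => g b8 g0.
have g2 : g ^+ 2 <= 20 / 29 by rewrite expr2; nra.
have g20 : 0 <= g ^+ 2 by rewrite exprn_ge0.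
have g4 : (g ^+ 2) ^+ 2 <= 10 / 21 by rewrite expr2; nra.
have g40 : 0 <= (g ^+ 2) ^+ 2 by rewrite exprn_ge0.
have g8 : ((g ^+ 2) ^+ 2) ^+ 2 <= 5 / 22 by rewrite expr2; nra.
rewrite (_ : g ^+ 8 = ((g ^+ 2) ^+ 2) ^+ 2); last by rewrite -!exprM.
by apply: (le_trans g8); rewrite invf_div ler_pdivlMr//; lra.
Qed.

(** Here K is e^(1/2) and D is [1 - gcdf 1]. The lower bound on q is affine in p, so joint convexity
    reduces the claim to p = 4/5 and p = 1. At these endpoints the ranges of K and D give q >= 17/40
    and q >= 149/200. *)
Lemma kl_bad_large (K D p q : R) : 4 / 5 <= p < 1 -> 8 / 5 <= K <= 5 / 3 ->
  97 / 625 <= D <= 2 / 10 ->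
  1 / 2 + K * (D - (1 - p)) <= q -> q <= p -> kl p q <= 3 / 10.
Proof.
move=> /andP[p0 p1] /andP[K0 K1] /andP[D0 D1] lq qp.
have Kpos : 0 <= K by clear -K0; lra.
have Dpos : 0 <= D by clear -D0; lra.
have r0 : 0 <= 1 - p by clear -p1; lra.
have r5 : 1 - p <= 1 / 5 by clear -p0; lra.
have d0 : 0 <= 1 / 5 - D by clear -D1; lra.
have d1 : 1 / 5 - D <= 28 / 625 by clear -D0; lra.
have n1 : 0 <= 8 / 5 :> R by clear; lra.
have n2 : 0 <= 97 / 625 :> R by clear; lra.
have b1 : 8 / 5 * (97 / 625) <= K * D := ler_pM n1 n2 K0 D0.
have b2 : K * D <= 5 / 3 * (2 / 10) := ler_pM Kpos Dpos K1 D1.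
have b3 : K * (1 / 5 - D) <= 5 / 3 * (28 / 625) := ler_pM Kpos d0 K1 d1.
have b4 : 0 <= K * (1 / 5 - D) := mulr_ge0 Kpos d0.
have b5 : K * (1 - p) <= 5 / 3 * (1 / 5) := ler_pM Kpos r0 K1 r5.
have b6 : 0 <= K * (1 - p) := mulr_ge0 Kpos r0.
have k1 : kl 1 (1 / 2 + K * D) <= 3 / 10 by apply: kl_num1; clear -b1; lra.
have k2 : kl (4 / 5) (1 / 2 + K * (D - 1 / 5)) <= 3 / 10.
  apply: (@le_trans _ _ (kl (4 / 5) (17 / 40))); last exact: kl_num2.
  apply: kl_between; [by clear; lra|by clear; lra|apply/orP; right].
  by apply/andP; split; clear -b3 b4; lra.
apply: (@le_trans _ _ (kl p (1 / 2 + K * (D - (1 - p))))).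
  apply: kl_between.
  - by clear -p0 p1; lra.
  - by apply/andP; split; clear -b1 b2 b5 b6; lra.
  - by rewrite lq qp orbT.
have t01 : 0 <= 5 * (1 - p) <= 1 by apply/andP; split; clear -r0 r5; lra.
have := @kl_convex R (5 * (1 - p)) (4 / 5) 1 (1 / 2 + K * (D - 1 / 5)) (1 / 2 + K * D) t01.
rewrite (_ : 5 * (1 - p) * (4 / 5) + (1 - 5 * (1 - p)) * 1 = p); last by field.
rewrite (_ : 5 * (1 - p) * (1 / 2 + K * (D - 1 / 5)) + _ = 1 / 2 + K * (D - (1 - p))); last by field.
move=> h; apply: (le_trans (h _ _ _ _)).
- by clear; lra.
- by clear; lra.
- by apply/andP; split; clear -b3 b4; lra.
- by apply/andP; split; clear -b1 b2; lra.
case/andP: t01 => t0 t1; have c2 : 0 <= 1 - 5 * (1 - p) by rewrite subr_ge0.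
have := ler_wpM2l c2 k1; have := ler_wpM2l t0 k2; clear.
by move: (kl _ _) (kl _ _) => u v; lra.
Qed.

End numeric.

(** * The maximal information of a message *)

Section information.
Context {R : realType}.
Implicit Types (A : set R) (x : R).
Local Notation gcdf := (@gcdf R).

Lemma tail_probE x j : tail_prob x j = gcdf (mean j - x).
Proof. exact: nP_tail. Qed.

Lemma info_fE : info_f R = kl (1 - gcdf 0) (1 - gcdf 1).
Proof.
by rewrite /info_f !tail_probE/= !subr0 -(gcdfN 1) -(gcdfN 0) oppr0.
Qed.

Lemma exp_half_bounds : 8 / 5 <= expR (1 / 2 : R) <= 5 / 3.
Proof.
have h0 : 0 <= 1 / 2 :> R by lra.
have [h1 h2] := expRN_bounds h0.
have e : expR (1 / 2) * expR (- (1 / 2)) = 1 :> R by rewrite expRxMexpNx_1.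
have g0 := expR_gt0 (1 / 2 : R).
move: (expR (1 / 2)) (expR (- (1 / 2))) h1 h2 e g0 => a b; clear => h1 h2 e g0.
have h3 : 29 / 48 <= b by lra.
have h4 : b <= 5 / 8 by lra.
by apply/andP; split; nra.
Qed.

Lemma expR1_ge2 : 2 <= expR 1 :> R.
Proof. by have := expR_ge1Dx (1 : R); lra. Qed.

Definition dprob (j : density) A : R := nP (mean j) A.

Lemma dprobE j A : measurable A -> (dprob j A)%:E = normal_prob (mean j) 1 A.
Proof. exact: nPE. Qed.

Lemma dprob_ge0 j A : 0 <= dprob j A.
Proof. exact: nP_ge0. Qed.

Lemma dprob_le1 j A : measurable A -> dprob j A <= 1.
Proof. exact: nP_le1. Qed.

Lemma dprob_setC j A : measurable A -> dprob j (~` A) = 1 - dprob j A.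
Proof. exact: nP_setC. Qed.

Lemma dprob_eq0 j j' A : measurable A -> dprob j' A = 0 -> dprob j A = 0.
Proof. exact: nP_eq0. Qed.

Lemma dprob_gt0 j j' A : measurable A -> 0 < dprob j' A -> 0 < dprob j A.
Proof. exact: nP_gt0. Qed.

Lemma dprob_product_ge A : measurable A -> 0 < dprob df A ->
  expR (- 1) * dprob df A ^+ 2 <= dprob dg1 A * dprob dg2 A.
Proof. exact: nP_product_ge. Qed.

Lemma neyman_pearson_fg1 x A : measurable A ->
  dprob df A - gcdf (- x) <= lr 0 (- 1) x * (dprob dg1 A - gcdf (- 1 - x)).
Proof.
have m1 : (-1 : R) <= 0 by rewrite oppr_le0 ler01.
move=> mA; have := neyman_pearson x mA m1.
by rewrite (nP_tail 0) (nP_tail (-1)) sub0r.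
Qed.

Lemma neyman_pearson_g2f x A : measurable A ->
  dprob dg2 A - gcdf (1 - x) <= lr 1 0 x * (dprob df A - gcdf (- x)).
Proof.
move=> mA; have := neyman_pearson x mA (ler01 : (0 : R) <= 1).
by rewrite (nP_tail 0) (nP_tail 1) sub0r.
Qed.

Opaque dprob.

Lemma scaled_diff_le (a b k c d : R) : 0 < k -> a - b <= k * (c - d) -> a = b -> d <= c.
Proof. by move=> k0 + ab; rewrite ab subrr pmulr_rge0// subr_ge0. Qed.

Lemma diff_le_scaled (a b k c d : R) : a - b <= k * (c - d) -> c = d -> a <= b.
Proof. by move=> + cd; rewrite cd subrr mulr0 subr_le0. Qed.

(** The tail of equal f-probability is extremal: Neyman-Pearson places the probabilities of [A]
    under both alternatives between [gcdf (-1 - x)] and [gcdf (1 - x)]. This and the next lemma give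
    one end for each alternative, and complements give the other ends. *)
Lemma dprob_g1_ge x A : measurable A -> dprob df A = gcdf (- x) -> gcdf (-1 - x) <= dprob dg1 A.
Proof. by move=> mA; exact: scaled_diff_le (lr_gt0 _ _ _) (neyman_pearson_fg1 x mA). Qed.

Lemma dprob_g2_le x A : measurable A -> dprob df A = gcdf (- x) -> dprob dg2 A <= gcdf (1 - x).
Proof. by move=> mA; exact: diff_le_scaled (neyman_pearson_g2f x mA). Qed.

Lemma dprob_f_le x A : measurable A -> dprob dg1 A = gcdf (-1 - x) -> dprob df A <= gcdf (- x).
Proof. by move=> mA; exact: diff_le_scaled (neyman_pearson_fg1 x mA). Qed.

Lemma dprob_f_ge x A : measurable A -> dprob dg2 A = gcdf (1 - x) -> gcdf (- x) <= dprob df A.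
Proof. by move=> mA; exact: scaled_diff_le (lr_gt0 _ _ _) (neyman_pearson_g2f x mA). Qed.

Lemma compl_tail x A : measurable A -> dprob df A = gcdf (- x) -> dprob df (~` A) = gcdf (- - x).
Proof. by move=> mA e; rewrite (dprob_setC df mA) e -gcdfN. Qed.

Lemma le_compl (a b c : R) : a <= 1 - b -> c = 1 - a -> b <= c.
Proof. by move=> h ->; move: h; lra. Qed.

Lemma ge_compl (a b c : R) : 1 - b <= a -> c = 1 - a -> c <= b.
Proof. by move=> h ->; move: h; lra. Qed.

Lemma dprob_g2_ge x A : measurable A -> dprob df A = gcdf (- x) -> gcdf (-1 - x) <= dprob dg2 A.
Proof.
move=> mA e; have h := dprob_g2_le (measurableC mA) (compl_tail mA e).
apply: (ge_compl (a := gcdf (1 - - x))); first by rewrite -(dprob_setC dg2 mA).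
by rewrite -gcdfN; congr gcdf; ring.
Qed.

Lemma dprob_g1_le x A : measurable A -> dprob df A = gcdf (- x) -> dprob dg1 A <= gcdf (1 - x).
Proof.
move=> mA e; have h := dprob_g1_ge (measurableC mA) (compl_tail mA e).
apply: (le_compl (a := gcdf (-1 - - x))); first by rewrite -(dprob_setC dg1 mA).
by rewrite -gcdfN; congr gcdf; ring.
Qed.

(* The two alternatives lie on opposite sides of 0, so a set that both make less
   likely than N(0,1) does carries little information. *)
Lemma kl_sum_bad A : measurable A -> 0 < dprob df A < 1 ->
  dprob dg1 A <= dprob df A -> dprob dg2 A <= dprob df A ->
  kl (dprob df A) (dprob dg1 A) + kl (dprob df A) (dprob dg2 A) <= 3 / 5.
Proof.
move=> mA /andP[p0 p1] q1p q2p.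
have q10 : 0 < dprob dg1 A by exact: dprob_gt0 p0.
have q20 : 0 < dprob dg2 A by exact: dprob_gt0 p0.
have pr := dprob_product_ge mA p0.
have kk : expR (1 / 2) * expR (- (1 / 2)) = 1 :> R by rewrite expRxMexpNx_1.
have kp : 0 < expR (1 / 2) :> R by exact: expR_gt0.
(* Neyman-Pearson at the threshold -1: its tail has probability [gcdf 1] under f and exactly 1/2
   under g_1. For g_2 the complement is compared with the tail from 1. *)
have b1 : 1 / 2 + expR (1 / 2) * ((1 - gcdf 1) - (1 - dprob df A)) <= dprob dg1 A.
  have := neyman_pearson_fg1 (-1) mA; rewrite subrr gcdf0 opprK.
  rewrite (_ : lr 0 (-1) (-1) = expR (- (1 / 2))); last by rewrite /lr; congr expR; field.
  rewrite -(ler_pM2l kp) mulrA kk mul1r.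
  move: (expR _) (gcdf 1) (dprob df A) (dprob dg1 A) => a b c d; clear => h; lra.
have b2 : 1 / 2 + expR (1 / 2) * ((1 - gcdf 1) - (1 - dprob df A)) <= dprob dg2 A.
  have := neyman_pearson_g2f 1 (measurableC mA).
  rewrite (dprob_setC df mA) (dprob_setC dg2 mA) subrr gcdfN gcdf0.
  rewrite (_ : lr 1 0 1 = expR (1 / 2)); last by rewrite /lr; congr expR; field.
  move: (expR _) (gcdf 1) (dprob df A) (dprob dg2 A) => a b c d; clear => h; lra.
have /andP[k1 k2] := exp_half_bounds; have /andP[g1 g2] := @gcdf1_bounds R.
have e2 := expR1_ge2.
move: (dprob df A) (dprob dg1 A) (dprob dg2 A) (gcdf 1) (expR (1 / 2)) p0 p1 q1p q2p
  q10 q20 pr b1 b2 k1 k2 g1 g2; clear - e2.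
move=> p q1 q2 F K p0 p1 q1p q2p q10 q20 pr b1 b2 k1 k2 g1 g2.
have [p45|p45] := leP p (4 / 5).
  apply: (@kl_bad_small R (expR (-1))).
  - by rewrite p0.
  - by rewrite expR_gt0 expRN div1r lef_pV2 ?posrE ?expR_gt0.
  - by rewrite expRK.
  - by rewrite q10.
  - by rewrite q20.
  - exact: pr.
have c1 : kl p q1 <= 3 / 10.
  by apply: (@kl_bad_large R K (1 - F)); [rewrite p1 ltW|rewrite k1|clear - g1 g2; apply/andP; split; lra|..].
have c2 : kl p q2 <= 3 / 10.
  by apply: (@kl_bad_large R K (1 - F)); [rewrite p1 ltW|rewrite k1|clear - g1 g2; apply/andP; split; lra|..].
by move: c1 c2; clear; lra.
Qed.

Lemma info_f_ge : 3 / 5 <= 2 * info_f R.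
Proof. by rewrite info_fE; exact: info_ge. Qed.

Lemma info_f_gt0 : 0 < info_f R.
Proof. have := info_f_ge; lra. Qed.

Lemma dprob_trivial j j' A : measurable A ->
  dprob j A = 0 \/ dprob j A = 1 -> dprob j' A = dprob j A.
Proof.
move=> mA [p|p]; first by rewrite p (dprob_eq0 j' mA p).
have mC := measurableC mA.
have c0 : dprob j (~` A) = 0 by rewrite (dprob_setC j mA) p subrr.
have := dprob_eq0 j' mC c0; rewrite (dprob_setC j' mA) => /eqP; rewrite subr_eq0 => /eqP <-.
by rewrite p.
Qed.

Lemma dprob_nontrivial j A : measurable A ->
  ~ (dprob j A = 0 \/ dprob j A = 1) -> 0 < dprob j A < 1.
Proof.
move=> mA /not_orP[/eqP h0 /eqP h1].
by rewrite lt0r h0 dprob_ge0 lt_neqAle h1 dprob_le1.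
Qed.

Lemma gtail01 x : 0 < 1 - gcdf x < 1.
Proof. by rewrite subr_gt0 gcdf_lt1 gtrBl gcdf_gt0. Qed.

Lemma kl_add_le (p q1 q2 l u : R) : 0 < p < 1 -> 0 < l < 1 -> 0 < u < 1 ->
  l <= q1 <= p -> p <= q2 <= u -> kl p q1 + kl p q2 <= kl p l + kl p u.
Proof.
move=> p01 l01 u01 h1 h2; apply: lerD; apply: kl_between => //; first by rewrite h1 orbT.
by rewrite h2.
Qed.

Lemma kl_sum_le_info_f A : measurable A ->
  kl (dprob df A) (dprob dg1 A) + kl (dprob df A) (dprob dg2 A) <= 2 * info_f R.
Proof.
move=> mA; have i0 := info_f_ge.
have [triv|/(dprob_nontrivial mA) p01] := pselect (dprob df A = 0 \/ dprob df A = 1).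
  by rewrite (dprob_trivial dg1 mA triv) (dprob_trivial dg2 mA triv) klxx addr0; lra.
have [y yE] := gcdf_surj p01.
have [x zx] : exists x, dprob df A = gcdf (- x) by exists (- y); rewrite opprK.
have xE : dprob df A = 1 - gcdf x by rewrite zx gcdfN.
have mC := measurableC mA.
have t1E : gcdf (-1 - x) = 1 - gcdf (x + 1) by rewrite -gcdfN; congr gcdf; ring.
have t2E : gcdf (1 - x) = 1 - gcdf (x - 1) by rewrite -gcdfN; congr gcdf; ring.
have a1 := dprob_g1_ge mA zx; have a2 := dprob_g2_le mA zx.
have a3 := dprob_g2_ge mA zx; have a4 := dprob_g1_le mA zx.
have t1 := gtail01 (x + 1); have t2 := gtail01 (x - 1).
have good : kl (dprob df A) (1 - gcdf (x + 1)) + kl (dprob df A) (1 - gcdf (x - 1)) <= 2 * info_f R.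
  by rewrite xE info_fE; exact: kl_shift_sum_le.
rewrite t1E in a1 a3; rewrite t2E in a2 a4.
have bad1 := kl_sum_bad mA p01; have bad2 := kl_sum_bad mC.
rewrite (dprob_setC df mA) (dprob_setC dg1 mA) (dprob_setC dg2 mA) !kl_compl in bad2.
move: i0 good bad1 bad2 a1 a2 a3 a4 t1 t2 p01; clear.
move: (gcdf _) (gcdf _) => l u; move: (dprob df A) (dprob dg1 A) (dprob dg2 A) => p q1 q2.
move: (info_f R) => I; move=> i0 good bad1 bad2 a1 a2 a3 a4 t1 t2 p01.
(* The bounds l and u hold for both alternatives, so either order around p leads to the same
   threshold cell. If both alternatives exceed p, the complement is in the small-information
   case. *)
have [h1|h1] := leP q1 p; have [h2|h2] := leP q2 p.
- by apply: le_trans i0; exact: bad1.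
- by apply: le_trans good; apply: kl_add_le; rewrite ?a1 ?h1 ?a2 ?(ltW h2).
- by rewrite addrC; apply: le_trans good; apply: kl_add_le; rewrite ?a3 ?h2 ?a4 ?(ltW h1).
- by apply: le_trans i0; apply: bad2; [case/andP: p01 => ? ?; lra|rewrite lerD2l lerN2 ltW..].
Qed.

Let G x := kl (tail_prob x dg2) (tail_prob x df).

Let GE' x : G x = kl (gcdf (1 - x)) (gcdf (- x)).
Proof. by rewrite /G !tail_probE sub0r. Qed.

Let GE x : G x = kl (1 - gcdf (x - 1)) (1 - gcdf x).
Proof.
rewrite GE' -!gcdfN; congr (kl (gcdf _) (gcdf _)); ring.
Qed.

(** A translation by 1 turns g_2 against f into f against g_1, which is one of the two nonnegative
    summands bounded by 2 I_f. *)
Let G_ub : has_ubound (range G).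
Proof.
exists (2 * info_f R) => _ [x _ <-].
have := kl_shift_sum_le (x - 1); rewrite -info_fE subrK -GE; apply: le_trans.
have /andP[/ltW t0 /ltW t1] := gtail01 (x - 1).
by rewrite lerDl kl_ge0 ?gtail01// t0.
Qed.

Let G_le x : G x <= info_g R.
Proof. by apply: sup_ubound; [exact: G_ub|exists x]. Qed.

Lemma info_g_gt0 : 0 < info_g R.
Proof.
apply: lt_le_trans (G_le 0); rewrite GE; apply: kl_gt0; [exact: gtail01..|].
by rewrite gt_eqF// ltrD2l ltrN2 gcdf_lt//; lra.
Qed.

Let kl_dprob_compl j A : measurable A ->
  kl (dprob j A) (dprob df A) = kl (dprob j (~` A)) (dprob df (~` A)).
Proof. by move=> mA; rewrite (dprob_setC j mA) (dprob_setC df mA) kl_compl. Qed.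

(** The tail with the g_2-probability of [A] has no larger f-probability, hence lies farther away,
    and its divergence is one of the values in the supremum. *)
Let kl_le_info_g2 A : measurable A -> 0 < dprob dg2 A < 1 -> dprob df A <= dprob dg2 A ->
  kl (dprob dg2 A) (dprob df A) <= info_g R.
Proof.
move=> mA p01 q; have [y yE] := gcdf_surj p01; have [x xE] : exists x, x = 1 - y by eexists.
have yx : dprob dg2 A = gcdf (1 - x) by rewrite xE subKr.
have := dprob_f_ge mA yx; move: p01 q; move: (dprob df A) => q; rewrite yx => p01 qp hq.
apply: le_trans (G_le x); rewrite GE'.
by apply: kl_between; [exact: p01|rewrite gcdf_gt0 gcdf_lt1|apply/orP; right; apply/andP].
Qed.

Let kl_le_info_g1 A : measurable A -> 0 < dprob dg1 A < 1 -> dprob dg1 A <= dprob df A ->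
  kl (dprob dg1 A) (dprob df A) <= info_g R.
Proof.
move=> mA p01 q; have [y yE] := gcdf_surj p01; have [x xE] : exists x, x = -1 - y by eexists.
have yx : dprob dg1 A = gcdf (-1 - x) by rewrite xE subKr.
have := dprob_f_le mA yx; move: p01 q; move: (dprob df A) => q; rewrite yx => p01 qp hq.
apply: le_trans (G_le (- x)); rewrite GE' !opprK -[leRHS]kl_compl -!gcdfN.
rewrite (_ : - (1 + x) = -1 - x); last by ring.
by apply: kl_between; [exact: p01|rewrite gcdf_gt0 gcdf_lt1|apply/orP; left; apply/andP].
Qed.

Lemma kl_le_info_g j A : measurable A -> j <> df ->
  kl (dprob j A) (dprob df A) <= info_g R.
Proof.
move=> mA jf.
have [triv|/(dprob_nontrivial mA) p01] := pselect (dprob j A = 0 \/ dprob j A = 1).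
  by rewrite (dprob_trivial df mA triv) klxx ltW// info_g_gt0.
have mC := measurableC mA.
have p01C : 0 < dprob j (~` A) < 1.
  by rewrite (dprob_setC j mA); case/andP: p01 => ? ?; rewrite subr_gt0 gtrBl; apply/andP.
case: j jf p01 p01C => [/(_ erefl) []|_|_] p01 p01C.
- have [h|h] := leP (dprob dg1 A) (dprob df A); first exact: kl_le_info_g1.
  rewrite (kl_dprob_compl dg1 mA); apply: (kl_le_info_g1 mC p01C).
  by rewrite (dprob_setC dg1 mA) (dprob_setC df mA) lerD2l lerN2 ltW.
- have [h|h] := leP (dprob df A) (dprob dg2 A); first exact: kl_le_info_g2.
  rewrite (kl_dprob_compl dg2 mA); apply: (kl_le_info_g2 mC p01C).
  by rewrite (dprob_setC dg2 mA) (dprob_setC df mA) lerD2l lerN2 ltW.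
Qed.

End information.

Opaque dprob.

(** * Message histories as a tree *)

Section tree.
Context {R : realType}.
Implicit Types (K : seq bool -> bool -> R) (leaf : nat -> seq bool -> option bool).

(** The conditional probability, given the history h, of reaching a leaf marked true. [K h b] is the
    probability that the next message is b, and [r] bounds the number of further messages. *)
Fixpoint tree_val K leaf r (h : seq bool) : R :=
  if leaf r h is Some a then a%:R else
  if r is r'.+1 then K h true * tree_val K leaf r' (rcons h true) +
                     K h false * tree_val K leaf r' (rcons h false)
  else 0.

End tree.

Section history_law.
Context {R : realType} {disp : measure_display} {Omega : measurableType disp}.
Variables (P : density -> probability Omega R) (X : nat -> Omega -> R).
Hypothesis iidX : iid_normal P X.
Variable s : sensor R.

Definition cell (h : seq bool) (b : bool) : set R :=
  [set x | quantize (size h) x (feed s h) = b].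

Definition kern (j : density) (h : seq bool) (b : bool) : R := dprob j (cell h b).

Lemma measurable_cell h b : measurable (cell h b).
Proof.
have := measurable_quantize (size h) (feed s h).
by move=> /(_ measurableT [set b] I); rewrite setTI.
Qed.

Lemma cellC h : cell h false = ~` cell h true.
Proof.
by apply/seteqP; split=> x; rewrite /cell /=; case: (quantize _ _ _) => // /(_ erefl).
Qed.

Lemma kern_ge0 j h b : 0 <= kern j h b.
Proof. exact: dprob_ge0. Qed.

Lemma kern_false j h : kern j h false = 1 - kern j h true.
Proof. by rewrite /kern cellC dprob_setC//; exact: measurable_cell. Qed.

Lemma kern_sum j h : kern j h true + kern j h false = 1.
Proof. by rewrite kern_false addrC subrK. Qed.

Definition hist_set n (h : seq bool) : set Omega := [set w | history X s n w = h].

Lemma hist_set_rcons n h b :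
  hist_set n.+1 (rcons h b) = hist_set n h `&` X n @^-1` cell h b.
Proof.
apply/seteqP; split=> w; rewrite /hist_set /cell /=.
  move=> /rcons_inj[e1 e2]; have sn : size h = n by rewrite -e1 size_history.
  by split=> //; rewrite sn -e1.
move=> [e1]; have -> : size h = n by rewrite -e1 size_history.
by rewrite e1 => ->.
Qed.

Lemma hist_set_split n h :
  hist_set n h = hist_set n.+1 (rcons h true) `|` hist_set n.+1 (rcons h false).
Proof.
by rewrite !hist_set_rcons -setIUr cellC -preimage_setU setUv preimage_setT setIT.
Qed.

Lemma hist_set_disj n h :
  hist_set n.+1 (rcons h true) `&` hist_set n.+1 (rcons h false) = set0.
Proof.
rewrite -subset0 => w [] /=; rewrite /hist_set /= => -> /rcons_inj[].
by [].
Qed.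

Lemma measurable_hist_set n h : measurable (hist_set n h).
Proof.
elim: n h => [|n IH] h.
  have [->|hn] := eqVneq h [::].
    by rewrite (_ : hist_set _ _ = setT)//; apply/seteqP; split.
  rewrite (_ : hist_set _ _ = set0)//; apply/seteqP; split=> // w /= e.
  by rewrite /hist_set /= -e eqxx in hn.
case/lastP: h => [|h b].
  rewrite (_ : hist_set _ _ = set0)//; apply/seteqP; split=> // w.
  by rewrite /hist_set /= => /(congr1 size); rewrite size_rcons.
rewrite hist_set_rcons; apply: measurableI => //.
have := iidX.1 n; move=> /(_ measurableT _ (measurable_cell h b)).
by rewrite setTI.
Qed.

Let cells (h : seq bool) (i : nat) : set R := cell (take i h) (nth false h i).

(** Along a fixed history the feedback is known, so each message constrains its own observation
    only. The event becomes a finite intersection to which independence applies, although the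
    quantizers depend on the past. *)
Let hist_set_cells h :
  hist_set (size h) h = \bigcap_(i in [set` iota 0 (size h)]) (X i @^-1` cells h i).
Proof.
elim/last_ind: h => [|h b IH].
  by rewrite /= set_nil bigcap_set0; apply/seteqP; split.
rewrite size_rcons hist_set_rcons IH -addn1 iotaD add0n /=.
apply/seteqP; split=> w /=.
  move=> [h1 h2] i /=; rewrite mem_cat => /orP[ih|].
    have := h1 i ih; rewrite /cells; move: ih; rewrite mem_iota /= add0n => ih.
    by rewrite -cats1 takel_cat ?(ltnW ih)// nth_cat ih.
  rewrite inE => /eqP ->; rewrite /cells -cats1 takel_cat// take_size.
  by rewrite nth_cat ltnn subnn.
move=> hh; split=> [i /= ih|].
  have := hh i; rewrite /= mem_cat ih => /(_ isT); rewrite /cells.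
  move: ih; rewrite mem_iota /= add0n => ih.
  by rewrite -cats1 takel_cat ?(ltnW ih)// nth_cat ih.
have := hh (size h); rewrite /= mem_cat inE eqxx orbT => /(_ isT).
by rewrite /cells -cats1 takel_cat// take_size nth_cat ltnn subnn.
Qed.

Definition hprob (j : density) (h : seq bool) : R := fine (P j (hist_set (size h) h)).

Lemma hprobE j h : P j (hist_set (size h) h) = (hprob j h)%:E.
Proof. by rewrite /hprob fineK// fin_num_measure//; exact: measurable_hist_set. Qed.

Let hprob_prod j h :
  hprob j h = \prod_(i <- iota 0 (size h)) dprob j (cells h i).
Proof.
apply: EFin_inj; rewrite -hprobE hist_set_cells (iidX.2 j).1 ?iota_uniq//.
  rewrite -prodEFin; apply: eq_bigr => i _.
  rewrite (iidX.2 j).2 ?dprobE//; exact: measurable_cell.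
by move=> i; exact: measurable_cell.
Qed.

Lemma hprob_nil j : hprob j [::] = 1.
Proof. by rewrite hprob_prod big_nil. Qed.

Lemma hprob_rcons j h b : hprob j (rcons h b) = hprob j h * kern j h b.
Proof.
rewrite !hprob_prod size_rcons -addn1 iotaD big_cat /= big_seq1 add0n; congr (_ * _).
  rewrite !big_seq; apply: eq_bigr => i; rewrite mem_iota /= add0n => ih.
  by rewrite /cells -cats1 takel_cat ?(ltnW ih)// nth_cat ih.
by rewrite /cells -cats1 takel_cat// take_size nth_cat ltnn subnn.
Qed.

(* [E r n] is an event to be decided by the messages n+1, ..., n+r. *)
Lemma tree_prob (E : nat -> nat -> set Omega) leaf j :
  (forall r n, measurable (E r n)) ->
  (forall h, leaf 0%N h <> None) ->
  (forall r h a, leaf r h = Some a ->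
    hist_set (size h) h `&` E r (size h) = if a then hist_set (size h) h else set0) ->
  (forall r h, leaf r.+1 h = None ->
    hist_set (size h) h `&` E r.+1 (size h) = hist_set (size h) h `&` E r (size h).+1) ->
  forall r h, P j (hist_set (size h) h `&` E r (size h)) =
    (hprob j h * tree_val (kern j) leaf r h)%:E.
Proof.
move=> mE l0 lS lN r; elim: r => [|r IH] h /=.
  case e: (leaf 0%N h) => [a|]; last by have := l0 h.
  rewrite (lS _ _ _ e); case: a {e}; first by rewrite mulr1 hprobE.
  by rewrite measure0 mulr0.
case e: (leaf r.+1 h) => [a|].
  rewrite (lS _ _ _ e); case: a {e}; first by rewrite mulr1 hprobE.
  by rewrite measure0 mulr0.
rewrite (lN _ _ e) hist_set_split setIUl measureU; last 3 first.
- by apply: measurableI => //; exact: measurable_hist_set.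
- by apply: measurableI => //; exact: measurable_hist_set.
- by rewrite setIACA hist_set_disj set0I.
have I1 b : P j (hist_set (size h).+1 (rcons h b) `&` E r (size h).+1) =
    (hprob j (rcons h b) * tree_val (kern j) leaf r (rcons h b))%:E.
  by rewrite -IH size_rcons.
transitivity ((hprob j (rcons h true) * tree_val (kern j) leaf r (rcons h true))%:E +
  (hprob j (rcons h false) * tree_val (kern j) leaf r (rcons h false))%:E)%E.
  by congr (_ + _)%E; exact: I1.
by rewrite !hprob_rcons -EFinD; congr EFin; ring.
Qed.

Lemma tree_prob0 (E : nat -> nat -> set Omega) leaf j :
  (forall r n, measurable (E r n)) ->
  (forall h, leaf 0%N h <> None) ->
  (forall r h a, leaf r h = Some a ->
    hist_set (size h) h `&` E r (size h) = if a then hist_set (size h) h else set0) ->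
  (forall r h, leaf r.+1 h = None ->
    hist_set (size h) h `&` E r.+1 (size h) = hist_set (size h) h `&` E r (size h).+1) ->
  forall r, P j (E r 0%N) = (tree_val (kern j) leaf r [::])%:E.
Proof.
move=> mE l0 lS lN r; have := tree_prob j mE l0 lS lN r [::].
rewrite hprob_nil mul1r /= => <-; congr (P j _).
by rewrite (_ : hist_set 0 [::] = setT) ?setTI//; apply/seteqP; split.
Qed.

(** There are countably many histories, so every predicate on them is a countable union of
    measurable events. *)
Lemma measurable_hist_pred n (B : set (seq bool)) :
  measurable [set w | B (history X s n w)].
Proof.
pose F k := if unpickle k is Some h then
  (if `[< B h >] then hist_set n h else set0) else set0.
rewrite (_ : mkset _ = \bigcup_k F k).
  apply: bigcupT_measurable => k; rewrite /F; case: unpickle => // h.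
  by case: ifP => // _; exact: measurable_hist_set.
apply/seteqP; split=> w /= => [Bw|[k _]].
  by exists (pickle (history X s n w)) => //; rewrite /F pickleK asboolT.
rewrite /F; case: unpickle => // h; case: ifP => // /asboolP Bh.
by rewrite /hist_set /= => ->.
Qed.

(* The history determines every message, so a message event is a history event. *)
Lemma message_sigma_inv n A w w' : message_sigma X s n A ->
  history X s n w = history X s n w' -> A w -> A w'.
Proof.
move=> hA e.
suff : message_sigma X s n `<=` [set B | B w <-> B w'] by move=> /(_ _ hA)[].
apply: smallest_sub.
  split=> [|B|F hF] /=.
  - by split.
  - by move=> BB; split=> -[_ nB]; split=> //; rewrite ?BB // -?BB.
  - by split=> -[k _ Fk]; exists k => //; apply/hF.
rewrite -bigcup_seq => B [i _] [Y _ <-]; rewrite setTI /=.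
have : nth false (history X s n w) i = nth false (history X s n w') i by rewrite e.
have m u : nth false (history X s n u) i = message X s i u.
  by rewrite -(@nth_take i.+1)// take_history// /= nth_rcons size_history ltnn eqxx.
by rewrite !m /preimage /= => ->.
Qed.

End history_law.

(** * Stopping and deciding as properties of the history *)

Section stopped_tree.
Context {R : realType} {disp : measure_display} {Omega : measurableType disp}.
Variables (P : density -> probability Omega R) (X : nat -> Omega -> R).
Hypothesis iidX : iid_normal P X.
Variable delta : seq_test X.

Local Notation s := (test_sensor delta).
Local Notation kern := (kern s).

(** Adaptedness makes stopping at time n a function of the first n messages; the existential reads
    that function off, with value false on histories that no outcome produces. *)
Definition stops (h : seq bool) : bool :=
  `[< exists w, history X s (size h) w = h /\ stop delta w = Some (size h) >].

Definition decides (b : bool) (h : seq bool) : bool :=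
  `[< exists w, [/\ history X s (size h) w = h, stop delta w = Some (size h)
                  & decision delta w = b] >].

Lemma stopsP n w : reflect (stop delta w = Some n) (stops (history X s n w)).
Proof.
apply: (iffP (asboolP _)); rewrite size_history; last by exists w.
move=> [u [e su]].
by have /(_ su) := message_sigma_inv (@stop_adapted _ _ _ delta n) e.
Qed.

Lemma decidesP b n w : reflect (stop delta w = Some n /\ decision delta w = b)
  (decides b (history X s n w)).
Proof.
apply: (iffP (asboolP _)); rewrite size_history; last by move=> [*]; exists w.
move=> [u [e su du]].
by have /(_ (conj su du)) := message_sigma_inv (@decision_adapted _ _ _ delta n b) e.
Qed.

(* The test stops at one of the times n, ..., n + r, resp. at none of them. *)
Definition accepted_in (b : bool) r n : set Omega :=
  [set w | exists2 i, (i <= r)%N & stop delta w = Some (n + i)%N /\ decision delta w = b].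

Definition running_in r n : set Omega :=
  [set w | forall i, (i <= r)%N -> stop delta w <> Some (n + i)%N].

Lemma measurable_accepted_in b r n : measurable (accepted_in b r n).
Proof.
rewrite (_ : accepted_in b r n =
  \bigcup_(i in `I_r.+1) [set w | decides b (history X s (n + i) w)]).
  by apply: bigcup_measurable => i _; exact: (measurable_hist_pred iidX s (n + i) (decides b)).
apply/seteqP; split=> w.
  by move=> [i ir h]; exists i => //=; apply/decidesP.
by move=> [i ir /= /decidesP h]; exists i.
Qed.

Lemma measurable_running_in r n : measurable (running_in r n).
Proof.
rewrite (_ : running_in r n =
  \bigcap_(i in `I_r.+1) [set w | ~ stops (history X s (n + i) w)]).
  apply: bigcap_measurable => [|i _]; first by exists 0%N.
  exact: (measurable_hist_pred iidX s (n + i) (fun h => ~ stops h)).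
apply/seteqP; split=> w.
  by move=> h i ir /= /stopsP; exact: h.
by move=> h i ir e; apply: (h i ir); apply/stopsP.
Qed.

Definition acc_leaf b r h : option bool :=
  if stops h then Some (decides b h) else if r is 0%N then Some false else None.

Definition run_leaf r h : option bool :=
  if stops h then Some false else if r is 0%N then Some true else None.

Definition acc j b r h : R := tree_val (kern j) (acc_leaf b) r h.
Definition run j r h : R := tree_val (kern j) run_leaf r h.

Let hist_stops h w : hist_set X s (size h) h w -> stops h -> stop delta w = Some (size h).
Proof. by rewrite /hist_set /= => e; rewrite -{1}e => /stopsP. Qed.

Let hist_nstops h w : hist_set X s (size h) h w -> stops h = false -> stop delta w <> Some (size h).
Proof. by rewrite /hist_set /= => e; rewrite -{1}e => /negbT/stopsP. Qed.

Lemma prob_accepted j b r : P j (accepted_in b r 0%N) = (acc j b r [::])%:E.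
Proof.
apply: (tree_prob0 iidX (E := accepted_in b) (leaf := acc_leaf b)) => //.
- exact: measurable_accepted_in.
- by move=> h; rewrite /acc_leaf; case: ifP.
- move=> {}r h a; rewrite /acc_leaf; case: ifPn => [st [<-]|nst].
    case: ifPn => dh; apply/seteqP; split=> w //=.
    - by move=> [].
    - move=> hw; split=> //; exists 0%N => //; rewrite addn0.
      by move: dh; rewrite -{1}hw => /decidesP.
    - move=> [hw [i _ [si di]]]; have := hist_stops hw st; rewrite si => -[].
      move=> /eqP; rewrite -[X in _ == X]addn0 eqn_add2l => /eqP i0.
      move: dh; rewrite -{1}hw => /decidesP; apply; rewrite si i0 addn0 di.
      by split.
  case: r => // -[<-]; apply/seteqP; split=> w //= [hw [i]].
  rewrite leqn0 => /eqP ->; rewrite addn0 => -[+ _].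
  exact: (hist_nstops hw (negbTE nst)).
- move=> {}r h; rewrite /acc_leaf; case: ifPn => // nst _.
  apply/seteqP; split=> w [hw] [i ir [si di]]; split=> //.
    case: i ir si => [_|i ir].
      by rewrite addn0 => /(hist_nstops hw (negbTE nst)).
    by rewrite -addSnnS => si; exists i.
  by exists i.+1 => //; rewrite -addSnnS.
Qed.

Lemma prob_running j r : P j (running_in r 0%N) = (run j r [::])%:E.
Proof.
apply: (tree_prob0 iidX (E := running_in) (leaf := run_leaf)) => //.
- exact: measurable_running_in.
- by move=> h; rewrite /run_leaf; case: ifP.
- move=> {}r h a; rewrite /run_leaf; case: ifPn => [st [<-]|nst].
    apply/seteqP; split=> w //= [hw] /(_ 0%N (leq0n _)).
    by rewrite addn0 => /(_ (hist_stops hw st)).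
  case: r => // -[<-]; apply/seteqP; split=> w //=; first by move=> [].
  move=> hw; split=> // i; rewrite leqn0 => /eqP ->; rewrite addn0.
  exact: (hist_nstops hw (negbTE nst)).
- move=> {}r h; rewrite /run_leaf; case: ifPn => // nst _.
  apply/seteqP; split=> w [hw] hh; split=> // i ir.
    by rewrite addSnnS; exact: hh.
  case: i ir => [_|i ir]; first by rewrite addn0; exact: (hist_nstops hw (negbTE nst)).
  by rewrite -addSnnS; exact: hh.
Qed.

Lemma run_ge0 j r : 0 <= run j r [::].
Proof. by rewrite -lee_fin -prob_running measure_ge0. Qed.

Lemma acc_ge0 j b r h : 0 <= acc j b r h.
Proof.
rewrite /acc; elim: r h => [|r IH] h /=; first by case: acc_leaf.
by case: acc_leaf => [a|] //; rewrite addr_ge0// mulr_ge0// kern_ge0.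
Qed.

Lemma acc_run_total j r :
  acc j true r [::] + acc j false r [::] + run j r [::] = 1.
Proof.
apply: EFin_inj; rewrite !EFinD -!prob_accepted -prob_running.
rewrite -measureU; [|exact: measurable_accepted_in..|]; last first.
  by rewrite -subset0 => w [[i _ [_ e]] [k _ [_]]]; rewrite e.
rewrite -measureU; [|by apply: measurableU; exact: measurable_accepted_in
  |exact: measurable_running_in|]; last first.
  by rewrite -subset0 => w [[]] [i ir [si _]] /(_ i ir).
have e : accepted_in true r 0 `|` accepted_in false r 0 `|` running_in r 0 = setT; last first.
  by rewrite e; exact: probability_setT.
apply/seteqP; split=> // w _ /=.
have [h|h] := pselect (exists2 i, (i <= r)%N & stop delta w = Some (0 + i)%N); last first.
  by right => i ir si; apply: h; exists i.
case: h => i ir si; left; case e: (decision delta w); [left|right]; exists i => //.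
Qed.

Lemma acc_le_incorrect j r : acc j (if j is df then true else false) r [::] <=
  fine (P j (incorrect delta j)).
Proof.
have mI : measurable (incorrect delta j).
  rewrite (_ : incorrect delta j =
     \bigcup_r accepted_in (if j is df then true else false) r 0%N).
    by apply: bigcupT_measurable => k; exact: measurable_accepted_in.
  apply/seteqP; split=> w /=.
    by case e: (stop delta w) => [n|] [] // _ dw; exists n => //; exists n.
  by move=> [k _ [i _ [si di]]]; rewrite /incorrect /= si di.
rewrite -lee_fin fineK ?fin_num_measure// -prob_accepted le_measure ?inE//.
  exact: measurable_accepted_in.
by move=> w [i _ [si di]]; rewrite /incorrect /= si di.
Qed.

Lemma incorrect_le j (c : R) :
  (forall r, acc j (if j is df then true else false) r [::] <= c) ->
  (P j (incorrect delta j) <= c%:E)%E.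
Proof.
move=> hc; set b := if j is df then true else false in hc.
have e : incorrect delta j = \bigcup_r accepted_in b r 0%N.
  apply/seteqP; split=> w /=.
    by case e: (stop delta w) => [n|] [] // _ dw; exists n => //; exists n.
  by move=> [k _ [i _ [si di]]]; rewrite /incorrect /= si di.
have nd : nondecreasing_seq (fun r => accepted_in b r 0%N).
  move=> m n mn; apply/subsetPset => w /= [i im h]; exists i => //.
  exact: leq_trans im mn.
have mU : measurable (\bigcup_r accepted_in b r 0%N).
  by apply: bigcupT_measurable => k; exact: measurable_accepted_in.
have cv := nondecreasing_cvg_mu (mu := P j) (fun k => measurable_accepted_in b k 0%N) mU nd.
rewrite e -(cvg_lim _ cv)//; apply: lime_le; first by apply/cvg_ex; eexists; exact: cv.
by apply: nearW => k /=; rewrite prob_accepted lee_fin.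
Qed.

Lemma time_series (w : Omega) : time_ereal (stop delta w) =
  (\sum_(n <oo) (\1_(running_in n 0%N) w : R)%:E)%E.
Proof.
have nn n : (0 <= (\1_(running_in n 0%N) w : R)%:E)%E by rewrite lee_fin.
case e: (stop delta w) => [k|] /=.
  have i1 n : (n < k)%N -> \1_(running_in n 0%N) w = 1 :> R.
    move=> nk; rewrite indicE mem_set//= => i ni; rewrite e => -[ki].
    by move: ni; rewrite leqNgt add0n in ki *; rewrite -ki nk.
  have i0 n : (k <= n)%N -> \1_(running_in n 0%N) w = 0 :> R.
    move=> nk; rewrite indicE memNset//= => /(_ k nk); rewrite add0n; exact.
  rewrite (nneseries_split 0%N k)// add0n [X in (_ + X)%E]eseries0 ?adde0; last first.
    by move=> n kn _; rewrite i0.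
  rewrite (eq_big_nat _ _ (F2 := fun=> (1 : R)%:E)); last by move=> n /andP[_ nk]; rewrite i1.
  by rewrite sumEFin big_const_nat subn0 iter_addr_0.
have i1 n : \1_(running_in n 0%N) w = 1 :> R.
  by rewrite indicE mem_set//= => i ni; rewrite e.
apply/esym/eqyP => A A0.
apply: (@le_trans _ _ (\sum_(0 <= n < (Num.trunc A).+1) (\1_(running_in n 0%N) w : R)%:E)%E).
  under eq_bigr do rewrite i1.
  rewrite sumEFin big_const_nat subn0 iter_addr_0 lee_fin.
  exact/ltW/Num.Theory.truncnS_gt.
exact: nneseries_lim_ge.
Qed.

Lemma expected_timeE j :
  expected_time (P j) delta = (\sum_(n <oo) (run j n [::])%:E)%E.
Proof.
rewrite /expected_time; under eq_integral do rewrite time_series.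
rewrite integral_nneseries//; last first.
  move=> n; apply/measurable_EFinP; apply: measurable_indic.
  exact: measurable_running_in.
apply: eq_eseriesr => n _; rewrite integral_indic ?setIT; [exact: prob_running|by []|exact: measurable_running_in].
Qed.

(** At the empty history, the expectation of min(N, r), as the sum of the probabilities of N > n
    over n < r. *)
Definition mean_run j r h : R := \sum_(n < r) run j n h.

Lemma mean_run_le_expected j r :
  ((mean_run j r [::])%:E <= expected_time (P j) delta)%E.
Proof.
rewrite expected_timeE /mean_run -sumEFin -(big_mkord xpredT (fun n => (run j n [::])%:E)).
by apply: nneseries_lim_ge => n _ _; rewrite lee_fin run_ge0.
Qed.

Lemma expected_le j (c : R) : (forall r, mean_run j r [::] <= c) ->
  (expected_time (P j) delta <= c%:E)%E.
Proof.
move=> h; rewrite expected_timeE; apply: lime_le.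
  by apply: is_cvg_nneseries => n _ _; rewrite lee_fin run_ge0.
by apply: nearW => n; rewrite big_mkord sumEFin lee_fin h.
Qed.

Lemma run_S j r h : run j r.+1 h = if stops h then 0 else
  kern j h true * run j r (rcons h true) + kern j h false * run j r (rcons h false).
Proof. by rewrite /run /= /run_leaf; case: ifP. Qed.

Lemma mean_run_S j r h : mean_run j r.+1 h = if stops h then 0 else
  1 + (kern j h true * mean_run j r (rcons h true) +
       kern j h false * mean_run j r (rcons h false)).
Proof.
rewrite /mean_run big_ord_recl /=; under eq_bigr do rewrite run_S.
rewrite {1}/run /= /run_leaf; case: ifP => _; first by rewrite big1// addr0.
by rewrite big_split /= -!mulr_sumr.
Qed.

Lemma run_anti j m n : (m <= n)%N -> run j n [::] <= run j m [::].
Proof.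
move=> mn; rewrite -lee_fin -!prob_running le_measure ?inE; [|exact: measurable_running_in..|].
  by [].
by move=> w h i im; apply: h; exact: leq_trans im mn.
Qed.

(** Markov's inequality; it makes the probability of running past the horizon vanish when the
    expectation is finite. *)
Lemma run_le_mean_run j r : r%:R * run j r [::] <= mean_run j r [::].
Proof.
rewrite /mean_run mulr_natl -[X in _ *+ X]card_ord -sumr_const.
by apply: ler_sum => i _; apply: run_anti; exact: ltnW.
Qed.

End stopped_tree.

(** * Lower bounds *)

Section change_of_measure.
Context {R : realType}.
Implicit Types p q y z t : R.

(* Donsker-Varadhan for a binary message. *)
Lemma kl_ge_ln p q y z : 0 <= p <= 1 -> 0 < q < 1 -> 0 < y -> 0 < z ->
  p * ln y + (1 - p) * ln z <= kl p q + ln (q * y + (1 - q) * z).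
Proof.
move=> /andP[p0 p1] /andP[q0 q1] y0 z0.
have s0 : 0 < q * y + (1 - q) * z by rewrite addr_gt0// mulr_gt0// subr_gt0.
have h1 := mul_ln_div_ge p0 q0 (divr_gt0 y0 s0).
have p1' : 0 <= 1 - p by rewrite subr_ge0.
have q1' : 0 < 1 - q by rewrite subr_gt0.
have h2 := mul_ln_div_ge p1' q1' (divr_gt0 z0 s0).
have e : q * (y / (q * y + (1 - q) * z)) + (1 - q) * (z / (q * y + (1 - q) * z)) = 1.
  by field; rewrite gt_eqF.
have ly : ln (y / (q * y + (1 - q) * z)) = ln y - ln (q * y + (1 - q) * z).
  by rewrite ln_div ?posrE.
have lz : ln (z / (q * y + (1 - q) * z)) = ln z - ln (q * y + (1 - q) * z).
  by rewrite ln_div ?posrE.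
move: h1 h2 e; rewrite ly lz /kl.
move: (q * (y / _)) (_ * (z / _)) => A B; move: (ln (_ + _)) (ln y) (ln z) => S Y Z.
move: (p * ln (p / q)) (_ * ln (_ / (1 - q))) => U V.
lra.
Qed.

End change_of_measure.

Section lower_bound.
Context {R : realType} {disp : measure_display} {Omega : measurableType disp}.
Variables (P : density -> probability Omega R) (X : nat -> Omega -> R).
Hypothesis iidX : iid_normal P X.
Variable delta : seq_test X.

Local Notation s := (test_sensor delta).
Local Notation kern := (kern s).
Local Notation stops := (stops delta).
Local Notation acc := (acc delta).
Local Notation run := (run delta).
Local Notation mean_run := (mean_run delta).

(** By the chain rule, the divergence between the laws under [j] and [i] of the further messages up
    to stopping or the horizon. *)
Fixpoint info (j i : density) r (h : seq bool) : R :=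
  if stops h then 0 else
  if r is r'.+1 then kl (kern j h true) (kern i h true) +
    (kern j h true * info j i r' (rcons h true) + kern j h false * info j i r' (rcons h false))
  else 0.

Lemma acc_S j b r h : acc j b r.+1 h = if stops h then (decides delta b h)%:R else
  kern j h true * acc j b r (rcons h true) + kern j h false * acc j b r (rcons h false).
Proof. by rewrite /acc /= /acc_leaf; case: ifP. Qed.

(** A message that is certain under one density is certain under all of them and carries no
    information; otherwise [kl_ge_ln] applies. *)
Lemma kern_dichotomy j i h :
  0 <= kern j h true <= 1 /\ (0 < kern i h true < 1 \/ kern j h true = kern i h true).
Proof.
have mA := measurable_cell s h true; split.
  by rewrite kern_ge0 dprob_le1.
have [t|/(dprob_nontrivial mA) nt] := pselect (kern i h true = 0 \/ kern i h true = 1).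
  by right; apply: dprob_trivial.
by left.
Qed.

(** The left side is the Donsker-Varadhan functional of t times the indicator of deciding b. Its
    exponential moment under [i] is affine in [acc], so it averages exactly over the two
    branches. *)
Lemma acc_le_info j i b r h t : 0 <= t ->
  t * acc j b r h - ln (1 + acc i b r h * (expR t - 1)) <= info j i r h.
Proof.
move=> t0; have et : 0 <= expR t - 1 by rewrite subr_ge0 -expR0 ler_expR.
have leafP (x : bool) : t * x%:R - ln (1 + x%:R * (expR t - 1)) <= 0.
  case: x; rewrite ?(mulr0, mul0r, mulr1, mul1r, addr0, ln1, subr0)//.
  have -> : 1 + (expR t - 1) = expR t by ring.
  by rewrite expRK subrr.
elim: r h => [|r IH] h.
  rewrite /acc /= /acc_leaf; case: ifP => _; last exact: (leafP false).
  exact: leafP.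
rewrite 2!(acc_S _ _ _ h) [info _ _ _ _]/=; case: ifP => _; first exact: leafP.
have pos b' : 0 < 1 + acc i b r (rcons h b') * (expR t - 1).
  by rewrite ltr_pwDl// mulr_ge0// acc_ge0.
have [p01 q01] := kern_dichotomy j i h.
rewrite !kern_false; have := IH (rcons h true); have := IH (rcons h false).
have := pos true; have := pos false; have /andP[p0 p1] := p01.
move: p01 p0 p1 q01; move: (kern j h true) (kern i h true) => p q p01 p0 p1 q01.
move: (acc i b r (rcons h true)) (acc i b r (rcons h false)) => Y Z.
move: (acc j b r (rcons h true)) (acc j b r (rcons h false)) => A B.
move: (info j i r (rcons h true)) (info j i r (rcons h false)) => U V.
rewrite (_ : 1 + (_ + _) * (expR t - 1) =
  q * (1 + Y * (expR t - 1)) + (1 - q) * (1 + Z * (expR t - 1))); last by ring.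
move: (1 + Y * _) (1 + Z * _) => y z z0 y0 hB hA.
have : p * ln y + (1 - p) * ln z <= kl p q + ln (q * y + (1 - q) * z).
  case: q01 => [q01|pq]; first exact: kl_ge_ln.
  rewrite -pq klxx add0r; move: p01 => /andP[]; rewrite le_eqVlt => /predU1P[<- _|p0' ].
    by rewrite !mul0r subr0 !mul1r !add0r.
  rewrite le_eqVlt => /predU1P[->|p1'].
    by rewrite subrr !mul0r !mul1r !addr0.
  have pp : 0 < p < 1 by rewrite p0' p1'.
  have := @kl_ge_ln R p p y z; rewrite klxx add0r p0 p1 pp; exact.
move=> H.
have hA' : p * (t * A - ln y) <= p * U by rewrite ler_wpM2l.
have hB' : (1 - p) * (t * B - ln z) <= (1 - p) * V by rewrite ler_wpM2l// subr_ge0.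
move: H hA' hB'; move: (ln (_ + _)) (ln y) (ln z) (kl p q) => ? ? ? ?; lra.
Qed.

Lemma info_f_sum_le r h : info df dg1 r h + info df dg2 r h <= 2 * info_f R * mean_run df r h.
Proof.
elim: r h => [|r IH] h.
  by rewrite /mean_run big_ord0 mulr0 /=; case: ifP; rewrite addr0.
rewrite mean_run_S [info df dg1 _ _]/= [info df dg2 _ _]/=.
case: ifP => _; first by rewrite addr0 mulr0.
have := kl_sum_le_info_f (measurable_cell s h true); rewrite -!/(kern _ _ _).
have := ler_wpM2l (kern_ge0 s df h true) (IH (rcons h true)).
have := ler_wpM2l (kern_ge0 s df h false) (IH (rcons h false)).
move: (kl _ _); move: (kl _ _) => b a.
move: (kern df h true) (kern df h false) (info_f R) => p q I.
move: (info _ _ _ _) (info _ _ _ _) (info _ _ _ _) (info _ _ _ _) => x1 x2 x3 x4.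
by move: (mean_run _ _ _) (mean_run _ _ _) => m1 m2; lra.
Qed.

Lemma info_g_le j r h : j <> df -> info j df r h <= info_g R * mean_run j r h.
Proof.
move=> jf; elim: r h => [|r IH] h.
  by rewrite /mean_run big_ord0 mulr0 /=; case: ifP.
rewrite mean_run_S [info _ _ _ _]/=.
case: ifP => _; first by rewrite mulr0.
have := kl_le_info_g (measurable_cell s h true) jf; rewrite -!/(kern _ _ _).
have := ler_wpM2l (kern_ge0 s j h true) (IH (rcons h true)).
have := ler_wpM2l (kern_ge0 s j h false) (IH (rcons h false)).
move: (kl _ _) => a; move: (kern j h true) (kern j h false) (info_g R) => p q I.
move: (info _ _ _ _) (info _ _ _ _) => x1 x2.
by move: (mean_run _ _ _) (mean_run _ _ _) => m1 m2; lra.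
Qed.

Let err (j : density) := fine (P j (incorrect delta j)).

(* [t = ln (1 / b)] makes the Donsker-Varadhan remainder at most [ln 2]. *)
Let acc_ln_le j i a b r : err j <= a -> err i <= b -> 0 < b <= 1 ->
  (j = df <-> i <> df) ->
  - ln b * (1 - a - run j r [::]) - ln 2 <= info j i r [::].
Proof.
move=> ja ib /andP[b0 b1] ji; set c := ~~ (if j is df then true else false).
have tb : 0 <= - ln b by rewrite oppr_ge0 ln_le0.
apply: le_trans (acc_le_info j i c r [::] tb).
have aj : acc j (~~ c) r [::] <= a.
  by apply: le_trans ja; rewrite negbK; exact: acc_le_incorrect.
have ai : acc i c r [::] <= b.
  apply: le_trans ib; suff -> : c = if i is df then true else false.
    exact: acc_le_incorrect.
  by rewrite /c; case: (j) (i) ji => -[] [] // h1 h2; exfalso;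
    try (by have := h1 erefl); try (by have : dg1 <> df by []; move/h2); by have := h2 (fun e => ltac:(discriminate e)).
have tot := acc_run_total iidX delta j r.
have l2 : ln (1 + acc i c r [::] * (expR (- ln b) - 1)) <= ln 2.
  rewrite expRN lnK ?posrE//; have bi : 1 <= b^-1 by rewrite invf_ge1.
  rewrite ler_ln ?posrE; [|by rewrite ltr_pwDl// mulr_ge0 ?acc_ge0// subr_ge0|by []].
  have : acc i c r [::] * (b^-1 - 1) <= b * (b^-1 - 1) by rewrite ler_wpM2r// subr_ge0.
  by rewrite [X in _ <= X]mulrBr mulfV ?gt_eqF// mulr1; lra.
have : - ln b * (1 - a - run j r [::]) <= - ln b * acc j c r [::].
  by rewrite ler_wpM2l//; move: tot aj; rewrite /c; case: (j) => /=; lra.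
by move: l2; move: (ln (1 + _)) => l ?; lra.
Qed.

(** Removes the horizon: for r at least t e / x, Markov's inequality bounds the term [t * f r] by
    the tolerance x. *)
Let limit_bound (I t a e : R) (m : nat -> R) (f : nat -> R) : 0 < I -> 0 <= t ->
  (forall r, m r <= e) -> (forall r, r%:R * f r <= m r) -> (forall r, 0 <= f r) ->
  (forall r, t * (1 - a - f r) - ln 2 <= I * m r) ->
  (t * (1 - a) - ln 2) / I <= e.
Proof.
move=> I0 t0 me fm f0 h; rewrite ler_pdivrMr// mulrC.
apply/ler_addgt0Pr => x x0.
have e0 : 0 <= e by apply: le_trans (me 0%N); apply: le_trans (fm 0%N); rewrite mul0r.
pose r := (Num.trunc (t * e / x)).+1.
have r0 : 0 < r%:R :> R by rewrite ltr0n.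
have rx : t * e / x <= r%:R by exact/ltW/Num.Theory.truncnS_gt.
have fr : t * f r <= x.
  have h1 : t * (r%:R * f r) <= t * e by rewrite ler_wpM2l// (le_trans (fm r)).
  have h2 : t * e <= r%:R * x by rewrite -ler_pdivrMr.
  by rewrite -(ler_pM2l r0); apply: le_trans h2; rewrite mulrCA.
have : I * m r <= I * e by rewrite ler_pM2l.
rewrite ![_ * t]mulrC [e * I]mulrC; have := h r; rewrite mulrBr; move: fr.
move: (I * e) (I * m r) (t * f r) (t * (1 - a)) (ln 2) => A B F T l; lra.
Qed.

Lemma expected_f_ge a b : err df <= a -> err dg1 <= b -> err dg2 <= b -> 0 < b <= 1 ->
  (((- ln b * (1 - a) - ln 2) / info_f R)%:E <= expected_time (P df) delta)%E.
Proof.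
move=> fa g1b g2b b01; case E: (expected_time (P df) delta) => [e| |].
- have me r : mean_run df r [::] <= e by rewrite -lee_fin -E; exact: mean_run_le_expected.
  rewrite lee_fin; apply: (limit_bound (m := fun r => mean_run df r [::])
    (f := fun r => run df r [::])) => //.
  + exact: info_f_gt0.
  + by rewrite oppr_ge0 ln_le0//; case/andP: b01.
  + by move=> r; exact: (run_le_mean_run iidX).
  + by move=> r; exact: (run_ge0 iidX).
  + move=> r; have h1 := @acc_ln_le df dg1 a b r fa g1b b01.
    have h2 := @acc_ln_le df dg2 a b r fa g2b b01.
    have : df = df <-> dg1 <> df by split.
    have : df = df <-> dg2 <> df by split.
    move=> /h2{}h2 /h1{}h1; have := info_f_sum_le r [::].
    move: h1 h2; move: (_ * (1 - a - _)) (ln 2) (info _ _ _ _) (info _ _ _ _) => ? ? ? ?.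
    by move: (info_f R) (mean_run _ _ _) => I m; lra.
- by rewrite leey.
- by have := mean_run_le_expected iidX delta df 0; rewrite E.
Qed.

Lemma expected_g_ge j a b : j <> df -> err j <= a -> err df <= b -> 0 < b <= 1 ->
  (((- ln b * (1 - a) - ln 2) / info_g R)%:E <= expected_time (P j) delta)%E.
Proof.
move=> jf ja fb b01; case E: (expected_time (P j) delta) => [e| |].
- have me r : mean_run j r [::] <= e by rewrite -lee_fin -E; exact: mean_run_le_expected.
  rewrite lee_fin; apply: (limit_bound (m := fun r => mean_run j r [::])
    (f := fun r => run j r [::])) => //.
  + exact: info_g_gt0.
  + by rewrite oppr_ge0 ln_le0//; case/andP: b01.
  + by move=> r; exact: (run_le_mean_run iidX).
  + by move=> r; exact: (run_ge0 iidX).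
  + move=> r; have h : j = df <-> df <> df by split.
    exact: le_trans (acc_ln_le r ja fb b01 h) (info_g_le r [::] jf).
- by rewrite leey.
- by have := mean_run_le_expected iidX delta j 0; rewrite E.
Qed.

End lower_bound.

(** * From error levels to asymptotics *)

Section asymptotics.
Context {R : realType}.
Implicit Types (E : R -> \bar R) (a : R -> R).

Lemma near0_ln (L : R) : \forall c \near (0:R)^'+, [/\ 0 < c, c < 1 & L <= - ln c].
Proof.
near=> c; have c0 : 0 < c by near: c; exact: nbhs_right_gt.
have c1 : c < 1 by near: c; apply: (@nbhs_right_lt R 0 1); exact: ltr01.
split=> //.
have : c < expR (- L) by near: c; apply: (@nbhs_right_lt R 0 (expR (- L))); exact: expR_gt0.
by move=> /ltW h; rewrite lerNr -[leRHS]expRK ler_ln ?posrE ?expR_gt0.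
Unshelve. all: by end_near. Qed.

(** The correction is cut off at 0, since E(c) may be infinite or much larger than a(c) while o(1)
    has to be a vanishing real. *)
Lemma asymp_ge_eps E a : (\forall c \near (0:R)^'+, 0 < a c) ->
  (forall e : R, 0 < e -> \forall c \near (0:R)^'+, (((1 - e) * a c)%:E <= E c)%E) ->
  asymp_ge E a.
Proof.
move=> a0 h; pose r c : R := if E c is EFin x then Num.min 0 (x / a c - 1) else 0.
exists r.
  apply/cvgrPdist_le => e e0; near=> c.
  have ac : 0 < a c by near: c.
  have Ec : (((1 - e) * a c)%:E <= E c)%E by near: c; exact: h.
  rewrite sub0r normrN /r; case: (E c) Ec => [x| |]; rewrite ?normr0 ?(ltW e0)//.
  rewrite lee_fin -ler_pdivlMr// => xe; rewrite ler_norml le_min oppr_le0 (ltW e0) /=.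
  rewrite ge_min (ltW e0) /= andbT; lra.
near=> c.
have ac : 0 < a c by near: c.
have Ec : (((1 - 1) * a c)%:E <= E c)%E by near: c; apply: h; exact: ltr01.
rewrite /r; case: (E c) Ec => [x| |] //; rewrite ?leey//.
move=> _; rewrite lee_fin -ler_pdivlMr// -lerBrDl ge_min; apply/orP; right; lra.
Unshelve. all: by end_near. Qed.

Lemma asymp_eq_eps E a : (\forall c \near (0:R)^'+, 0 < a c) ->
  (forall e : R, 0 < e -> \forall c \near (0:R)^'+, (((1 - e) * a c)%:E <= E c)%E) ->
  (forall e : R, 0 < e -> \forall c \near (0:R)^'+, (E c <= ((1 + e) * a c)%:E)%E) ->
  asymp_eq E a.
Proof.
move=> a0 h h'; exists (fun c => fine (E c) / a c - 1).
  apply/cvgrPdist_le => e e0; near=> c.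
  have ac : 0 < a c by near: c.
  have : (((1 - e) * a c)%:E <= E c)%E by near: c; exact: h.
  have : (E c <= ((1 + e) * a c)%:E)%E by near: c; exact: h'.
  case: (E c) => [x| |] //=; rewrite !lee_fin => h1 h2.
  move: h1 h2; rewrite -(ler_pdivlMr _ _ ac) -(ler_pdivrMr _ _ ac) => h1 h2.
  by rewrite sub0r normrN ler_norml; apply/andP; split; lra.
near=> c.
have ac : 0 < a c by near: c.
have : (((1 - 1) * a c)%:E <= E c)%E by near: c; apply: h; exact: ltr01.
have : (E c <= ((1 + 1) * a c)%:E)%E by near: c; apply: h'; exact: ltr01.
by case: (E c) => [x| |] //= _ _; congr EFin; field; rewrite gt_eqF.
Unshelve. all: by end_near. Qed.

Lemma asymp_eq_of_ge E a : (\forall c \near (0:R)^'+, 0 < a c) ->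
  asymp_ge E a ->
  (forall e : R, 0 < e -> \forall c \near (0:R)^'+, (E c <= ((1 + e) * a c)%:E)%E) ->
  asymp_eq E a.
Proof.
move=> a0 [r r0 hr]; apply: asymp_eq_eps => // e e0; near=> c.
have ac : 0 < a c by near: c.
have re : `|0 - r c| <= e by near: c; move/cvgrPdist_le : r0; exact.
apply: (@le_trans _ _ ((1 + r c) * a c)%:E); last by near: c.
rewrite lee_fin ler_pM2r//; move: re; rewrite sub0r normrN ler_norml => /andP[]; lra.
Unshelve. all: by end_near. Qed.

Lemma ln_le_linear (d x : R) : 0 < d -> 0 < x -> ln x <= d * x - ln d.
Proof.
move=> d0 x0; have := le_ln1Dx (x := d * x - 1).
have -> : 1 + (d * x - 1) = d * x by ring.
rewrite lnM ?posrE// => h; have : -1 < d * x - 1 by rewrite ltrBrDl subrr mulr_gt0.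
by move=> /h; lra.
Qed.

Lemma mul_expRN_le (k d x : R) : 0 < d -> 0 < x -> k <= d * x / 2 -> k * (expR (- x) * x) <= d.
Proof.
move=> d0 x0 h; have := expR_ge1Dxn 1 (ltW x0); rewrite (_ : 2`!%:R = 2 :> R)// => h2.
have := expR_gt0 x; rewrite expRN.
have {h2} : x ^+ 2 / 2 <= expR x by lra.
move: (expR x) => E h2 E0; rewrite mulrCA ler_pdivrMl//.
have : k * x <= d * x / 2 * x by rewrite ler_pM2r.
have : x ^+ 2 / 2 * d <= E * d by rewrite ler_pM2r.
by rewrite expr2; lra.
Qed.

(** For the error level b = k c |log c|, - log b is |log c| minus log |log c| and a constant, so the
    factor |log c| allowed in the errors is of lower order. *)
Lemma error_level_asymp (k e : R) : 0 < k -> 0 < e -> \forall c \near (0:R)^'+,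
  [/\ 0 < k * (c * - ln c) <= 1 &
  (1 - e) * - ln c <= - ln (k * (c * - ln c)) * (1 - k * (c * - ln c)) - ln 2].
Proof.
(* Three losses of at most d |log c| each: the term log |log c|, the factor 1 - b, and the constants
   collected in [M]. *)
move=> k0 e0; pose d := Num.min (e / 3) 1.
have d0 : 0 < d by rewrite lt_min ltr01 andbT divr_gt0.
have d1 : d <= 1 by rewrite ge_min lexx orbT.
have de : 3 * d <= e by rewrite mulrC -ler_pdivlMr// ge_min lexx.
pose M := `|ln k| + `|ln d| + `|ln 2|.
have M0 : 0 <= M by rewrite !addr_ge0.
near=> c; have [c0 c1 L] : [/\ 0 < c, c < 1 & 2 * k / d + M / d + 1 <= - ln c].
  by near: c; exact: near0_ln.
have H1 : 0 <= 2 * k / d by rewrite divr_ge0 ?mulr_ge0// ltW.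
have H2 : 0 <= M / d by rewrite divr_ge0 // ltW.
have [x xE] : exists x, x = - ln c by eexists.
have cE : c = expR (- x) by rewrite xE opprK lnK ?posrE.
rewrite -xE in L *; have x0 : 0 < x by lra.
have kd : k * (c * x) <= d.
  rewrite cE; apply: mul_expRN_le => //; have : 2 * k / d <= x by lra.
  by rewrite ler_pdivrMr//; lra.
have y0 : 0 < k * (c * x) by rewrite !mulr_gt0.
split; first by rewrite y0 /= (le_trans kd).
have z0 : 0 <= - ln (k * (c * x)) by rewrite oppr_ge0 ln_le0// (le_trans kd).
have lx := ln_le_linear d0 x0.
have lE : ln (k * (c * x)) = ln k + (- x + ln x).
  by rewrite !lnM ?posrE ?mulr_gt0// xE opprK.
have Md : M <= d * x by rewrite mulrC -ler_pdivrMr//; lra.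
have hk := ler_norm (ln k); have hd := ler_norm (- ln d); have h2 := ler_norm (ln 2 : R).
rewrite normrN in hd.
have B : (1 - d) * x - `|ln k| - `|ln d| <= - ln (k * (c * x)) by rewrite lE; lra.
have P : - ln (k * (c * x)) * (1 - d) <= - ln (k * (c * x)) * (1 - k * (c * x)).
  by rewrite ler_wpM2l// lerD2l lerN2.
apply: le_trans (lerB P h2).
have B' : ((1 - d) * x - `|ln k| - `|ln d|) * (1 - d) <= - ln (k * (c * x)) * (1 - d).
  by rewrite ler_wpM2r// subr_ge0.
apply: le_trans (lerB B' (lexx _)).
have nk0 := normr_ge0 (ln k); have nd0 := normr_ge0 (ln d).
have a1 : 0 <= d * `|ln k| by rewrite mulr_ge0// ltW.
have a2 : 0 <= d * `|ln d| by rewrite mulr_ge0// ltW.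
have a3 : 0 <= d * (d * x) by rewrite !mulr_ge0// ltW.
have a4 : 3 * d * x <= e * x by rewrite ler_pM2r.
move: a1 a2 a3 a4 Md; rewrite /M; move: (`|ln k|) (`|ln d|) (`|ln 2|) => nk nd n2.
by clearbody d; clear; nra.
Unshelve. all: by end_near. Qed.

End asymptotics.

Section lower_asymptotics.
Context {R : realType} {disp : measure_display} {Omega : measurableType disp}.
Variables (P : density -> probability Omega R) (X : nat -> Omega -> R).
Hypothesis iidX : iid_normal P X.

Lemma asymp_ge_div_info (I : R) (E : R -> \bar R) : 0 < I ->
  (forall e, 0 < e -> \forall c \near (0:R)^'+, (((1 - e) * - ln c / I)%:E <= E c)%E) ->
  asymp_ge E (fun c => `|ln c| / I).
Proof.
move=> I0 h; apply: asymp_ge_eps.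
  near=> c; have [c0 c1 _] : [/\ 0 < c, c < 1 & 0 <= - ln c] by near: c; exact: near0_ln.
  by rewrite divr_gt0// normr_gt0 lt_eqF// ln_lt0// c0.
move=> e e0; near=> c.
have [c0 c1 L] : [/\ 0 < c, c < 1 & 0 <= - ln c] by near: c; exact: near0_ln.
by rewrite ler0_norm ?mulrA; [near: c; exact: h|lra].
Unshelve. all: by end_near. Qed.

Section family.
Variables (delta : R -> seq_test X) (k : R).
Hypothesis k0 : 0 < k.
Hypothesis errors : forall j, \forall c \near (0:R)^'+,
  fine (P j (incorrect (delta c) j)) <= k * (c * - ln c).

Lemma asymp_ge_f :
  asymp_ge (fun c => expected_time (P df) (delta c)) (fun c => `|ln c| / info_f R).
Proof.
apply: (asymp_ge_div_info (info_f_gt0 (R := R))) => e e0; near=> c.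
have [b01 h] : [/\ 0 < k * (c * - ln c) <= 1 &
  (1 - e) * - ln c <= - ln (k * (c * - ln c)) * (1 - k * (c * - ln c)) - ln 2].
  by near: c; exact: error_level_asymp.
have ef : fine (P df (incorrect (delta c) df)) <= k * (c * - ln c) by near: c; exact: errors.
have e1 : fine (P dg1 (incorrect (delta c) dg1)) <= k * (c * - ln c) by near: c; exact: errors.
have e2 : fine (P dg2 (incorrect (delta c) dg2)) <= k * (c * - ln c) by near: c; exact: errors.
apply: le_trans (expected_f_ge iidX ef e1 e2 b01).
by rewrite lee_fin ler_pM2r// invr_gt0 info_f_gt0.
Unshelve. all: by end_near. Qed.

Lemma asymp_ge_g j : j <> df ->
  asymp_ge (fun c => expected_time (P j) (delta c)) (fun c => `|ln c| / info_g R).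
Proof.
move=> jf; apply: (asymp_ge_div_info (info_g_gt0 (R := R))) => e e0; near=> c.
have [b01 h] : [/\ 0 < k * (c * - ln c) <= 1 &
  (1 - e) * - ln c <= - ln (k * (c * - ln c)) * (1 - k * (c * - ln c)) - ln 2].
  by near: c; exact: error_level_asymp.
have ef : fine (P df (incorrect (delta c) df)) <= k * (c * - ln c) by near: c; exact: errors.
have ej : fine (P j (incorrect (delta c) j)) <= k * (c * - ln c) by near: c; exact: errors.
apply: le_trans (expected_g_ge iidX jf ej ef b01).
by rewrite lee_fin ler_pM2r// invr_gt0 info_g_gt0.
Unshelve. all: by end_near. Qed.

End family.

Lemma error_level_of_bigO (delta : R -> seq_test X) :
  (forall j : density,
    ((fun c : R => fine (P j (incorrect (delta c) j))) : R -> R^o)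
      =O_ ((0:R)^'+) ((fun c : R => c * ln c) : R -> R^o)) ->
  exists2 k : R, 0 < k & forall j, \forall c \near (0:R)^'+,
    fine (P j (incorrect (delta c) j)) <= k * (c * - ln c).
Proof.
move=> h; have {}h j : exists2 k : R, 0 < k & \forall c \near (0:R)^'+,
    fine (P j (incorrect (delta c) j)) <= k * (c * - ln c).
  have /eqO_exP[k k0 hk] := h j; exists k => //; near=> c.
  have [c0 c1 L] : [/\ 0 < c, c < 1 & 0 <= - ln c] by near: c; exact: near0_ln.
  apply: (le_trans (ler_norm _)).
  have <- : `|c * ln c| = c * - ln c by rewrite normrM gtr0_norm// ler0_norm//; lra.
  by near: c; exact: hk.
have [k1 k10 h1] := h df; have [k2 k20 h2] := h dg1; have [k3 k30 h3] := h dg2.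
exists (k1 + k2 + k3) => [|j]; first by rewrite !addr_gt0.
near=> c; have [c0 c1 L] : [/\ 0 < c, c < 1 & 0 <= - ln c] by near: c; exact: near0_ln.
have cL : 0 <= c * - ln c by rewrite mulr_ge0// ltW.
case: j.
- apply: (@le_trans _ _ (k1 * (c * - ln c))); first by near: c.
  by rewrite ler_wpM2r//; lra.
- apply: (@le_trans _ _ (k2 * (c * - ln c))); first by near: c.
  by rewrite ler_wpM2r//; lra.
- apply: (@le_trans _ _ (k3 * (c * - ln c))); first by near: c.
  by rewrite ler_wpM2r//; lra.
Unshelve. all: by end_near. Qed.

End lower_asymptotics.

(** * The two-stage test *)

Section message_law.
Context {R : realType}.
Variable lamstar : R.

Lemma message_probE v b j :
  message_prob lamstar v b j = dprob j [set x | two_stage_quantize lamstar x v = b].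
Proof.
have mA : measurable [set x | two_stage_quantize lamstar x v = b].
  have := measurable_two_stage_quantize lamstar 0 v.
  by move=> /(_ measurableT [set b] I); rewrite setTI.
by apply: EFin_inj; rewrite dprobE// /message_prob fineK// fin_num_measure.
Qed.

Lemma message_prob_true v j :
  message_prob lamstar v true j = gcdf (mean j - threshold lamstar v).
Proof.
rewrite -tail_probE /tail_prob /message_prob; congr (fine (normal_prob _ _ _)).
by apply/seteqP; split=> x /=; rewrite /two_stage_quantize in_itv/= andbT.
Qed.

Lemma message_prob_false v j :
  message_prob lamstar v false j = 1 - message_prob lamstar v true j.
Proof.
rewrite !message_probE -dprob_setC; last first.
  have := measurable_two_stage_quantize lamstar 0 v.
  by move=> /(_ measurableT [set true] I); rewrite setTI.
congr dprob; apply/seteqP; split=> x /=; first by move=> ->.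
by case: two_stage_quantize.
Qed.

Lemma message_prob01 v b j : 0 < message_prob lamstar v b j < 1.
Proof.
case: b; rewrite ?message_prob_false message_prob_true ?gtail01//.
by rewrite gcdf_gt0 gcdf_lt1.
Qed.

Lemma message_prob_neq v i j : i <> j ->
  message_prob lamstar v true i != message_prob lamstar v true j.
Proof.
rewrite !message_prob_true; case: i j => -[] //= _;
  by [rewrite lt_eqF// gcdf_lt//; lra|rewrite gt_eqF// gcdf_lt//; lra].
Qed.

End message_law.

(** * Change of measure along the tree *)

Section tree_change.
Context {R : realType} {disp : measure_display} {Omega : measurableType disp}.
Variables (P : density -> probability Omega R) (X : nat -> Omega -> R).
Hypothesis iidX : iid_normal P X.

Let nonneg_split (a b c l1 l2 l3 p1 p2 p3 q1 q2 q3 x1 x2 x3 y1 y2 y3 : R) :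
  0 <= a * (l1 * q1 * y1) + b * (l2 * q2 * y2) + c * (l3 * q3 * y3) ->
  0 <= a * (l1 * p1 * x1) + b * (l2 * p2 * x2) + c * (l3 * p3 * x3) ->
  0 <= a * (l1 * (p1 * x1 + q1 * y1)) + b * (l2 * (p2 * x2 + q2 * y2)) +
       c * (l3 * (p3 * x3 + q3 * y3)).
Proof. by move=> h1 h2; apply: le_trans (addr_ge0 h1 h2) _; lra. Qed.

(** The product of [hprob] and [tree_val] is the total likelihood of the true leaves below h, so a
    linear inequality between likelihoods at those leaves passes to the sums. *)
Lemma tree_val_change (s : sensor R) (a b c : R) leaf r h :
  (forall r h, leaf r h = Some true ->
    0 <= a * hprob P X s df h + b * hprob P X s dg1 h + c * hprob P X s dg2 h) ->
  0 <= a * (hprob P X s df h * tree_val (kern s df) leaf r h) +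
       b * (hprob P X s dg1 h * tree_val (kern s dg1) leaf r h) +
       c * (hprob P X s dg2 h * tree_val (kern s dg2) leaf r h).
Proof.
move=> H; elim: r h => [|r IH] h /=.
  case e : leaf => [[]|]; rewrite ?mulr0 ?addr0//.
  by rewrite !mulr1; exact: (H _ _ e).
case e : leaf => [[]|]; first by rewrite !mulr1; exact: (H _ _ e).
  by rewrite !mulr0 ?addr0.
have := IH (rcons h true); have := IH (rcons h false); rewrite !(hprob_rcons iidX).
exact: nonneg_split.
Qed.

Lemma acc_change (delta : seq_test X) (a0 a1 a2 : R) b r :
  (forall h, decides delta b h -> 0 <= a0 * hprob P X (test_sensor delta) df h +
    a1 * hprob P X (test_sensor delta) dg1 h + a2 * hprob P X (test_sensor delta) dg2 h) ->
  0 <= a0 * acc delta df b r [::] + a1 * acc delta dg1 b r [::] + a2 * acc delta dg2 b r [::].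
Proof.
move=> H; have := @tree_val_change (test_sensor delta) a0 a1 a2 (acc_leaf delta b) r [::].
rewrite 3!(hprob_nil iidX (test_sensor delta)) !mul1r; apply=> r' h.
by rewrite /acc_leaf; case: ifP => [_ [/H]|_]; last by case: r'.
Qed.

End tree_change.

Section delta_I_tree.
Context {R : realType} {disp : measure_display} {Omega : measurableType disp}.
Variables (P : density -> probability Omega R) (X : nat -> Omega -> R).
Hypothesis iidX : iid_normal P X.
Variables (prior W : density -> R) (lamstar uc c : R).
Hypothesis prior_gt0 : forall j, 0 < prior j.
Hypothesis prior_sum : prior df + prior dg1 + prior dg2 = 1.
Hypothesis W_gt0 : forall j, 0 < W j.

Local Notation s := (two_stage_sensor prior lamstar uc).
Local Notation st := (state prior lamstar uc).
Local Notation lik := (hprob P X s).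
Local Notation stop_rule := (two_stage_stop prior W lamstar uc c).
Local Notation dec_rule := (two_stage_decision prior W lamstar uc c).
Definition two_stage : seq_test X := rule_test X s stop_rule dec_rule.

Lemma kernE j h b : kern s j h b = message_prob lamstar (st h).2 b j.
Proof. by rewrite message_probE. Qed.

Lemma kern01 j h b : 0 < kern s j h b < 1.
Proof. by rewrite kernE message_prob01. Qed.

Lemma kern_gt0 j h b : 0 < kern s j h b.
Proof. by case/andP: (kern01 j h b). Qed.

Lemma lik_gt0 j h : 0 < lik j h.
Proof.
elim/last_ind: h => [|h b IH]; first by rewrite (hprob_nil iidX).
by rewrite (hprob_rcons iidX) mulr_gt0// kern_gt0.
Qed.

(** Threshold messages have probabilities strictly between 0 and 1, so every history has positive
    probability. *)
Lemma realize h : exists w, history X s (size h) w = h.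
Proof.
apply: contrapT => nw; have := lik_gt0 df h; rewrite /hprob.
rewrite (_ : hist_set X s (size h) h = set0) ?measure0 ?ltxx//.
by rewrite -subset0 => w hw; apply: nw; exists w.
Qed.

Lemma state_rcons h b : st (rcons h b) = update lamstar uc (st h) b.
Proof. by rewrite /state foldl_rcons. Qed.

Definition evidence h := prior df * lik df h + prior dg1 * lik dg1 h + prior dg2 * lik dg2 h.

Lemma evidence_gt0 h : 0 < evidence h.
Proof. by rewrite !addr_gt0// mulr_gt0// lik_gt0. Qed.

(** The normalising constants of the Bayes recursion telescope. *)
Lemma posteriorE j h : (st h).1 j = prior j * lik j h / evidence h.
Proof.
elim/last_ind: h j => [|h b IH] j.
  by rewrite /evidence !(hprob_nil iidX) !mulr1 prior_sum divr1.
have e i : prior i * lik i (rcons h b) = prior i * lik i h * kern s i h b.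
  by rewrite (hprob_rcons iidX) mulrA.
have := evidence_gt0 (rcons h b); rewrite state_rcons /= /bayes /evidence !IH -!kernE !e.
have := evidence_gt0 h; rewrite /evidence.
move: (prior df * _) (prior dg1 * _) (prior dg2 * _) (prior j * _) => a b' c' d z0.
move: (kern _ _ _ _) (kern _ _ _ _) (kern _ _ _ _) (kern _ _ _ _) => x y z t z1.
by field; rewrite (gt_eqF z0) gt_eqF.
Qed.

Lemma ratioE h : posterior_ratio W (st h).1 = prior df * W df * lik df h /
  (prior dg1 * W dg1 * lik dg1 h + prior dg2 * W dg2 * lik dg2 h).
Proof.
have z0 := evidence_gt0 h; rewrite /posterior_ratio !posteriorE; field.
by rewrite (gt_eqF z0) andbT gt_eqF// addr_gt0 ?mulr_gt0 ?lik_gt0.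
Qed.

Lemma two_stage_stopsP h : reflect
  (stop_rule h /\ forall m, (m < size h)%N -> ~~ stop_rule (take m h)) (stops two_stage h).
Proof.
apply: (iffP idP); have [w <-] := realize h; rewrite size_history.
  by move/(stopsP two_stage) => /rule_stopP.
by move=> H; apply/(stopsP two_stage)/rule_stopP.
Qed.

Lemma two_stage_decides b h : decides two_stage b h -> stop_rule h /\ dec_rule h = b.
Proof.
have [w <-] := realize h; move/(decidesP two_stage) => -[sw].
have sw' : rule_stop X s stop_rule w = Some (size h) := sw.
rewrite /= /rule_decision sw' => dw; split=> //.
by have /rule_stopP[] := sw'.
Qed.

Hypothesis c01 : 0 < c < 1.

Let A j := prior j * W j.
Let A_gt0 j : 0 < A j. Proof. by rewrite mulr_gt0. Qed.

Let den_gt0 h : 0 < A dg1 * lik dg1 h + A dg2 * lik dg2 h.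
Proof. by rewrite addr_gt0// mulr_gt0// lik_gt0. Qed.

Lemma decides_true h : decides two_stage true h ->
  A df * lik df h <= c * (A dg1 * lik dg1 h + A dg2 * lik dg2 h).
Proof.
move=> /two_stage_decides[/andP[_]]; rewrite /two_stage_decision -/(posterior_ratio W _).
rewrite in_itv/= negb_and -!leNgt => /orP[|h1 /negP//]; rewrite ratioE.
by rewrite ler_pdivrMr.
Qed.

Lemma decides_false h : decides two_stage false h ->
  A dg1 * lik dg1 h + A dg2 * lik dg2 h <= c * (A df * lik df h).
Proof.
move=> /two_stage_decides[_ /negbFE]; rewrite ratioE ler_pdivlMr//.
by case/andP: c01 => c0 _; rewrite ler_pdivrMl.
Qed.

Let acc_le1 j b r : acc two_stage j b r [::] <= 1.
Proof.
have := acc_run_total iidX two_stage j r; have := run_ge0 iidX two_stage j r.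
have := acc_ge0 two_stage j true r [::]; have := acc_ge0 two_stage j false r [::].
by case: b; lra.
Qed.

(** Stopping in favour of H_1 is a linear inequality between likelihoods; summed over the leaves it
    leaves probabilities under the alternatives, which are bounded by 1. *)
Lemma acc_f_le r : acc two_stage df true r [::] <= (A dg1 + A dg2) / A df * c.
Proof.
have c0 : 0 < c by case/andP: c01.
rewrite mulrAC ler_pdivlMr//.
have := @acc_change _ _ _ _ _ iidX two_stage (- A df) (c * A dg1) (c * A dg2) true r.
have h1 : c * A dg1 * acc two_stage dg1 true r [::] <= c * A dg1.
  by rewrite ler_piMr// mulr_ge0// ltW.
have h2 : c * A dg2 * acc two_stage dg2 true r [::] <= c * A dg2.
  by rewrite ler_piMr// mulr_ge0// ltW.
move=> H; have {}H : 0 <= - A df * acc two_stage df true r [::] +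
  c * A dg1 * acc two_stage dg1 true r [::] + c * A dg2 * acc two_stage dg2 true r [::].
  apply: H => h /decides_true; move: (lik df h) (lik dg1 h) (lik dg2 h) => x y z.
  by move: (A df) (A dg1) (A dg2) => a a1 a2; lra.
move: h1 h2 H; move: (acc _ _ _ _ _) (acc _ _ _ _ _) (acc _ _ _ _ _) => x y z.
by move: (A df) (A dg1) (A dg2) => a a1 a2; lra.
Qed.

Lemma acc_g_le j r : j <> df -> acc two_stage j false r [::] <= A df / A j * c.
Proof.
move=> jf; have c0 : 0 < c by case/andP: c01.
have h1 : c * A df * acc two_stage df false r [::] <= c * A df.
  by rewrite ler_piMr// mulr_ge0// ltW.
rewrite mulrAC ler_pdivlMr//; case: j jf => // _.
- have := @acc_change _ _ _ _ _ iidX two_stage (c * A df) (- A dg1) 0 false r.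
  move=> H; have {}H : 0 <= c * A df * acc two_stage df false r [::] +
    - A dg1 * acc two_stage dg1 false r [::] + 0 * acc two_stage dg2 false r [::].
    apply: H => h /decides_false; have : 0 < A dg2 * lik dg2 h by rewrite mulr_gt0// lik_gt0.
    move: (lik df h) (lik dg1 h) (lik dg2 h) => x y z.
    by move: (A df) (A dg1) (A dg2) => a a1 a2; lra.
  move: h1 H; move: (acc _ _ _ _ _) (acc _ _ _ _ _) (acc _ _ _ _ _) => x y z.
  by move: (A df) (A dg1) => a a1; lra.
- have := @acc_change _ _ _ _ _ iidX two_stage (c * A df) 0 (- A dg2) false r.
  move=> H; have {}H : 0 <= c * A df * acc two_stage df false r [::] +
    0 * acc two_stage dg1 false r [::] + - A dg2 * acc two_stage dg2 false r [::].
    apply: H => h /decides_false; have : 0 < A dg1 * lik dg1 h by rewrite mulr_gt0// lik_gt0.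
    move: (lik df h) (lik dg1 h) (lik dg2 h) => x y z.
    by move: (A df) (A dg1) (A dg2) => a a1 a2; lra.
  move: h1 H; move: (acc _ _ _ _ _) (acc _ _ _ _ _) (acc _ _ _ _ _) => x y z.
  by move: (A df) (A dg2) => a a1; lra.
Qed.

Lemma two_stage_error j : fine (P j (incorrect two_stage j)) <=
  ((A dg1 + A dg2) / A df + A df / A dg1 + A df / A dg2) * c.
Proof.
have c0 : 0 < c by case/andP: c01.
have p0 : 0 < (A dg1 + A dg2) / A df * c by rewrite mulr_gt0// divr_gt0// addr_gt0.
have p1 : 0 < A df / A dg1 * c by rewrite mulr_gt0// divr_gt0.
have p2 : 0 < A df / A dg2 * c by rewrite mulr_gt0// divr_gt0.
have H : (P j (incorrect two_stage j) <=
    (((A dg1 + A dg2) / A df + A df / A dg1 + A df / A dg2) * c)%:E)%E.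
  apply: (incorrect_le iidX) => r; rewrite !mulrDl.
  case: j => /=.
  - apply: le_trans (acc_f_le r) _; rewrite -!mulrDl.
    by move: p0 p1 p2; move: (_ / _) (_ / _) (_ / _) => x y z; lra.
  - apply: le_trans (@acc_g_le dg1 r _) _ => //; rewrite -!mulrDl.
    by move: p0 p1 p2; move: (_ / _) (_ / _) (_ / _) => x y z; lra.
  - apply: le_trans (@acc_g_le dg2 r _) _ => //; rewrite -!mulrDl.
    by move: p0 p1 p2; move: (_ / _) (_ / _) (_ / _) => x y z; lra.
rewrite -lee_fin fineK// ge0_fin_numE ?measure_ge0//.
exact: le_lt_trans H (ltry _).
Qed.

End delta_I_tree.

(** * Exponential moments of likelihood ratios *)

Section tilt.
Context {R : realType}.

(** From 1 - y/2 <= e^(-y/2), squared and inverted. What remains is (1 - y/2)^2 (1 + y + y^2) >= 1,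
    with excess (y/2)^2 (1 - 3y + y^2); hence the restriction to y <= 1/3. *)
Lemma expR_le_quad (y : R) : y <= 1 / 3 -> expR y <= 1 + y + y ^+ 2.
Proof.
move=> y3; have y20 : 0 < 1 - y / 2 by lra.
have h : 1 - y / 2 <= expR (- (y / 2)) by have := expR_ge1Dx (- (y / 2)); lra.
have e : expR y = (expR (- (y / 2)) ^+ 2)^-1.
  by rewrite -exprVn -expRN opprK -expRM_natl; congr expR; field.
rewrite e; have p : 0 < expR (- (y / 2)) by exact: expR_gt0.
move: p h; move: (expR _) => E p h; rewrite invf_ple ?posrE ?exprn_gt0//; last by nra.
have q0 : 0 < 1 + y + y ^+ 2 by nra.
have EE : (1 - y / 2) ^+ 2 <= E ^+ 2 by rewrite lerXn2r// ?nnegrE ltW.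
apply: le_trans EE; rewrite -[leLHS]mul1r ler_pdivrMr// -subr_ge0.
rewrite (_ : _ - 1 = (y / 2) ^+ 2 * (1 - 3 * y + y ^+ 2)); last by field.
by rewrite mulr_ge0 ?sqr_ge0//; have := sqr_ge0 y; lra.
Qed.

(** The left side is the t-th moment under p of the likelihood ratio of q to p. It is 1 at t = 0
    with derivative - kl p q, so for small t it decays at almost that rate. *)
Lemma binary_tilt (p q e : R) : 0 < p < 1 -> 0 < q < 1 -> p != q -> 0 < e ->
  \forall t \near (0:R)^'+,
  p * expR (t * (ln q - ln p)) + (1 - p) * expR (t * (ln (1 - q) - ln (1 - p))) <=
  expR (- (t * ((1 - e) * kl p q))).
Proof.
move=> p01 q01 pq e0; have I0 := kl_gt0 p01 q01 pq.
have /andP[p0 p1] := p01; have /andP[q0 q1] := q01.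
have IE : kl p q = - (p * (ln q - ln p) + (1 - p) * (ln (1 - q) - ln (1 - p))).
  by rewrite /kl !ln_div ?posrE ?subr_gt0//; ring.
move: I0 IE; move: (kl p q) (ln q - ln p) (ln (1 - q) - ln (1 - p)) => I y z I0 IE.
have K0 : 0 < 3 * (`|y| + `|z| + 1) by rewrite mulr_gt0// ltr_wpDl// addr_ge0.
have Z0 : 0 < y ^+ 2 + z ^+ 2 + 1 by rewrite ltr_wpDl// addr_ge0// sqr_ge0.
near=> t; have t0 : 0 < t by near: t; exact: nbhs_right_gt.
have t1 : t <= (3 * (`|y| + `|z| + 1))^-1.
  by near: t; apply: nbhs_right_le; rewrite invr_gt0.
have t2 : t <= e * I / (y ^+ 2 + z ^+ 2 + 1).
  by near: t; apply: nbhs_right_le; rewrite divr_gt0// mulr_gt0.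
rewrite -[_^-1]mul1r ler_pdivlMr// in t1; rewrite ler_pdivlMr// in t2.
have ny := ler_norm y; have nz := ler_norm z.
have ny0 := normr_ge0 y; have nz0 := normr_ge0 z.
have hy : t * y <= 1 / 3.
  have : t * y <= t * (`|y| + `|z| + 1) by rewrite ler_pM2l//; lra.
  lra.
have hz : t * z <= 1 / 3.
  have : t * z <= t * (`|y| + `|z| + 1) by rewrite ler_pM2l//; lra.
  lra.
apply: (@le_trans _ _ (1 + - (t * ((1 - e) * I)))); last exact: expR_ge1Dx.
have hp : p * expR (t * y) <= p * (1 + t * y + (t * y) ^+ 2).
  by rewrite ler_pM2l// expR_le_quad.
have hq : (1 - p) * expR (t * z) <= (1 - p) * (1 + t * z + (t * z) ^+ 2).
  by rewrite ler_pM2l ?subr_gt0// expR_le_quad.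
apply: le_trans (lerD hp hq) _; rewrite !exprMn.
have ty : t ^+ 2 * (p * y ^+ 2) <= t ^+ 2 * y ^+ 2.
  by rewrite ler_wpM2l ?sqr_ge0// ler_piMl ?sqr_ge0// ltW.
have tz : t ^+ 2 * ((1 - p) * z ^+ 2) <= t ^+ 2 * z ^+ 2.
  by rewrite ler_wpM2l ?sqr_ge0// ler_piMl ?sqr_ge0//; lra.
have tt : t * (t * (y ^+ 2 + z ^+ 2 + 1)) <= t * (e * I) by rewrite ler_pM2l.
have t20 := sqr_ge0 t; clear - IE ty tz tt t20.
rewrite expr2 in t20 ty tz *; rewrite IE in tt *; lra.
Unshelve. all: by end_near. Qed.

End tilt.

Section finite.
Context {R : realType}.
Implicit Types (G : density -> R).

Lemma near_density (F : set_system R) (Q : density -> R -> Prop) : Filter F ->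
  (forall i, \forall t \near F, Q i t) -> \forall t \near F, forall i, Q i t.
Proof.
move=> FF h; have h0 := h df; have h1 := h dg1; have h2 := h dg2.
by near=> t => -[]; near: t.
Unshelve. all: by end_near. Qed.

Lemma near_option (F : set_system R) (Q : option density -> R -> Prop) : Filter F ->
  (forall i, \forall t \near F, Q i t) -> \forall t \near F, forall i, Q i t.
Proof.
move=> FF h; have h0 := h None; have h1 := near_density FF (fun i => h (Some i)).
by near=> t => -[i|]; [move: i|]; near: t.
Unshelve. all: by end_near. Qed.

Lemma density_bound G : exists2 D, 0 <= D & forall i, `|G i| <= D.
Proof.
exists (`|G df| + `|G dg1| + `|G dg2|); first by rewrite !addr_ge0.
have := normr_ge0 (G df); have := normr_ge0 (G dg1); have := normr_ge0 (G dg2).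
by move=> ? ? ? []; lra.
Qed.

Lemma density_bound2 (G : density -> density -> R) :
  exists2 D, 0 <= D & forall i j, `|G i j| <= D.
Proof.
have [D0 p0 h0] := density_bound (G df); have [D1 p1 h1] := density_bound (G dg1).
have [D2 p2 h2] := density_bound (G dg2); exists (D0 + D1 + D2); first by rewrite !addr_ge0.
by case=> j; [have := h0 j|have := h1 j|have := h2 j]; lra.
Qed.

Lemma option_bound2 (G : option density -> density -> density -> R) :
  exists2 D, 0 <= D & forall v i j, `|G v i j| <= D.
Proof.
have [D p h] := density_bound2 (G None).
have [D0 p0 h0] := density_bound2 (G (Some df)).
have [D1 p1 h1] := density_bound2 (G (Some dg1)).
have [D2 p2 h2] := density_bound2 (G (Some dg2)).
exists (D + D0 + D1 + D2); first by rewrite !addr_ge0.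
by case=> [[]|] i j; [have := h0 i j|have := h1 i j|have := h2 i j|have := h i j]; lra.
Qed.

End finite.

Section message_rates.
Context {R : realType}.
Variable lamstar : R.
Local Notation mp := (message_prob lamstar).

Definition mllr v b i j : R := ln (mp v b i) - ln (mp v b j).

(** The mean under [j] of the t-th power of the likelihood ratio of [i] to [j] for one message. *)
Definition tilted t v i j : R :=
  mp v true j * expR (t * mllr v true i j) + mp v false j * expR (t * mllr v false i j).

Lemma near_tilted (e : R) : 0 < e -> \forall t \near (0:R)^'+, forall v i j, i <> j ->
  tilted t v i j <= expR (- (t * ((1 - e) * kl (mp v true j) (mp v true i)))).
Proof.
move=> e0; apply: near_option => v; apply: near_density => i; apply: near_density => j.
have [->|ij] := pselect (i = j); first by near=> t.
have := binary_tilt (message_prob01 lamstar v true j) (message_prob01 lamstar v true i)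
  (message_prob_neq lamstar v (nesym ij)) e0.
apply: filterS => t h _; rewrite /tilted /mllr !message_prob_false; exact: h.
Unshelve. all: by end_near. Qed.

Lemma mllr_bound : exists2 D, 0 <= D & forall v b i j, `|mllr v b i j| <= D.
Proof.
have [D0 p0 h0] := option_bound2 (fun v => mllr v true).
have [D1 p1 h1] := option_bound2 (fun v => mllr v false).
exists (D0 + D1); first by rewrite addr_ge0.
by move=> v [] i j; [have := h0 v i j|have := h1 v i j]; lra.
Qed.

Lemma kl_message_min : exists2 k, 0 < k & forall v i j, i <> j ->
  k <= kl (mp v true j) (mp v true i).
Proof.
(* An upper bound on the inverses is a positive lower bound on the divergences. *)
have [D p h] := option_bound2 (fun v i j => (kl (mp v true j) (mp v true i))^-1).
have D1 : 0 < D + 1 by rewrite ltr_wpDl.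
exists (D + 1)^-1 => [|v i j ij]; first by rewrite invr_gt0.
have k0 := kl_gt0 (message_prob01 lamstar v true j) (message_prob01 lamstar v true i)
  (message_prob_neq lamstar v (nesym ij)).
have := h v i j; rewrite gtr0_norm ?invr_gt0// => hD.
by rewrite -[leRHS]invrK lef_pV2 ?posrE ?invr_gt0//; lra.
Qed.

End message_rates.

(* [Mo h] is a sum of powers of likelihood ratios, alternatives against the truth,
   over the densities that the final decision must exclude, and [Mn h] over all
   wrong densities. The phase is [None] in the first stage and [Some b] in the
   second one, [b] telling whether the preliminary decision is right. The test
   can only run while [Mo] (resp. [Mn]) is large, and both shrink geometrically in
   mean; hence, by concavity, their logarithms decrease linearly. *)
Section potential.
Context {R : realType}.
Variables (K : seq bool -> bool -> R) (Mo Mn G : seq bool -> R).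
Variables (phase : seq bool -> option bool) (stopped : seq bool -> bool).
Variables (alive : seq bool -> Prop) (A B D l0 l1 : R).

Definition rate (b : bool) := if b then l1 else l0.

Hypothesis K01 : forall h, 0 < K h true < 1.
Hypothesis KF : forall h, K h false = 1 - K h true.
Hypothesis l0_gt0 : 0 < l0.
Hypothesis l01 : l0 <= l1.
Hypothesis D0 : 0 <= D.
Hypothesis B0 : 0 <= B.
Hypothesis BA : B <= A.
Hypothesis Mo_gt0 : forall h, 0 < Mo h.
Hypothesis Mo_le : forall h, Mo h <= Mn h.
Hypothesis Mn_step : forall h, phase h = None ->
  K h true * Mn (rcons h true) + K h false * Mn (rcons h false) <= expR (- l0) * Mn h.
Hypothesis Mo_step : forall h b, phase h = Some b ->
  K h true * Mo (rcons h true) + K h false * Mo (rcons h false) <= expR (- rate b) * Mo h.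
Hypothesis Mn_rcons : forall h b, expR (- D) * Mn h <= Mn (rcons h b).
Hypothesis Mo_rcons : forall h b, expR (- D) * Mo h <= Mo (rcons h b).
Hypothesis G_ge0 : forall h, 0 <= G h.
Hypothesis G_step : forall h, K h true * G (rcons h true) + K h false * G (rcons h false) = G h.
Hypothesis phase_rcons : forall h b x, phase h = Some x -> phase (rcons h b) = Some x.
Hypothesis phase_wrong : forall h b, phase h = None -> phase (rcons h b) = Some false ->
  1 <= G (rcons h b).
Hypothesis phase_run : forall h, phase h = None -> stopped h = false.
Hypothesis alive_rcons : forall h b, alive h -> stopped h = false -> alive (rcons h b).
Hypothesis Mo_low : forall h b, alive h -> stopped h = false -> phase h = Some b ->
  expR (- A) <= Mo h.
Hypothesis Mn_low : forall h, phase h = None -> expR (- B) <= Mn h.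

(* Bounds the expected remaining time in the first stage: the second-stage time
   if the preliminary decision is right, the rest of the first stage, and the
   excess after a wrong decision, an event on which [G] exceeds 1. The linear
   term in [Mn] dominates [ln Mo], which is not bounded above on that event. *)
Definition first_potential h := (ln (Mn h) + A + D) / l1 + (ln (Mn h) + B + D) / l0 +
  (Mn h + (A + D) * G h) / l0.

(** The offset [D] absorbs what one message can take from [ln Mo]: while the test runs, the argument
    of the maximum is nonnegative at the node and at both children. The maximum with 0 matters only
    after stopping or on entering the second stage. *)
Definition potential h :=
  if phase h is Some b then Num.max (ln (Mo h) + A + D) 0 / rate b else first_potential h.

Let l1_gt0 : 0 < l1. Proof. exact: lt_le_trans l0_gt0 l01. Qed.

Let rate_gt0 b : 0 < rate b. Proof. by case: b. Qed.

Let Mn_gt0 h : 0 < Mn h. Proof. exact: lt_le_trans (Mo_gt0 h) (Mo_le h). Qed.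

Let A0 : 0 <= A. Proof. exact: le_trans B0 BA. Qed.

(* Jensen's inequality for [ln]. *)
Let ln_step (M : seq bool -> R) l h : (forall h, 0 < M h) ->
  K h true * M (rcons h true) + K h false * M (rcons h false) <= expR (- l) * M h ->
  K h true * ln (M (rcons h true)) + K h false * ln (M (rcons h false)) <= ln (M h) - l.
Proof.
move=> M0; have /andP[k0 k1] := K01 h; rewrite KF => hM.
have k01 : 0 <= K h true <= 1 by rewrite !ltW.
have := kl_ge_ln k01 (K01 h) (M0 (rcons h true)) (M0 (rcons h false)).
rewrite klxx add0r => h1; apply: le_trans h1 _.
have -> : ln (M h) - l = ln (expR (- l) * M h) by rewrite lnM ?posrE ?expR_gt0// expRK addrC.
rewrite ler_ln ?posrE// ?mulr_gt0 ?expR_gt0//.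
by rewrite addr_gt0// mulr_gt0// subr_gt0.
Qed.

Let ln_rcons (M : seq bool -> R) h b : (forall h, 0 < M h) ->
  expR (- D) * M h <= M (rcons h b) -> ln (M h) - D <= ln (M (rcons h b)).
Proof.
move=> M0 hM.
have -> : ln (M h) - D = ln (expR (- D) * M h) by rewrite lnM ?posrE ?expR_gt0// expRK addrC.
by rewrite ler_ln ?posrE// mulr_gt0// expR_gt0.
Qed.

Let low_ln (a M : R) : 0 < M -> expR (- a) <= M -> 0 <= ln M + a.
Proof. by move=> M0 h; rewrite -lerBlDr sub0r; exact: ln_ge_of_expR. Qed.

Let first_potential_ge0 h : phase h = None -> 0 <= first_potential h.
Proof.
move=> ph; have := low_ln (Mn_gt0 h) (Mn_low ph) => hB; have d0 := D0; have ba := BA.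
rewrite !addr_ge0// divr_ge0 ?(ltW l1_gt0) ?(ltW l0_gt0)//.
- by lra.
- by lra.
- by rewrite addr_ge0 ?(ltW (Mn_gt0 h))// mulr_ge0// addr_ge0.
Qed.

Let potential_ge0 h : 0 <= potential h.
Proof.
rewrite /potential; case e: (phase h) => [b|]; last exact: first_potential_ge0.
by rewrite divr_ge0 ?(ltW (rate_gt0 b))// le_max lexx orbT.
Qed.

(** On entering the second stage, the first summand of [first_potential] covers a right decision. A
    wrong one is covered by the third, since then [G] is at least 1 and ln Mo <= Mo - 1 <= Mn. *)
Let potential_le_first h b : phase h = None -> potential (rcons h b) <= first_potential (rcons h b).
Proof.
move=> ph; rewrite /potential; case e: (phase (rcons h b)) => [x|]; last by [].
have hB := low_ln (Mn_gt0 h) (Mn_low ph); have d0 := D0; have ba := BA.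
have hn := ln_rcons Mn_gt0 (Mn_rcons h b).
have hon : ln (Mo (rcons h b)) <= ln (Mn (rcons h b)) by rewrite ler_ln ?posrE.
have T0 : 0 <= (ln (Mn (rcons h b)) + B + D) / l0 by rewrite divr_ge0 ?(ltW l0_gt0)//; lra.
have Y0 : 0 <= (ln (Mn (rcons h b)) + A + D) / l1 by rewrite divr_ge0 ?(ltW l1_gt0)//; lra.
have g0 : 0 <= (A + D) * G (rcons h b) by rewrite mulr_ge0// addr_ge0.
have Z0 : 0 <= (Mn (rcons h b) + (A + D) * G (rcons h b)) / l0.
  by rewrite divr_ge0 ?(ltW l0_gt0)// addr_ge0// ltW.
rewrite /first_potential; case: x e => e; rewrite /rate.
  apply: (@le_trans _ _ ((ln (Mn (rcons h b)) + A + D) / l1)); last by lra.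
  rewrite ler_pM2r ?invr_gt0// ge_max; apply/andP; split; lra.
apply: (@le_trans _ _ ((Mn (rcons h b) + (A + D) * G (rcons h b)) / l0)); last by lra.
rewrite ler_pM2r ?invr_gt0// ge_max; apply/andP; split; last by rewrite addr_ge0// ltW.
have G1 : A + D <= (A + D) * G (rcons h b).
  by rewrite ler_peMr ?addr_ge0// phase_wrong.
have : ln (Mo (rcons h b)) <= Mo (rcons h b) - 1.
  have := le_ln1Dx (x := Mo (rcons h b) - 1).
  by rewrite (_ : 1 + (_ - 1) = Mo (rcons h b)); [apply; rewrite ltrBrDl subrr|ring].
by have := Mo_le (rcons h b); lra.
Qed.

(** Only the second summand pays for the unit of time: its numerator drops by [l0] in mean. The
    others merely do not grow, [Mn] being a supermartingale and [G] a martingale. *)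
Let first_potential_step h : phase h = None ->
  1 + (K h true * first_potential (rcons h true) + K h false * first_potential (rcons h false))
    <= first_potential h.
Proof.
move=> ph; have l0p := l0_gt0; have hl := ln_step Mn_gt0 (Mn_step ph).
have hG := G_step h.
have hM : K h true * Mn (rcons h true) + K h false * Mn (rcons h false) <= Mn h.
  apply: le_trans (Mn_step ph) _; rewrite ler_piMl ?(ltW (Mn_gt0 h))//.
  by rewrite -expR0 ler_expR oppr_le0 ltW.
rewrite /first_potential; move: hl hG hM; rewrite KF.
move: (ln (Mn h)) (ln (Mn (rcons h true))) (ln (Mn (rcons h false))) => x y z.
move: (Mn h) (Mn (rcons h true)) (Mn (rcons h false)) => x' y' z'.
move: (G h) (G (rcons h true)) (G (rcons h false)) (K h true) => g g1 g2 k hl hG hM.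
have E : 1 + (k * ((y + A + D) / l1 + (y + B + D) / l0 + (y' + (A + D) * g1) / l0) +
   (1 - k) * ((z + A + D) / l1 + (z + B + D) / l0 + (z' + (A + D) * g2) / l0)) =
   (k * y + (1 - k) * z + A + D) / l1 + (k * y + (1 - k) * z + l0 + B + D) / l0 +
   (k * y' + (1 - k) * z' + (A + D) * (k * g1 + (1 - k) * g2)) / l0.
  by field; rewrite !gt_eqF.
rewrite E hG; apply: lerD; first apply: lerD; rewrite ler_pM2r ?invr_gt0//; lra.
Qed.

Lemma potential_step h : alive h -> stopped h = false ->
  1 + (K h true * potential (rcons h true) + K h false * potential (rcons h false))
    <= potential h.
Proof.
move=> ah sh; have /andP[k0 k1] := K01 h.
case e: (phase h) => [b|].
  rewrite /potential e !(phase_rcons _ e).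
  have hA := low_ln (Mo_gt0 h) (Mo_low ah sh e); have d0 := D0.
  have c b' : 0 <= ln (Mo (rcons h b')) + A + D.
    by have := ln_rcons Mo_gt0 (Mo_rcons h b'); lra.
  have hl := ln_step Mo_gt0 (Mo_step e).
  have ch : 0 <= ln (Mo h) + A + D by lra.
  rewrite !max_l//; move: hl (rate_gt0 b); rewrite KF; move: (rate b) (K h true) => l k.
  move: (ln _) (ln _) (ln _) => x y z hl l_gt0.
  rewrite (_ : 1 + _ = (k * z + (1 - k) * y + l + A + D) / l); last by field; rewrite gt_eqF.
  by rewrite ler_pM2r ?invr_gt0//; lra.
have -> : potential h = first_potential h by rewrite /potential e.
apply: le_trans (first_potential_step e).
rewrite lerD2l; apply: lerD; first by rewrite ler_pM2l// potential_le_first.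
by rewrite KF ler_pM2l ?subr_gt0// potential_le_first.
Qed.

Lemma le_potential (m : nat -> seq bool -> R) :
  (forall h, m 0%N h = 0) ->
  (forall r h, m r.+1 h = if stopped h then 0 else
    1 + (K h true * m r (rcons h true) + K h false * m r (rcons h false))) ->
  forall r h, alive h -> m r h <= potential h.
Proof.
move=> m0 mS; elim=> [|r IH] h ah; first by rewrite m0 potential_ge0.
rewrite mS; case: ifPn => [_|/negbTE sh]; first exact: potential_ge0.
have /andP[k0 k1] := K01 h.
apply: le_trans (potential_step ah sh); rewrite lerD2l; apply: lerD.
  by rewrite ler_pM2l//; apply: IH; exact: alive_rcons.
by rewrite KF ler_pM2l ?subr_gt0//; apply: IH; exact: alive_rcons.
Qed.

End potential.

Section exp_sum.
Context {R : realType}.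
Variables (t : R) (w : density -> R).
Hypothesis t0 : 0 < t.
Hypothesis w0 : forall i, 0 <= w i.
Implicit Types L z : density -> R.

(** The logarithm of this sum is a smooth substitute for the maximum of the weighted log-likelihood
    ratios; the weights 0 and 1 select which densities count. *)
Definition exp_sum L := w df * expR (t * L df) + w dg1 * expR (t * L dg1) + w dg2 * expR (t * L dg2).

Lemma exp_sum_ge i L : w i * expR (t * L i) <= exp_sum L.
Proof.
have p k : 0 <= w k * expR (t * L k) by rewrite mulr_ge0// ltW// expR_gt0.
by have := p df; have := p dg1; have := p dg2; rewrite /exp_sum; case: i; lra.
Qed.

Lemma exp_sum_gt0 i L : 0 < w i -> 0 < exp_sum L.
Proof. by move=> wi; apply: lt_le_trans (exp_sum_ge i L); rewrite mulr_gt0 ?expR_gt0. Qed.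

Lemma exp_sum_le (w' : density -> R) L : (forall i, w i <= w' i) ->
  exp_sum L <= w' df * expR (t * L df) + w' dg1 * expR (t * L dg1) + w' dg2 * expR (t * L dg2).
Proof. by move=> ww; rewrite /exp_sum !lerD// ler_pM2r ?expR_gt0. Qed.

Lemma exp_sum_shift_ge D L z : (forall i, `|t * z i| <= D) ->
  expR (- D) * exp_sum L <= exp_sum (fun i => L i + z i).
Proof.
move=> zD; have h i : expR (- D) * (w i * expR (t * L i)) <= w i * expR (t * (L i + z i)).
  rewrite mulrCA ler_wpM2l// mulrDr addrC expRD ler_pM2r ?expR_gt0// ler_expR.
  by have := zD i; rewrite ler_norml => /andP[].
by rewrite /exp_sum 2!mulrDr !lerD.
Qed.

Lemma exp_sum_step E k L y z :
  (forall i, 0 < w i -> k * expR (t * y i) + (1 - k) * expR (t * z i) <= E) ->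
  k * exp_sum (fun i => L i + y i) + (1 - k) * exp_sum (fun i => L i + z i) <= E * exp_sum L.
Proof.
move=> h; have h' i : w i * expR (t * L i) * (k * expR (t * y i) + (1 - k) * expR (t * z i)) <=
    w i * expR (t * L i) * E.
  have := w0 i; rewrite le_eqVlt => /predU1P[<-|wi]; first by rewrite !mul0r.
  by rewrite ler_pM2l ?h// mulr_gt0// expR_gt0.
rewrite /exp_sum !mulrDr !expRD.
move: (h' df) (h' dg1) (h' dg2).
move: (expR (t * L df)) (expR (t * L dg1)) (expR (t * L dg2)) => a b c.
move: (expR (t * y df)) (expR (t * y dg1)) (expR (t * y dg2)) => a1 b1 c1.
move: (expR (t * z df)) (expR (t * z dg1)) (expR (t * z dg2)) => a2 b2 c2.
move: (w df) (w dg1) (w dg2) => d e f; clear; lra.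
Qed.

End exp_sum.

(* The densities to be excluded when [j] is true: those of the other hypothesis. *)
Definition opponent {R : realType} (j i : density) : R :=
  match j, i with df, df => 0 | df, _ => 1 | _, df => 1 | _, _ => 0 end.

(** The preliminary decision separates all three densities, so in the first stage every wrong
    density counts, including the one that belongs to the same hypothesis. *)
Definition others {R : realType} (j i : density) : R := if `[< i = j >] then 0 else 1.

Section opponents.
Context {R : realType}.
Implicit Types i j : density.

Lemma opponent_ge0 j i : 0 <= opponent j i :> R.
Proof. by case: j i => -[]. Qed.

Lemma others_ge0 j i : 0 <= others j i :> R.
Proof. by rewrite /others; case: ifP. Qed.

Lemma opponent_neq j i : 0 < opponent j i :> R -> i <> j.
Proof. by case: j i => -[] //=; rewrite ltxx. Qed.

Lemma others_neq j i : i <> j -> others j i = 1 :> R.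
Proof. by move=> ij; rewrite /others asboolF. Qed.

Lemma others_gt0 j i : 0 < others j i :> R -> i <> j.
Proof. by rewrite /others; case: asboolP; rewrite ?ltxx. Qed.

Lemma opponent_le j i : opponent j i <= others j i :> R.
Proof.
rewrite /others; case: asboolP => [->|]; first by case: j.
by case: j i => -[].
Qed.

Lemma opponent_exists j : exists i, opponent j i = 1 :> R.
Proof. by case: j; [exists dg1|exists df|exists df]. Qed.

Lemma others_sum j : others j df + others j dg1 + others j dg2 = 2 :> R.
Proof.
rewrite /others; case: j; rewrite (asboolT erefl) !asboolF//; by lra.
Qed.

End opponents.

Section log_ratio.
Context {R : realType}.

(** The factor 2 is the price of singling out the larger of two competing terms. *)
Lemma llr_lower (c a b x y K : R) : 0 < c -> 0 < a -> 0 < b -> 0 < x -> 0 < y ->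
  `|ln a| <= K -> `|ln b| <= K -> c * (a * x) <= 2 * (b * y) ->
  - (- ln c + (2 * K + ln 2)) <= ln y - ln x.
Proof.
move=> c0 a0 b0 x0 y0 aK bK; rewrite -ler_ln ?posrE ?mulr_gt0// !lnM ?posrE ?mulr_gt0//.
move: aK bK; rewrite !ler_norml => /andP[+ _] /andP[_ +]; lra.
Qed.

End log_ratio.

(** * The potential of the two-stage test *)

Section two_stage_potential.
Context {R : realType} {disp : measure_display} {Omega : measurableType disp}.
Variables (P : density -> probability Omega R) (X : nat -> Omega -> R).
Hypothesis iidX : iid_normal P X.
Variables (prior W : density -> R) (lamstar uc c : R).
Hypothesis prior_gt0 : forall j, 0 < prior j.
Hypothesis prior_sum : prior df + prior dg1 + prior dg2 = 1.
Hypothesis W_gt0 : forall j, 0 < W j.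
Hypothesis c0 : 0 < c.
Hypothesis cuc : c <= uc.
Hypothesis uc1 : uc < 1.

Local Notation S := (two_stage_sensor prior lamstar uc).
Local Notation st := (state prior lamstar uc).
Local Notation lik := (hprob P X S).
Local Notation mp := (message_prob lamstar).
Local Notation mllr := (mllr lamstar).
Local Notation tilted := (tilted lamstar).
Local Notation stop_rule := (two_stage_stop prior W lamstar uc c).
Local Notation delta := (two_stage X prior W lamstar uc c).
Local Notation kern := (kern S).
Local Notation evidence := (evidence P X prior lamstar uc).

Variables (j : density) (t D K0 l0 l1 : R).
Hypothesis t0 : 0 < t.
Hypothesis prior_bound : forall i, `|ln (prior i)| <= K0.
Hypothesis cost_bound : forall i, `|ln (prior i * W i)| <= K0.
Hypothesis D0 : 0 <= D.
Hypothesis mllr_le : forall v b i, `|t * mllr v b i j| <= D.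
Hypothesis l0_gt0 : 0 < l0.
Hypothesis l01 : l0 <= l1.
Hypothesis tilted0 : forall v i, i <> j -> tilted t v i j <= expR (- l0).
Hypothesis tilted1 : forall i, 0 < opponent j i :> R -> tilted t (Some j) i j <= expR (- l1).

Let uc0 : 0 < uc. Proof. exact: lt_le_trans c0 cuc. Qed.

Let lik0 i h : 0 < lik i h. Proof. exact: lik_gt0. Qed.

Definition llr h (i : density) : R := ln (lik i h) - ln (lik j h).

Lemma llr_rcons h b : llr (rcons h b) = fun i => llr h i + mllr (st h).2 b i j.
Proof.
have e k : ln (lik k (rcons h b)) = ln (lik k h) + ln (mp (st h).2 b k).
  have k0 : 0 < kern k h b by exact: kern_gt0.
  by rewrite (hprob_rcons iidX) -kernE lnM// posrE.
apply/funext => i; rewrite /llr /mllr !e.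
by rewrite addrACA -opprD.
Qed.

Definition Kbound := 2 * K0 + ln 2.

Let Kbound_ge0 : 0 <= Kbound.
Proof.
have : 0 <= ln 2 :> R by rewrite ln_ge0//; lra.
have := le_trans (normr_ge0 _) (prior_bound df).
by rewrite /Kbound; lra.
Qed.

Definition phase h : option bool := omap (fun d => `[< d = j >]) (st h).2.

Definition pace (w : density -> R) h := exp_sum t w (llr h).

Let pace_gt0 w i h : (forall i, 0 <= w i) -> 0 < w i -> 0 < pace w h.
Proof. by move=> w0; exact: exp_sum_gt0. Qed.

Let pace_rcons w h b : (forall i, 0 <= w i) -> expR (- D) * pace w h <= pace w (rcons h b).
Proof. by move=> w0; rewrite /pace llr_rcons; apply: exp_sum_shift_ge. Qed.

Let pace_step w l h : (forall i, 0 <= w i) ->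
  (forall i, 0 < w i -> tilted t (st h).2 i j <= expR (- l)) ->
  kern j h true * pace w (rcons h true) + kern j h false * pace w (rcons h false) <=
  expR (- l) * pace w h.
Proof.
move=> w0 wl; rewrite kern_false kernE /pace !llr_rcons; apply: exp_sum_step => // i wi.
by have := wl i wi; rewrite /tilted message_prob_false.
Qed.

(* A martingale under the true density, being the likelihood ratio of the mixture;
   it is at least 1 once the posterior of the truth falls to [uc]. *)
Definition odds_bound h := uc * (evidence h / (prior j * lik j h)).

Let odds_step h : kern j h true * odds_bound (rcons h true) +
  kern j h false * odds_bound (rcons h false) = odds_bound h.
Proof.
have e i : prior i * lik i (rcons h true) + prior i * lik i (rcons h false) = prior i * lik i h.
  by rewrite !(hprob_rcons iidX) -mulrDr -mulrDr kern_sum mulr1.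
have ev : evidence (rcons h true) + evidence (rcons h false) = evidence h.
  rewrite /evidence -!e; move: (prior df * _) (prior df * _) (prior dg1 * _) (prior dg1 * _).
  by move: (prior dg2 * _) (prior dg2 * _) => ? ? ? ? ? ?; ring.
rewrite [in RHS]/odds_bound -ev /odds_bound !(hprob_rcons iidX).
have := kern_gt0 prior lamstar uc j h true; have := kern_gt0 prior lamstar uc j h false.
have := prior_gt0 j; have := lik0 j h.
move: (kern _ _ _) (kern _ _ _) (lik _ _) (prior j) (evidence _) (evidence _) => a b l p x y.
by move=> l0' p0 a0 b0; field; rewrite !gt_eqF.
Qed.

Let odds_ge0 h : 0 <= odds_bound h.
Proof.
by rewrite mulr_ge0 ?(ltW uc0)// divr_ge0 ?ltW ?mulr_gt0// evidence_gt0.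
Qed.

Let phase_rcons h b x : phase h = Some x -> phase (rcons h b) = Some x.
Proof. by rewrite /phase state_rcons /=; case: (st h).2. Qed.

Let max3P (p : density -> R) : p (argmax3 p) = max3 p.
Proof.
rewrite /argmax3; case: eqP => // h0; case: eqP => // h1; move: h0 h1; rewrite /max3.
by case: (leP (p dg1) (p dg2)) => _; case: leP.
Qed.

Let max3_ge (p : density -> R) i : p i <= max3 p.
Proof. by rewrite /max3 !le_max; case: i; rewrite lexx ?orbT. Qed.

Let post_sum h : (st h).1 df + (st h).1 dg1 + (st h).1 dg2 = 1.
Proof.
rewrite !(posteriorE iidX)// -!mulrDl divff// gt_eqF//; exact: evidence_gt0.
Qed.

Let post_ge0 h i : 0 <= (st h).1 i.
Proof.
rewrite (posteriorE iidX)// divr_ge0// ltW ?mulr_gt0//; exact: evidence_gt0.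
Qed.

Let phase_wrong h b : phase h = None -> phase (rcons h b) = Some false ->
  1 <= odds_bound (rcons h b).
Proof.
move=> ph pw; have : (st (rcons h b)).1 j <= uc.
  have e : (st h).2 = None by move: ph; rewrite /phase; case: (st h).2.
  have : exists d, [/\ d <> j & 1 - uc <= (st (rcons h b)).1 d].
    move: pw; rewrite /phase state_rcons /update /= e; case: ifP => //= hu [] /asboolPn dj.
    by eexists; split; [exact: dj|rewrite max3P].
  move=> [d [dj du]]; have := post_sum (rcons h b); move: dj du.
  have := post_ge0 (rcons h b) df; have := post_ge0 (rcons h b) dg1.
  have := post_ge0 (rcons h b) dg2.
  move: (st (rcons h b)).1 => p; case: d (j) => -[] //; lra.
have z0 : 0 < evidence (rcons h b) by exact: evidence_gt0.
rewrite (posteriorE iidX)// ler_pdivrMr// /odds_bound mulrA ler_pdivlMr ?mulr_gt0//.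
by rewrite mul1r.
Qed.

Let phase_run h : phase h = None -> stops delta h = false.
Proof.
move=> ph; apply/negP => /(two_stage_stopsP iidX) [] []; rewrite /two_stage_stop.
by move: ph; rewrite /phase; case: (st h).2.
Qed.

(** The test stops at the first time its rule holds; on histories without an earlier stop, stopping
    is just the rule at h. *)
Definition alive h := forall m, (m < size h)%N -> ~~ stop_rule (take m h).

Let alive_stop h : alive h -> stops delta h = false -> ~~ stop_rule h.
Proof.
by move=> ah /negbT; apply: contra => sh; apply/(two_stage_stopsP iidX).
Qed.

Let alive_rcons h b : alive h -> stops delta h = false -> alive (rcons h b).
Proof.
move=> ah sh m; rewrite size_rcons ltnS leq_eqVlt => /predU1P[->|mh].
  by rewrite -cats1 take_size_cat//; exact: alive_stop.
by rewrite -cats1 takel_cat ?ah// ltnW.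
Qed.

Let pace_low w x i h : (forall i, 0 <= w i) -> w i = 1 -> - x <= llr h i ->
  expR (- (t * x)) <= pace w h.
Proof.
move=> w0 wi hx; apply: le_trans (exp_sum_ge t w0 i _).
by rewrite wi mul1r ler_expR -mulrN ler_pM2l.
Qed.

Let A i := prior i * W i.
Let A_gt0 i : 0 < A i. Proof. by rewrite mulr_gt0. Qed.

(** While the posterior ratio lies in (c, 1/c), the weighted likelihood of the truth is at most 1/c
    times that of the opposite hypothesis. Under f, the larger of the two alternatives carries half
    of the latter. *)
Let opponent_low h b : alive h -> stops delta h = false -> phase h = Some b ->
  expR (- (t * (- ln c + Kbound))) <= pace (opponent j) h.
Proof.
move=> ah sh ph; have [i [i1 ic]] : exists i, opponent j i = 1 :> R /\
    c * (A j * lik j h) <= 2 * (A i * lik i h).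
  have := alive_stop ah sh; rewrite /two_stage_stop.
  have -> /= : (st h).2 by move: ph; rewrite /phase; case: (st h).2.
  rewrite negbK (ratioE iidX)// in_itv/= => /andP[].
  have d0 : 0 < A dg1 * lik dg1 h + A dg2 * lik dg2 h by rewrite addr_gt0// mulr_gt0.
  have a0 : 0 < A df * lik df h by rewrite mulr_gt0.
  have a1 : 0 < A dg1 * lik dg1 h by rewrite mulr_gt0.
  have a2 : 0 < A dg2 * lik dg2 h by rewrite mulr_gt0.
  rewrite ltr_pdivlMr// ltr_pdivrMr// -/(A df) -/(A dg1) -/(A dg2) => h1.
  rewrite ltr_pdivlMl// => h2.
  have c0' := c0; case: (j).
  - have [m|m] := leP (A dg1 * lik dg1 h) (A dg2 * lik dg2 h).
      exists dg2; split=> //; move: m a0 a1 a2 h1 h2.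
      by move: (A df * _) (A dg1 * _) (A dg2 * _) => x y z; lra.
    exists dg1; split=> //; move: m a0 a1 a2 h1 h2.
    by move: (A df * _) (A dg1 * _) (A dg2 * _) => x y z; lra.
  - exists df; split=> //; move: a0 a1 a2 h1 h2.
    move: (A df * _) (A dg1 * _) (A dg2 * _) => x y z x0 y0 z0 h1 h2.
    have cz : 0 < c * z by rewrite mulr_gt0.
    by move: h1 cz x0; clear h2; lra.
  - exists df; split=> //; move: a0 a1 a2 h1 h2.
    move: (A df * _) (A dg1 * _) (A dg2 * _) => x y z x0 y0 z0 h1 h2.
    have cz : 0 < c * y by rewrite mulr_gt0.
    by move: h1 cz x0; clear h2; lra.
apply: (pace_low (i := i)) => //; first exact: opponent_ge0.
exact: (llr_lower c0 (A_gt0 j) (A_gt0 i) (lik0 j h) (lik0 i h) (cost_bound j) (cost_bound i) ic).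
Qed.

Let others_low h : phase h = None -> expR (- (t * (- ln uc + Kbound))) <= pace (others j) h.
Proof.
move=> ph; have [i [ij il]] : exists i, i <> j /\ - (- ln uc + Kbound) <= llr h i.
  (* The first-stage rule is never applied to the prior itself, so the empty history is treated
     apart: all log-likelihood ratios vanish there. Afterwards the other densities share posterior
     mass more than [uc]. *)
  case/lastP: h ph => [_|h b ph].
    have [i ij] : exists i, i <> j by case: (j); [exists dg1|exists df|exists df].
    exists i; split=> //; rewrite /llr !(hprob_nil iidX) subrr oppr_le0.
    by rewrite addr_ge0// oppr_ge0 ln_le0// ltW.
  have pj : (st (rcons h b)).1 j < 1 - uc.
    have e : (st h).2 = None.
      by case e : (st h).2 => [d|] //; move: ph; rewrite /phase state_rcons /= e.
    move: ph; rewrite /phase state_rcons /update /= e; case: ifP => // /negbT.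
    by rewrite -ltNge => + _; apply: le_lt_trans; exact: max3_ge.
  have z0 : 0 < evidence (rcons h b) by exact: evidence_gt0.
  move: pj; rewrite (posteriorE iidX)// ltr_pdivrMr//; move: z0; rewrite /evidence.
  have a0 : 0 < prior df * lik df (rcons h b) by rewrite mulr_gt0.
  have a1 : 0 < prior dg1 * lik dg1 (rcons h b) by rewrite mulr_gt0.
  have a2 : 0 < prior dg2 * lik dg2 (rcons h b) by rewrite mulr_gt0.
  move=> z0 hj; have [i [ij ic]] : exists i, i <> j /\
      uc * (prior j * lik j (rcons h b)) <= 2 * (prior i * lik i (rcons h b)).
    apply: contrapT => nex.
    have H i : i <> j -> 2 * (prior i * lik i (rcons h b)) < uc * (prior j * lik j (rcons h b)).
      by move=> ij; rewrite ltNge; apply/negP => hi; apply: nex; exists i.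
    move: H hj; case: (j) => H.
    - have := H dg1 ltac:(by []); have := H dg2 ltac:(by []); move: a0 a1 a2.
      move: (prior df * _) (prior dg1 * _) (prior dg2 * _) => x y z x0 y0 z0' h1 h2 h3.
      have : 0 < uc * y by rewrite mulr_gt0. have : 0 < uc * z by rewrite mulr_gt0. lra.
    - have := H df ltac:(by []); have := H dg2 ltac:(by []); move: a0 a1 a2.
      move: (prior df * _) (prior dg1 * _) (prior dg2 * _) => x y z x0 y0 z0' h1 h2 h3.
      have : 0 < uc * x by rewrite mulr_gt0. have : 0 < uc * z by rewrite mulr_gt0. lra.
    - have := H df ltac:(by []); have := H dg1 ltac:(by []); move: a0 a1 a2.
      move: (prior df * _) (prior dg1 * _) (prior dg2 * _) => x y z x0 y0 z0' h1 h2 h3.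
      have : 0 < uc * x by rewrite mulr_gt0. have : 0 < uc * y by rewrite mulr_gt0. lra.
  exists i; split=> //.
  by apply: (llr_lower uc0 (prior_gt0 j) (prior_gt0 i)).
apply: (pace_low (i := i)) => //; first exact: others_ge0.
exact: others_neq.
Qed.

(** The right side is the potential at the empty history, where all likelihood ratios are 1: the two
    wrong densities sum to 2 and [odds_bound] equals uc / prior j. *)
Lemma two_stage_expected_le : (expected_time (P j) delta <=
  ((ln 2 + t * (- ln c + Kbound) + D) / l1 + (ln 2 + t * (- ln uc + Kbound) + D) / l0 +
   (2 + (t * (- ln c + Kbound) + D) * (uc / prior j)) / l0)%:E)%E.
Proof.
apply: (expected_le iidX) => r.
have o0 := @opponent_ge0 R j; have n0 := @others_ge0 R j.
have E : potential (pace (opponent j)) (pace (others j)) odds_bound phase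
  (t * (- ln c + Kbound)) (t * (- ln uc + Kbound)) D l0 l1 [::] =
  (ln 2 + t * (- ln c + Kbound) + D) / l1 + (ln 2 + t * (- ln uc + Kbound) + D) / l0 +
   (2 + (t * (- ln c + Kbound) + D) * (uc / prior j)) / l0.
  have l00 i : llr [::] i = 0 by rewrite /llr !(hprob_nil iidX) subrr.
  have p2 : pace (others j) [::] = 2.
    by rewrite /pace /exp_sum !l00 mulr0 expR0 !mulr1 others_sum.
  have ob : odds_bound [::] = uc / prior j.
    by rewrite /odds_bound /evidence !(hprob_nil iidX) !mulr1 prior_sum mul1r.
  by rewrite /potential /first_potential /= p2 ob.
rewrite -E; apply: (@le_potential R (kern j) (pace (opponent j)) (pace (others j)) odds_bound
  phase (stops delta) alive (t * (- ln c + Kbound)) (t * (- ln uc + Kbound)) D l0 l1) => //.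
- by move=> h; exact: kern01.
- by move=> h; exact: kern_false.
- by rewrite mulr_ge0 ?(ltW t0)// addr_ge0// oppr_ge0 ln_le0// ltW.
- by rewrite ler_pM2l// lerD2r lerN2 ler_ln.
- by move=> h; have [i i1] := @opponent_exists R j; apply: (pace_gt0 (i := i)); rewrite ?i1.
- by move=> h; apply: exp_sum_le; exact: opponent_le.
- by move=> h _; apply: pace_step => // i /others_gt0; exact: tilted0.
- move=> h b; rewrite /phase; case e: (st h).2 => [d|] //= [<-].
  apply: pace_step => // i oi; rewrite e /rate; case: asboolP => [->|_]; first exact: tilted1.
  by apply: tilted0; exact: opponent_neq oi.
- by move=> h b; exact: pace_rcons.
- by move=> h b; exact: pace_rcons.
- by move=> h; rewrite /mean_run big_ord0.
- by move=> r' h; rewrite mean_run_S.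
Qed.

End two_stage_potential.

(** * Asymptotics of the two-stage test *)

Section upper_asymptotics.
Context {R : realType}.

(** Here L is |log c|, x is |log u(c)| and u is u(c). The summands are the constants, the first
    stage, and the wrong preliminary decision. *)
Lemma small_remainder (g a b C1 C2 : R) : 0 < g -> 0 <= a -> 0 <= b -> 0 <= C1 -> 0 <= C2 ->
  exists2 h : R, 0 < h <= 1 & exists M : R, forall x L u,
    x <= h * L -> 0 <= u <= h -> M <= L -> C1 + a * x + b * u * (L + C2) <= g * L.
Proof.
move=> g0 a0 b0 C10 C20; pose h := Num.min 1 (g / (3 * (a + b + 1))).
have ab : 0 < 3 * (a + b + 1) by lra.
have h0 : 0 < h by rewrite lt_min ltr01 divr_gt0.
have h1 : h <= 1 by rewrite ge_min lexx.
have hg : h * (3 * (a + b + 1)) <= g by rewrite -ler_pdivlMr// ge_min lexx orbT.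
exists h; first by rewrite h0.
exists (3 * (C1 + b * C2) / g) => x L u xL /andP[u0 uh]; rewrite ler_pdivrMr// => ML.
have bC : 0 <= b * C2 by rewrite mulr_ge0.
have L0 : 0 <= L by rewrite -(pmulr_lge0 _ g0); lra.
have s1 : a * x <= a * (h * L) by rewrite ler_wpM2l.
have s2 : b * u * (L + C2) <= b * h * (L + C2).
  by rewrite ler_wpM2r ?addr_ge0// ler_wpM2l.
have s3 : h * (b * C2) <= b * C2 by rewrite ler_piMl.
have s4 : h * (3 * (a + b + 1)) * L <= g * L by rewrite ler_wpM2r.
have s5 : 0 <= h * L by rewrite mulr_ge0// ltW.
have s6 : 0 <= g * L by rewrite mulr_ge0// ltW.
clearbody h; move: s1 s2 s3 s4 s5 s6 ML; clear; lra.
Qed.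

Lemma message_kl_f lamstar i : 0 < opponent df i :> R ->
  kl (message_prob lamstar (Some df) true df) (message_prob lamstar (Some df) true i) = info_f R.
Proof.
move=> oi; rewrite !message_prob_true /threshold !subr0 info_fE.
have e : 1 - gcdf 0 = gcdf 0 :> R by rewrite gcdf0; lra.
case: i oi => [|_|_]; rewrite /opponent ?ltxx /mean ?gcdfN; first by [].
  by rewrite e.
by rewrite kl_compl.
Qed.

Lemma message_kl_g (lamstar : R) j i : attains_info_g lamstar -> j <> df -> 0 < opponent j i :> R ->
  kl (message_prob lamstar (Some j) true j) (message_prob lamstar (Some j) true i) = info_g R.
Proof.
rewrite /attains_info_g => <- jf oi; rewrite !message_prob_true !tail_probE.
case: j jf oi => [/(_ erefl) []|_|_]; case: i; rewrite /opponent /threshold ?ltxx => oi;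
  try by exfalso.
  rewrite -kl_compl -!gcdfN; rewrite /mean; congr (kl (gcdf _) (gcdf _)); ring.
by [].
Qed.

End upper_asymptotics.

Section two_stage_asymptotics.
Context {R : realType} {disp : measure_display} {Omega : measurableType disp}.
Variables (P : density -> probability Omega R) (X : nat -> Omega -> R).
Hypothesis iidX : iid_normal P X.
Variables (prior W : density -> R) (u : R -> R) (lamstar : R).
Hypothesis prior_gt0 : forall j, 0 < prior j.
Hypothesis prior_sum : prior df + prior dg1 + prior dg2 = 1.
Hypothesis W_gt0 : forall j, 0 < W j.
Hypothesis u01 : \forall c \near (0:R)^'+, 0 < u c < 2^-1.
Hypothesis u_cvg : u c @[c --> (0:R)^'+] --> (0:R).
Hypothesis ln_u_cvg : ln (u c) / ln c @[c --> (0:R)^'+] --> (0:R).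

Local Notation delta := (delta_I prior W lamstar X u).

(** The errors are even O(c), which brings the test under the general lower bounds. *)
Lemma delta_I_errors : exists2 k : R, 0 < k & forall j, \forall c \near (0:R)^'+,
  fine (P j (incorrect (delta c) j)) <= k * (c * - ln c).
Proof.
pose A j := prior j * W j; have A0 j : 0 < A j by rewrite mulr_gt0.
have [k kE] : exists k, k = (A dg1 + A dg2) / A df + A df / A dg1 + A df / A dg2 by eexists.
have k0 : 0 < k by rewrite kE !addr_gt0// divr_gt0// addr_gt0.
exists k => // j; near=> c.
have [c0 c1 L] : [/\ 0 < c, c < 1 & 1 <= - ln c] by near: c; exact: near0_ln.
have c01 : 0 < c < 1 by rewrite c0.
apply: le_trans (two_stage_error iidX lamstar (u c) prior_gt0 prior_sum W_gt0 c01 j) _.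
by rewrite -[X in X * c]kE ler_pM2l// ler_peMr// ltW.
Unshelve. all: by end_near. Qed.

Lemma near_u (h : R) : 0 < h -> \forall c \near (0:R)^'+,
  [/\ 0 < u c, u c <= h, u c < 1 & - ln (u c) <= h * - ln c].
Proof.
move=> h0; near=> c.
have [c0 c1 L] : [/\ 0 < c, c < 1 & 1 <= - ln c] by near: c; exact: near0_ln.
have /andP[uc0 uc1] : 0 < u c < 2^-1 by near: c.
have : `|0 - u c| <= h by near: c; move/cvgrPdist_le : u_cvg; exact.
rewrite sub0r normrN gtr0_norm// => uh.
have : `|0 - ln (u c) / ln c| <= h by near: c; move/cvgrPdist_le : ln_u_cvg; exact.
rewrite sub0r normrN => lh; have lc : ln c < 0 by lra.
split=> //; first by lra.
move: lh => /(le_trans (ler_norm _)); rewrite ler_ndivrMr//; lra.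
Unshelve. all: by end_near. Qed.

Lemma delta_I_upper j (I : R) : 0 < I ->
  (forall i, 0 < opponent j i :> R -> kl (message_prob lamstar (Some j) true j)
      (message_prob lamstar (Some j) true i) = I) ->
  forall e : R, 0 < e -> \forall c \near (0:R)^'+,
    (expected_time (P j) (delta c) <= ((1 + e) * (`|ln c| / I))%:E)%E.
Proof.
(* With this f, 1 / (1 - f) = 1 + e/2, which leaves e/2 for the terms of lower order. *)
move=> I0 HI e e0; pose f := e / (2 + e).
have fE : 1 - f = 2 / (2 + e) by rewrite /f; field; lra.
have f0 : 0 < f by rewrite divr_gt0//; lra.
have f1 : 0 < 1 - f by rewrite fE divr_gt0//; lra.
(* The exponent is chosen before c, so [D], [l0] and [l1] below are constants; in the leading term t
   / l1 it cancels. *)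
have [t [ht t0]] := filter_ex (filterI (near_tilted lamstar f0) (nbhs_right_gt (0 : R))).
have [D1 D10 hD] := mllr_bound lamstar.
have [k k0 hk] := kl_message_min lamstar.
have [K1 K10 hK1] := density_bound (fun j => ln (prior j)).
have [K2 K20 hK2] := density_bound (fun j => ln (prior j * W j)).
have [i0 i01] := @opponent_exists R j.
have kI : k <= I by rewrite -(HI i0) ?i01// hk//; apply: (@opponent_neq R); rewrite i01.
pose K := Kbound (K1 + K2); pose D := t * D1.
pose l0 := t * ((1 - f) * k); pose l1 := t * ((1 - f) * I).
have l00 : 0 < l0 by rewrite !mulr_gt0.
have l10 : 0 < l1 by rewrite !mulr_gt0.
have l20 : 0 <= ln 2 :> R by rewrite ln_ge0//; lra.
have K0 : 0 <= K by rewrite addr_ge0// mulr_ge0// addr_ge0.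
have D0 : 0 <= D by rewrite mulr_ge0// ltW.
have tK : 0 <= t * K by rewrite mulr_ge0// ltW.
have [h h01 [M hM]] := @small_remainder R (e / 2 / I) (t / l0) (t / l0 / prior j)
  ((ln 2 + t * K + D) / l1 + (ln 2 + t * K + D) / l0 + 2 / l0) (K + D / t)
  ltac:(by rewrite !divr_gt0) ltac:(by rewrite divr_ge0// ltW) ltac:(by rewrite !divr_ge0// ltW)
  ltac:(by rewrite !addr_ge0// divr_ge0// ?addr_ge0// ltW) ltac:(by rewrite addr_ge0// divr_ge0// ltW).
have [h0 h1] := andP h01.
near=> c.
have [c0 c1 L] : [/\ 0 < c, c < 1 & `|M| + 1 <= - ln c] by near: c; exact: near0_ln.
have [uc0 uh uc1 lu] : [/\ 0 < u c, u c <= h, u c < 1 & - ln (u c) <= h * - ln c].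
  by near: c; exact: near_u.
have L0 : 0 <= - ln c by have := normr_ge0 M; lra.
have ML : M <= - ln c by have := ler_norm M; lra.
have cu : c <= u c.
  have hL : h * - ln c <= - ln c by rewrite ler_piMl.
  by rewrite -ler_ln ?posrE//; move: lu hL; move: (ln c) (ln (u c)) => x y; lra.
have B := @two_stage_expected_le _ _ _ P X iidX prior W lamstar (u c) c prior_gt0 prior_sum
  W_gt0 c0 cu uc1 j t D (K1 + K2) l0 l1 t0.
apply: le_trans (B _ _ _ _ _ _ _ _) _ => //.
- by move=> i; have := hK1 i; lra.
- by move=> i; have := hK2 i; lra.
- by move=> v b i; rewrite normrM gtr0_norm// ler_pM2l.
- by rewrite ler_pM2l// ler_pM2l.
- move=> v i ij; apply: le_trans (ht v i j ij) _.
  by rewrite ler_expR lerN2 !ler_pM2l// hk.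
- by move=> i oi; have := ht (Some j) i j (opponent_neq oi); rewrite HI.
rewrite lee_fin -/K; have u0h : 0 <= u c <= h by rewrite uh ltW.
have := hM (- ln (u c)) (- ln c) (u c) lu u0h ML.
rewrite ler0_norm; last by lra.
have E : t / l1 = (1 + e / 2) / I.
  by rewrite /l1 fE; field; rewrite !gt_eqF//; lra.
move: (- ln c) (- ln (u c)) (u c) => x y z h2.
apply: (@le_trans _ _ ((1 + e / 2) / I * x + e / 2 / I * x)); last first.
  by rewrite le_eqVlt; apply/orP; left; apply/eqP; field; rewrite gt_eqF.
rewrite -E; apply: le_trans (lerD (lexx _) h2).
rewrite le_eqVlt; apply/orP; left; apply/eqP.
have p0 := prior_gt0 j.
field; rewrite !gt_eqF//.
Unshelve. all: by end_near. Qed.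

End two_stage_asymptotics.

Theorem theorem1 (R : realType) (disp : measure_display)
    (Omega : measurableType disp) (P : density -> probability Omega R)
    (X : nat -> Omega -> R) (iidX : iid_normal P X) :
  (forall delta : R -> seq_test X,
     (forall j : density,
        ((fun c : R => fine (P j (incorrect (delta c) j))) : R -> R^o)
          =O_ ((0:R)^'+) ((fun c : R => c * ln c) : R -> R^o)) ->
     [/\ asymp_ge (fun c => expected_time (P df) (delta c))
           (fun c => `|ln c| / info_f R),
         asymp_ge (fun c => expected_time (P dg1) (delta c))
           (fun c => `|ln c| / info_g R) &
         asymp_ge (fun c => expected_time (P dg2) (delta c))
           (fun c => `|ln c| / info_g R)])
  /\
  (forall (prior W : density -> R) (u : R -> R) (lamstar : R),
     (forall j, 0 < prior j) ->
     prior df + prior dg1 + prior dg2 = 1 ->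
     (forall j, 0 < W j) ->
     (\forall c \near (0:R)^'+, 0 < u c < 2^-1) ->
     u c @[c --> (0:R)^'+] --> (0:R) ->
     ln (u c) / ln c @[c --> (0:R)^'+] --> (0:R) ->
     attains_info_g lamstar ->
     [/\ asymp_eq (fun c => expected_time (P df) (delta_I prior W lamstar X u c))
           (fun c => `|ln c| / info_f R),
         asymp_eq (fun c => expected_time (P dg1) (delta_I prior W lamstar X u c))
           (fun c => `|ln c| / info_g R) &
         asymp_eq (fun c => expected_time (P dg2) (delta_I prior W lamstar X u c))
           (fun c => `|ln c| / info_g R)]).
Proof.
have a0 (I : R) : 0 < I -> \forall c \near (0:R)^'+, 0 < `|ln c| / I.
  move=> I0; near=> c.
  have [c0 c1 _] : [/\ 0 < c, c < 1 & 0 <= - ln c] by near: c; exact: near0_ln.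
  by rewrite divr_gt0// normr_gt0 lt_eqF// ln_lt0// c0.
have f0 := a0 _ (@info_f_gt0 R); have g0 := a0 _ (@info_g_gt0 R).
split=> [delta /error_level_of_bigO[k k0 err]|prior W u lamstar p0 p1 W0 u01 uc lu al].
  by split; [exact: (asymp_ge_f iidX k0)|exact: (asymp_ge_g iidX k0)|exact: (asymp_ge_g iidX k0)].
have [k k0 err] := delta_I_errors iidX u lamstar p0 p1 W0.
have H := delta_I_upper iidX p0 p1 W0 u01 uc lu.
split; apply: asymp_eq_of_ge => //.
- exact: (asymp_ge_f iidX k0).
- by apply: H; [exact: info_f_gt0|exact: message_kl_f].
- exact: (asymp_ge_g iidX k0).
- by apply: H; [exact: info_g_gt0|move=> i; exact: message_kl_g].
- exact: (asymp_ge_g iidX k0).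
- by apply: H; [exact: info_g_gt0|move=> i; exact: message_kl_g].
Unshelve. all: by end_near. Qed.
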